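(* Assume that $f,a,B$ are Lipschitz continuous on the torus $\mathcal X$ and that there exists $\alpha\in L^\infty(\mathcal X;\mathbb R^m)$ such that $a(x)=B(x)\alpha(x)$ for all $x\in\mathcal X$. Consider the problems $$\text{(P)}\quad \inf_{\nu\in\mathcal M_+(\mathcal X\times\mathbb R^m)}\iint_{\mathcal X\times\mathbb R^m}(f(x)+R(u))\,\nu(\mathrm dx,\mathrm du)\quad\text{such that}\quad \mathcal L^*\nu=\mu_0,$$ $$\text{(D)}\quad \sup_{V\in C^1(\mathcal X)}\int_{\mathcal X}V(x)\mu_0(x)\,\mathrm dx\quad\text{such that}\quad \mathcal L V(x,u)\le f(x)+R(u)\ \ \forall (x,u)\in\mathcal X\times\mathbb R^m.$$ Then: (1) (P) and (D) are feasible, (D) is the Lagrange dual of (P), and $\mathrm{val}(P)\ge \mathrm{val}(D)\ge\int_{\mathcal X}V^*(x)\mu_0(x)\,\mathrm dx$. (2) Strong duality holds: $\mathrm{val}(P)=\mathrm{val}(D)$. (3) Their common value is $\mathrm{val}(P)=\mathrm{val}(D)=\int_{\mathcal X}V^*(x)\mu_0(x)\,\mathrm dx$.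
   Context: Setting. $d,m\ge1$ are integers, $\rho>0$, $q\in(1,2]$, and $q'\in[2,\infty)$ satisfies $1/q+1/q'=1$; $\|\cdot\|$ is the Euclidean norm. $\mathcal X=[0,1]^d$ denotes the $d$-dimensional torus (functions on $\mathcal X$ are 1-periodic in each coordinate). $f:\mathcal X\to\mathbb R_+$, $a:\mathcal X\to\mathbb R^d$, $B:\mathcal X\to\mathbb R^{d\times m}$, $b(x,u)=a(x)+B(x)u$, $R(u)=\|u\|^q/q$. The optimal value function is $$V^*(x)=\inf_{u:\mathbb R_+\to\mathbb R^m}\rho\int_0^{\infty}e^{-\rho t}(f(x_t)+R(u_t))\,\mathrm dt,\qquad \dot x_t=a(x_t)+B(x_t)u_t,\ x_0=x,$$ the infimum being over measurable controls. $\mu_0$ is a probability measure on $\mathcal X$ with full support and a bounded density with respect to Lebesgue measure, also denoted $\mu_0$. $\mathcal M_+(\mathcal X\times\mathbb R^m)$ is the set of non-negative finite Borel measures on $\mathcal X\times\mathbb R^m$ with compact support. The operator $\mathcal L:C^1(\mathcal X)\to C(\mathcal X\times\mathbb R^m)$ is $\mathcal L\varphi(x,u)=\varphi(x)-\frac1\rho\nabla\varphi(x)^\top b(x,u)$, and $\mathcal L^*$ is its dual: $\mathcal L^*\nu=\mu_0$ means $\iint\mathcal L\varphi\,\mathrm d\nu=\int_{\mathcal X}\varphi\mu_0\,\mathrm dx$ for all $\varphi\in C^1(\mathcal X)$. ''(D) is the Lagrange dual of (P)'' refers to the Lagrangian $\iint(f+R)\,\mathrm d\nu+\int_{\mathcal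 X} V\mu_0\,\mathrm dx-\iint\mathcal LV\,\mathrm d\nu$ with multiplier $V\in C^1(\mathcal X)$. $\mathrm{val}(\cdot)$ denotes the optimal value of a problem. *)

(* Defs.v *)
From HB Require Import structures.
From mathcomp Require Import all_boot all_order all_algebra.
From mathcomp Require Import all_classical all_reals all_analysis.
Import Order.TTheory GRing.Theory Num.Theory.
Import numFieldNormedType.Exports.

Set Implicit Arguments.
Unset Strict Implicit.
Unset Printing Implicit Defensive.

Local Open Scope classical_set_scope.
Local Open Scope ring_scope.

(* R^n with its Borel sigma-algebra; as a type it is 'cV[R]_n. *)
Notation Rvec R n := (g_sigma_algebraType (@open 'cV[R]_n)).

Section LebesgueTorus.
Variable R : realType.

Lemma open_rat_balls n (U : set 'cV[R]_n) : open U ->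
  U = \bigcup_(p in [set p : 'cV[rat]_n * nat |
        ball (map_mx ratr p.1 : 'cV[R]_n) p.2.+1%:R^-1 `<=` U])
      ball (map_mx ratr p.1 : 'cV[R]_n) p.2.+1%:R^-1.
Proof.
move=> oU; apply/seteqP; split => [y Uy|y [p /= pU yp]]; last exact: pU.
have /nbhs_ballP[e /= e0 eU] : nbhs y U by apply: open_nbhs_nbhs.
have [k] := ltr_add_invr (divr_gt0 e0 (ltr0n _ 2)); rewrite add0r => ke.
have k0 : (0 : R) < k.+1%:R^-1 by rewrite invr_gt0 ltr0n.
have /choice[r yr] : forall i : 'I_n, exists r : rat,
    ratr r \in `](y i ord0 - k.+1%:R^-1), (y i ord0 + k.+1%:R^-1)[.
  by move=> i; apply: rat_in_itvoo; rewrite ltrD2l (lt_trans _ k0)// oppr_lt0.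
have ry : ball (map_mx ratr (\col_i r i) : 'cV[R]_n) k.+1%:R^-1 y.
  split=> // i j; rewrite (ord1 j) !mxE /ball/= distrC ltr_distlC.
  by have := yr i; rewrite in_itv /= => /andP[-> ->].
exists (\col_i r i, k) => //= z rz; apply: eU.
rewrite (splitr e); apply: (@le_ball _ _ _ (k.+1%:R^-1 + k.+1%:R^-1)).
  by rewrite lerD// ltW.
exact: ball_triangle (ball_sym ry) rz.
Qed.

Definition vcons n (z : measurableTypeR R * Rvec R n) : Rvec R n.+1 :=
  \col_i oapp (fun j => (z.2 : 'cV[R]_n) j ord0) z.1 (unlift ord0 i).

Lemma measurable_vcons n : measurable_fun setT (@vcons n).
Proof.
apply: (@measurability _ _ _ (Rvec R n.+1) setT (@vcons n) (@open 'cV[R]_n.+1)) => // _ [U oU <-]; rewrite setTI.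
rewrite (open_rat_balls oU) preimage_bigcup.
rewrite bigcup_mkcond; apply: countable_bigcupT_measurable => [|[q k]]; first exact: countableP.
case: ifPn => // _ /=.
have k0 : (0 : R) < k.+1%:R^-1 by rewrite invr_gt0 ltr0n.
rewrite [X in measurable X](_ : _ =
  ball (ratr (q ord0 ord0) : R) k.+1%:R^-1 `*`
  (ball (\col_i ratr (q (lift ord0 i) ord0) : 'cV[R]_n) k.+1%:R^-1 : set (Rvec R n))).
  apply: measurableX; first exact: measurable_realfun.measurable_ball.
  apply: sub_sigma_algebra; exact: ball_open.
apply/seteqP; split => -[x y] /=.
  move=> [_ h]; split; first by have := h ord0 ord0; rewrite /vcons !mxE unlift_none.
  split=> // i j; have := h (lift ord0 i) ord0.
  by rewrite /vcons !mxE liftK (ord1 j).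
move=> [h1 [_ h2]]; split=> // i j; rewrite /vcons !mxE.
case: unliftP => [i' ->|->] /=; last by rewrite (ord1 j).
by have := h2 i' ord0; rewrite !mxE (ord1 j).
Qed.

HB.instance Definition _ n := isMeasurableFun.Build _ _ _ _ (@vcons n) (@measurable_vcons n).

(* Lebesgue measure on the fundamental domain of R^n / Z^n (the law of n
   independent uniform coordinates; see torus_leb_box).  It is carried by the
   unit cube, so integrating a 1-periodic function against it is integrating
   over the torus. *)
Fixpoint torus_leb n : probability (Rvec R n) R :=
  match n return probability (Rvec R n) R with
  | 0 => dirac (0 : Rvec R 0)
  | n'.+1 => distribution (uniform_prob (@ltr01 R) \x torus_leb n')%E (@vcons n')
  end.


Lemma measurable_coord n (i : 'I_n) :
  measurable_fun setT (fun x : Rvec R n => (x : 'cV[R]_n) i ord0).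
Proof.
apply: (@measurability _ _ (Rvec R n) R setT _ _ (measurable_realfun.RGenOpens.measurableE R)).
move=> _ [_ [a [b ->]] <-]; rewrite setTI; apply: sub_sigma_algebra.
have /continuousP := @coord_continuous R n 1 i ord0; apply.
exact: itv_open.
Qed.

Lemma measurable_box n (A : 'I_n -> set R) : (forall i, measurable (A i)) ->
  measurable ([set x : 'cV[R]_n | forall i, A i (x i ord0)] : set (Rvec R n)).
Proof.
move=> mA; rewrite (_ : [set x : 'cV[R]_n | _] =
    \bigcap_(i : 'I_n) ((fun x : Rvec R n => (x : 'cV[R]_n) i ord0) @^-1` A i)).
  apply: fin_bigcap_measurable => // i _; rewrite -[X in measurable X]setTI.
  exact: measurable_coord.
by apply/seteqP; split => x /= Ax i; [move=> _; exact: Ax|exact: Ax].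
Qed.

Lemma torus_leb_box n (A : 'I_n -> set R) : (forall i, measurable (A i)) ->
  (torus_leb n [set x : 'cV[R]_n | forall i, A i (x i ord0)] =
   \prod_(i < n) lebesgue_measure (A i `&` `[0%R, 1%R]))%E.
Proof.
elim: n => [|n IH] in A * => mA.
  rewrite (_ : [set x : 'cV[R]_0 | _] = setT); last first.
    by apply/seteqP; split => // x _ [].
  by rewrite probability_setT big_ord0.
rewrite big_ord_recl -IH; last by move=> i; exact: mA.
rewrite [LHS]/= /distribution /pushforward.
rewrite [X in product_measure1 _ _ X](_ : _ = A ord0 `*`
    [set x : 'cV[R]_n | forall i, A (lift ord0 i) (x i ord0)]); last first.
  apply/seteqP; split => -[x y] /=.
    move=> h; split; first by have := h ord0; rewrite /vcons !mxE unlift_none.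
    by move=> i; have := h (lift ord0 i); rewrite /vcons !mxE liftK.
  move=> [h1 h2] i; rewrite /vcons !mxE; case: unliftP => [j ->|->] //=.
rewrite [LHS]product_measure1E//; last exact: (@measurable_box n (fun i => A (lift ord0 i))).
congr (_ * _)%E; transitivity
    (\int[lebesgue_measure]_(x in A ord0) (uniform_pdf 0 1 x)%:E)%E => //.
rewrite integral_uniform_pdf.
rewrite (eq_integral (cst 1%E)) ?integral_cst ?mul1e//; last first.
  by move=> x; rewrite inE /uniform_pdf /= in_itv/= => -[_ ->]; rewrite subr0 invr1.
  exact: (@measurableI _ R _ _ (mA ord0) (measurable_itv `[0%R, 1%R])).
exact: mA.
Qed.
End LebesgueTorus.

Section Vectors.
Variable R : realType.

(* Functions, and subsets (T := Prop), of the torus R^d / Z^d are identified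
   with the 1-periodic functions, and subsets, of R^d. *)
Definition Zperiodic d (T : Type) (g : 'cV[R]_d -> T) :=
  forall (x : 'cV[R]_d) (i : 'I_d), g (x + delta_mx i ord0) = g x.

Definition dotv n (u v : 'cV[R]_n) : R := \sum_(i < n) u i ord0 * v i ord0.

Definition enorm n (u : 'cV[R]_n) : R := Num.sqrt (dotv u u).

Definition grad d (phi : 'cV[R]_d -> R) (x : 'cV[R]_d) : 'cV[R]_d :=
  \col_i 'D_(delta_mx i ord0) phi x.

Definition C1_torus d : set ('cV[R]_d -> R) :=
  [set phi | [/\ Zperiodic phi, (forall x, differentiable phi x)
                & continuous (grad phi)]].

(* A density is a function on the torus; full support means that it gives
   positive mass to every nonempty open subset of the torus. *)
Definition full_support_bounded_density d (mu0 : 'cV[R]_d -> R) :=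
  [/\ Zperiodic mu0,
      measurable_fun setT (mu0 : Rvec R d -> R),
      (forall x, 0 <= mu0 x),
      (exists M, forall x, mu0 x <= M)
    & (\int[torus_leb R d]_x (mu0 x)%:E = 1)%E] /\
  (forall U : set 'cV[R]_d, open U -> Zperiodic U -> U !=set0 ->
     (0 < \int[torus_leb R d]_(x in U) (mu0 x)%:E)%E).

Definition Linfty_torus d m (alpha : 'cV[R]_d -> 'cV[R]_m) :=
  [/\ Zperiodic alpha,
      measurable_fun setT (alpha : Rvec R d -> Rvec R m)
    & exists M, {ae torus_leb R d, forall x, enorm (alpha x) <= M}].

(* One representative of each point of the torus. *)
Definition unit_cube d : set 'cV[R]_d :=
  [set x | forall i, 0 <= x i ord0 < 1].

(* A Borel measure on (torus x R^m) is a Borel measure on R^d x R^m carried by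
   unit_cube x R^m.  The torus being compact, its support is compact iff it is
   carried by unit_cube x K with K compact. *)
Definition Mplus d m :
    set {finite_measure set (Rvec R d * Rvec R m)%type -> \bar R} :=
  [set nu | exists K : set 'cV[R]_m, compact K /\
     nu (~` (unit_cube (d := d) `*` K)) = 0%E].

End Vectors.

Section Problem.
Variables (R : realType) (d m : nat) (rho q : R).
Variables (f : 'cV[R]_d -> R) (a : 'cV[R]_d -> 'cV[R]_d).
Variables (B : 'cV[R]_d -> 'M[R]_(d, m)) (mu0 : 'cV[R]_d -> R).

Implicit Types (x : 'cV[R]_d) (u : 'cV[R]_m) (V phi : 'cV[R]_d -> R).
Implicit Type nu : {finite_measure set (Rvec R d * Rvec R m)%type -> \bar R}.

Definition drift x u : 'cV[R]_d := a x + B x *m u.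

Definition ctrl_cost u : R := enorm u `^ q / q.

Definition calL phi x u : R :=
  phi x - rho^-1 * dotv (grad phi x) (drift x u).

(* Caratheodory solutions: with measurable controls, the state equation is
   understood in integrated form. *)
Definition trajectory x (u : R -> 'cV[R]_m) (y : R -> 'cV[R]_d) :=
  forall t : R, 0 <= t -> forall i : 'I_d,
    lebesgue_measure.-integrable `[0, t]
      (fun s => (drift (y s) (u s) i ord0)%:E) /\
    y t i ord0 = x i ord0 +
      \int[lebesgue_measure]_(s in `[0, t]) drift (y s) (u s) i ord0.

Definition ocp_cost (u : R -> 'cV[R]_m) (y : R -> 'cV[R]_d) : \bar R :=
  (rho%:E * \int[lebesgue_measure]_(t in `[0%R, +oo[)
     (expR (- (rho * t)) * (f (y t) + ctrl_cost (u t)))%:E)%E.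

(* A control that admits no trajectory is not locally integrable, hence has
   infinite running cost (q > 1): leaving it out does not change the
   infimum. *)
Definition Vstar x : \bar R :=
  ereal_inf [set c | exists (u : R -> 'cV[R]_m) (y : R -> 'cV[R]_d),
    [/\ measurable_fun (`[0, +oo[ : set R) (u : R -> Rvec R m),
        trajectory x u y & c = ocp_cost u y]].

Definition int_Vstar : \bar R :=
  (\int[torus_leb R d]_x (Vstar x * (mu0 x)%:E))%E.

Definition primal_obj nu : \bar R :=
  (\int[nu]_z (f z.1 + ctrl_cost z.2)%:E)%E.

Definition dual_obj V : \bar R :=
  (\int[torus_leb R d]_x (V x * mu0 x)%:E)%E.

Definition int_calL nu phi : \bar R :=
  (\int[nu]_z (calL phi z.1 z.2)%:E)%E.

Definition primal_feasible :
    set {finite_measure set (Rvec R d * Rvec R m)%type -> \bar R} :=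
  [set nu | Mplus nu /\
     forall phi, C1_torus phi -> int_calL nu phi = dual_obj phi].

Definition dual_feasible : set ('cV[R]_d -> R) :=
  [set V | C1_torus V /\ forall x u, calL V x u <= f x + ctrl_cost u].

Definition val_P : \bar R := ereal_inf [set primal_obj nu | nu in primal_feasible].

Definition val_D : \bar R := ereal_sup [set dual_obj V | V in dual_feasible].

Definition lagrangian nu V : \bar R :=
  (primal_obj nu + dual_obj V - int_calL nu V)%E.

Definition dual_function V : \bar R :=
  ereal_inf [set lagrangian nu V | nu in @Mplus R d m].

(* (D) is the maximisation over C^1 of the dual function, whose value -oo
   encodes the violation of the constraint of (D). *)
Definition lagrange_dual :=
  forall V, C1_torus V ->
    dual_function V = if `[< dual_feasible V >] then dual_obj V else -oo%E.

End Problem.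

(* Main.v *)
From HB Require Import structures.
Require Import Defs.
From mathcomp Require Import all_boot all_order all_algebra.
From mathcomp Require Import all_classical all_reals all_analysis.
From mathcomp Require Import measurable_realfun.
From mathcomp Require Import ring lra.
Import Order.TTheory GRing.Theory Num.Theory.
Import numFieldNormedType.Exports.

Set Implicit Arguments.
Unset Strict Implicit.
Unset Printing Implicit Defensive.

Local Open Scope classical_set_scope.
Local Open Scope ring_scope.

(** Why the theorem holds.

    Let V* be the optimal value function.  Weak duality gives val(D) <= val(P),
    so that everything follows from  int V* mu0 <= val(D)  and
    val(P) <= int V* mu0.  Both come from the same auxiliary function.

    A plan is a finite list of stages (h, u): apply the constant control u
    during the time h.  Give it a cost that bounds from above the discounted
    cost of following the plan and then switching the control off, and let v
    (plan_value) be the infimum of the costs of all plans.  Plans are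
    admissible controls, hence V* <= v (Vstar_le_plan_value).  In the other
    direction, if U is feasible for (D) then along a trajectory
    d/dt (e^(-rho t) U(y_t)) = - rho e^(-rho t) (calL U)(y_t, u_t)
    >= - rho e^(-rho t) (f(y_t) + R(u_t)),
    and integration yields U <= V* (dual_feasible_le_Vstar).  The core of the
    proof is near_optimal_subsolution: for every eps some U feasible for (D)
    satisfies v <= U + eps.  Thus U <= V* <= v <= U + eps, so V* = v is a
    uniform limit of functions feasible for (D), and int V* mu0 <= val(D).

    To build U, note that putting one stage in front of a plan gives a plan,
    which is the one-sided dynamic programming inequality
    v(x) <= (1 - e^(-rho h)) (f(x) + O(h) + R(u)) + e^(-rho h) v(phi^u_h x)
    for the flow phi^u of the drift with constant control u: a subsolution
    property of v.  In general v is not Lipschitz, because nearby trajectories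
    may separate faster than the discount decays, so averaging v directly would
    leave an error that does not vanish.  First v is replaced by
    w(x) = sup_y (v(y) - th ln(1 + |x - y|/eta)).  The flow multiplies
    distances by at most exp(Lam(u) h), so it increases this logarithmic
    penalty by at most the additive amount th Lam(u) h, whatever the distance;
    since Lam(u) = L(1 + |u|) <= 2 L (1 + R(u)), q being larger than 1, the
    running cost absorbs it when th is small.  Only those y compete for which
    the penalty is at most max f, and eta is taken so small that such y are
    extremely close to x.  So w is an almost subsolution above v, and it is
    Lipschitz.  Averaging w over a small interval in each coordinate direction
    makes it C^1 with Lipschitz gradient, at the price of an error bounded by a
    small multiple of 1 + R(u) (smooth_subsolution); the affine change
    U = g/(1 + e) - e removes the errors.

    For the primal problem, every x has a plan of cost smaller than v(x) + e.
    By continuity and compactness of the torus finitely many plans suffice, and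
    taking the first one that works makes the choice measurable in x.  The image
    of the measure mu0(x) dx rho e^(-rho t) dt under (x, t) |-> (state at time
    t modulo Z^d, control at time t) has compact support, is feasible for (P) by
    the chain rule above, and costs at most int v mu0 + e
    (near_optimal_measure).

    The Lagrange dual function at V is computed by testing the measure 0 and,
    when V violates the constraint of (D) at some (x, u), large multiples of
    the Dirac mass at (x, u).

    Throughout, |x| is the sup norm of vectors; the Euclidean norm only enters
    through the control cost. *)

(** * Norms of vectors and functions on the torus *)

Section Vec.
Variable R : realType.

Lemma mxnorm_coord m n (A : 'M[R]_(m, n)) i j : `|A i j| <= `|A|.
Proof.
rewrite [leRHS]/Num.norm /= mx_normrE; apply/bigmax_geP; right => /=.
by exists (i, j).
Qed.

Lemma mxnorm_le m n (A : 'M[R]_(m, n)) (c : R) : 0 <= c ->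
  (forall i j, `|A i j| <= c) -> `|A| <= c.
Proof.
move=> c0 Ac; rewrite [leLHS]/Num.norm /= mx_normrE; apply/bigmax_leP; split => //.
Qed.

Lemma cvnorm_le n (u : 'cV[R]_n) (c : R) : 0 <= c ->
  (forall i, `|u i ord0| <= c) -> `|u| <= c.
Proof. by move=> c0 uc; apply: mxnorm_le => // i j; rewrite (ord1 j). Qed.

Lemma mulmx_norm m n (A : 'M[R]_(m, n)) (u : 'cV[R]_n) :
  `|A *m u| <= n%:R * `|A| * `|u|.
Proof.
apply: cvnorm_le => [|i]; first by rewrite !mulr_ge0.
rewrite mxE (le_trans (ler_norm_sum _ _ _))//.
rewrite (le_trans (ler_sum _ (_ : forall j, true -> _ <= `|A| * `|u|)))//.
  by move=> j _; rewrite normrM ler_pM// mxnorm_coord.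
by rewrite sumr_const card_ord -mulrA mulr_natl.
Qed.

Lemma norm_le_enorm n (u : 'cV[R]_n) : `|u| <= enorm u.
Proof.
apply: cvnorm_le => [|i]; first exact: sqrtr_ge0.
rewrite -sqrtr_sqr ler_wsqrtr// /dotv (bigD1 i)//= -expr2 lerDl.
by apply: sumr_ge0 => j _; rewrite -expr2 sqr_ge0.
Qed.

(** As q > 1 the control cost dominates the norm, so error terms that are linear
    in the control can be absorbed by the running cost. *)
Lemma norm_le_ctrl_cost n (q : R) (u : 'cV[R]_n) : 1 < q -> q <= 2 ->
  `|u| <= 1 + 2 * ctrl_cost q u.
Proof.
move=> q1 q2; apply: (le_trans (norm_le_enorm u)).
have e0 : 0 <= enorm u by exact: sqrtr_ge0.
have c0 : 0 <= ctrl_cost q u by rewrite divr_ge0 ?powR_ge0; lra.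
have [e1|e1] := leP (enorm u) 1; first by lra.
have : enorm u <= enorm u `^ q.
  by rewrite -[leLHS]powRr1// ler_powR; lra.
suff -> : enorm u `^ q = q * ctrl_cost q u by nra.
by rewrite /ctrl_cost mulrC divfK//; lra.
Qed.

(** Turns the library notion, a bound for all large enough constants, into one
    explicit positive constant. *)
Lemma lipschitzP (U W : normedModType R) (g : U -> W) : lipschitz g ->
  exists2 L, 0 < L & forall x y, `|g x - g y| <= L * `|x - y|.
Proof.
move=> [M [_ hM]]; exists (`|M| + 1); first by rewrite ltr_wpDl.
move=> x y; apply: (hM _ _ (x, y)) => //.
by rewrite (le_lt_trans (ler_norm M))// ltrDl.
Qed.

Section Torus.
Variable d : nat.
Implicit Types x : 'cV[R]_d.

Definition zvec (z : 'I_d -> int) : 'cV[R]_d := \col_i (z i)%:~R.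

Lemma Zperiodic_coord T (g : 'cV[R]_d -> T) : Zperiodic g ->
  forall x i (z : int), g (x + z%:~R *: delta_mx i ord0) = g x.
Proof.
move=> gp x i z.
have gn : forall (n : nat) x, g (x + n%:R *: delta_mx i ord0) = g x.
  elim=> [|n IH] y; first by rewrite scale0r addr0.
  by rewrite -natr1 scalerDl scale1r addrA gp IH.
case: z => n; first exact: gn.
by rewrite -[LHS](gn n.+1) NegzE intrN scaleNr subrK.
Qed.

Lemma Zperiodic_zvec T (g : 'cV[R]_d -> T) : Zperiodic g ->
  forall x z, g (x + zvec z) = g x.
Proof.
move=> gp x z.
have -> : zvec z = \sum_(i < d) (z i)%:~R *: delta_mx i ord0.
  apply/colP => i; rewrite mxE summxE (bigD1 i)//= big1 => [|j ji].
    by rewrite !mxE !eqxx mulr1 addr0.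
  by rewrite !mxE eq_sym (negbTE ji) mulr0.
have : forall (s : seq 'I_d) x,
  g (x + \sum_(i <- s) (z i)%:~R *: delta_mx i ord0) = g x.
  elim=> [|j s IH] y; first by rewrite big_nil addr0.
  by rewrite big_cons addrA IH Zperiodic_coord.
exact.
Qed.

Definition torus_rep x : 'cV[R]_d := \col_i (x i ord0 - (Num.floor (x i ord0))%:~R).

Lemma torus_repE x : torus_rep x = x + zvec (fun i => - Num.floor (x i ord0)).
Proof. by apply/colP => i; rewrite !mxE mulrNz. Qed.

Lemma Zperiodic_rep T (g : 'cV[R]_d -> T) : Zperiodic g ->
  forall x, g (torus_rep x) = g x.
Proof. by move=> gp x; rewrite torus_repE Zperiodic_zvec. Qed.

Lemma torus_rep_cube x : unit_cube (torus_rep x).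
Proof.
move=> i; rewrite mxE subr_ge0 ge_floor/= ltrBlDl.
by have := floorD1_gt (x i ord0); rewrite intrD.
Qed.

Lemma cube_norm x : unit_cube x -> `|x| <= 1.
Proof.
by move=> cx; apply: cvnorm_le => // i; have /andP[x0 /ltW x1] := cx i; rewrite ger0_norm.
Qed.

(** Every point of the torus has a representative within distance 1 of 0. *)
Lemma lip_periodic_bounded (W : normedModType R) (g : 'cV[R]_d -> W) L :
  Zperiodic g -> (forall x y, `|g x - g y| <= L * `|x - y|) -> 0 <= L ->
  forall x, `|g x| <= `|g 0| + L.
Proof.
move=> gp gL L0 x; rewrite -(Zperiodic_rep gp).
have := gL (torus_rep x) 0; rewrite subr0 => h.
rewrite -[X in `|X|](subrK (g 0)) (le_trans (ler_normD _ _))// addrC lerD2l.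
by rewrite (le_trans h)// ler_piMr// cube_norm//; exact: torus_rep_cube.
Qed.

End Torus.
End Vec.

(** * Integrals over segments and the Gronwall inequality *)

Section Calc.
Variable R : realType.
Notation mu := (@lebesgue_measure R).

Lemma cont_integrable (g : R -> R) a b : continuous g ->
  mu.-integrable `[a, b] (EFin \o g).
Proof.
move=> cg; apply: continuous_compact_integrable; first exact: segment_compact.
exact: continuous_subspaceT.
Qed.

Lemma FTC2 (g G : R -> R) a b : continuous g ->
  (forall x : R, is_derive x (1 : R) G (g x)) -> a <= b ->
  \int[mu]_(s in `[a, b]) g s = G b - G a.
Proof.
move=> cg dG; rewrite le_eqVlt => /predU1P[->|ab].
  by rewrite set_itv1 Rintegral_set1 subrr.
have cG : continuous G.
  by move=> x; apply: differentiable_continuous; apply/derivable1_diffP; exact: ex_derive.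
rewrite /Rintegral (@continuous_FTC2 _ g G)//.
- exact: continuous_subspaceT.
- split.
  + by move=> x _; exact: ex_derive.
  + exact/cvg_at_right_filter/cG.
  + exact/cvg_at_left_filter/cG.
- by move=> x _; rewrite derive1E; have [_ ->] := dG x.
Qed.

Lemma integral_split (g : R -> R) a b c : mu.-integrable `[a, c] (EFin \o g) ->
  a <= b -> b <= c ->
  \int[mu]_(s in `[a, c]) g s =
  \int[mu]_(s in `[a, b]) g s + \int[mu]_(s in `[b, c]) g s.
Proof.
move=> ig ab bc.
have ibc : mu.-integrable `]b, c] (EFin \o g).
  by apply: integrableS ig => //; apply: subset_itvr; rewrite bnd_simp.
rewrite -[in RHS](Rintegral_itv_obnd_cbnd ibc).
by rewrite -(Rintegral_itvB ig) ?bnd_simp// addrC subrK.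
Qed.

(** The derivative is only claimed to the right of the base point c, where the
    fundamental theorem of calculus applies; the callers take c to the left of
    the segments that they integrate over. *)
Lemma primitive (g : R -> R) c : continuous g -> exists G : R -> R,
  (forall x : R, c < x -> is_derive x 1 G (g x)) /\
  forall a b, c <= a -> a <= b -> \int[mu]_(s in `[a, b]) g s = G b - G a.
Proof.
move=> cg; exists (fun x => \int[mu]_(s in `[c, x]) g s); split=> [x cx|a b ca ab].
  have [|dG G'] := @continuous_FTC1_closed _ g c x (x + 1) _ (cont_integrable _ _ cg) cx (cg x).
    by rewrite ltrDl.
  by apply: DeriveDef; [exact: dG|rewrite -derive1E; exact: G'].
by rewrite (integral_split (cont_integrable _ _ cg) ca ab) addrC addKr.
Qed.

Lemma integral_shift (g : R -> R) t a b : continuous g -> a <= b ->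
  \int[mu]_(s in `[a, b]) g (s + t) = \int[mu]_(s in `[a + t, b + t]) g s.
Proof.
move=> cg; rewrite le_eqVlt => /predU1P[->|ab].
  by rewrite !set_itv1 !Rintegral_set1.
have [G [dG IG]] := primitive (a + t - 1) cg.
rewrite IG; [|lra..].
have dGt x : a + t - 1 < x + t -> is_derive x 1 (fun x => G (x + t)) (g (x + t)).
  move=> ax; have := dG _ ax => dGx.
  have := @is_derive1_comp R G (fun x => x + t) x (g (x + t)) 1 dGx.
  rewrite mulr1; apply.
  by apply: is_derive_eq; rewrite addr0.
have cGt x : a + t - 1 < x + t -> {for x, continuous (fun x => G (x + t))}.
  move=> ax; apply: differentiable_continuous; apply/derivable1_diffP.
  by have [] := dGt _ ax.
have cgt : continuous (fun x => g (x + t)).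
  by move=> x; apply: continuous_comp; [exact: cvgD (@cvg_id _ _) (cvg_cst _)|exact: cg].
rewrite /Rintegral (@continuous_FTC2 _ _ (fun x => G (x + t)))//.
- exact: continuous_subspaceT.
- split.
  + move=> x; rewrite in_itv/= => /andP[ax xb].
    by have [] : is_derive x 1 (fun x => G (x + t)) (g (x + t)) by apply: dGt; lra.
  + by apply/cvg_at_right_filter/cGt; lra.
  + by apply/cvg_at_left_filter/cGt; lra.
- move=> x; rewrite in_itv/= => /andP[ax xb]; rewrite derive1E.
  by have [_ ->] : is_derive x 1 (fun x => G (x + t)) (g (x + t)) by apply: dGt; lra.
Qed.

Lemma integral_cst_itv (a b c : R) : a <= b ->
  \int[mu]_(s in `[a, b]) c = c * (b - a).
Proof.
move=> ab; rewrite Rintegral_cst//= lebesgue_measure_itv/= lte_fin.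
by case: ltP => //= ?; congr (_ * _); lra.
Qed.

Lemma integral_le (g h : R -> R) a b : mu.-integrable `[a, b] (EFin \o g) ->
  mu.-integrable `[a, b] (EFin \o h) ->
  (forall s, a <= s -> s <= b -> g s <= h s) ->
  \int[mu]_(s in `[a, b]) g s <= \int[mu]_(s in `[a, b]) h s.
Proof.
move=> ig ih gh; apply: le_Rintegral => // s /=.
by rewrite in_itv/= => /andP[]; exact: gh.
Qed.

Lemma normr_integral_le (g h : R -> R) a b : mu.-integrable `[a, b] (EFin \o g) ->
  mu.-integrable `[a, b] (EFin \o h) ->
  (forall s, a <= s -> s <= b -> `|g s| <= h s) ->
  `|\int[mu]_(s in `[a, b]) g s| <= \int[mu]_(s in `[a, b]) h s.
Proof.
move=> ig ih gh; apply: (le_trans (le_normr_Rintegral _ ig)) => //.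
by apply: integral_le => //; exact: integrable_norm.
Qed.

Lemma normr_integral_bound (g : R -> R) a b c : mu.-integrable `[a, b] (EFin \o g) ->
  a <= b -> (forall s, a <= s -> s <= b -> `|g s| <= c) ->
  `|\int[mu]_(s in `[a, b]) g s| <= c * (b - a).
Proof.
move=> ig ab gc; rewrite -integral_cst_itv//; apply: normr_integral_le => //.
exact: (cont_integrable _ _ (@cst_continuous _ _ _)).
Qed.

Lemma is_derive_expRM (k x : R) : is_derive x 1 (fun s => expR (k * s)) (k * expR (k * x)).
Proof.
have := @is_derive1_comp R expR (fun s => k * s) x (expR (k * x)) k.
have dk : is_derive x (1 : R) (fun s => k * s) k.
  by apply: is_derive_eq; rewrite /GRing.scale/= mulr1.
by move=> /(_ _ dk); rewrite mulrC.
Qed.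

Lemma continuous_expRM (k : R) : continuous (fun s => expR (k * s)).
Proof.
move=> x; apply: continuous_comp; last exact: continuous_expR.
exact: mulrl_continuous.
Qed.

Lemma integral_expRM (k a b : R) : a <= b ->
  \int[mu]_(s in `[a, b]) (k * expR (k * s)) = expR (k * b) - expR (k * a).
Proof.
move=> ab; apply: (@FTC2 _ (fun s => expR (k * s))) => // x; last exact: is_derive_expRM.
by apply: cvgM; [exact: cvg_cst|exact: continuous_expRM].
Qed.

(** The function (A + K int_0^t z) e^(-K t) is nonincreasing, because the
    hypothesis says exactly that its derivative is nonpositive. *)
Lemma gronwall (z : R -> R) (A K T : R) : continuous z -> 0 <= K ->
  (forall t, 0 <= t <= T -> z t <= A + K * \int[mu]_(s in `[0, t]) z s) ->
  forall t, 0 <= t <= T -> z t <= A * expR (K * t).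
Proof.
move=> cz K0 hz t /andP[t0 tT].
have [G [dG IG]] := primitive (-1) cz.
have dG' (x : R) : 0 <= x -> is_derive x 1 (fun x => G x - G 0) (z x).
  move=> x0; have dGx : is_derive x 1 G (z x) by apply: dG; lra.
  by apply: is_derive_eq; rewrite subr0.
pose Y := fun x : R => (A + K * (G x - G 0)) * expR (- K * x).
have dY (x : R) : 0 <= x -> is_derive x 1 Y
   ((K * z x) * expR (- K * x) + (A + K * (G x - G 0)) * (- K * expR (- K * x))).
  move=> x0; have dGx := dG' x x0; have dE := is_derive_expRM (- K) x.
  by apply: is_derive_eq; rewrite /GRing.scale/= ; ring.
have Yt : Y t <= Y 0.
  have [->//|t_gt0] := eqVneq t 0.
  have {t_gt0} t_gt0 : 0 < t by rewrite lt_def t_gt0.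
  have : {in `[0, t] &, {homo Y : x y /~ x <= y}}.
    apply: ler0_derive1_le_cc => //.
    - move=> x; rewrite in_itv/= => /andP[x0 xt].
      by have [] := dY x (ltW x0).
    - move=> x; rewrite in_itv/= => /andP[x0 xt]; rewrite derive1E.
      have [_ ->] := dY x (ltW x0).
      have := hz x; rewrite IG; [|lra..] => /(_ ltac:(lra)).
      move=> hx; have e0 := expR_gt0 (- K * x).
      have : K * z x <= K * (A + K * (G x - G 0)) by rewrite ler_wpM2l.
      by nra.
    - apply/(continuous_within_itvP _ t_gt0); split.
      + move=> x; rewrite in_itv/= => /andP[x0 xt].
        apply: differentiable_continuous; apply/derivable1_diffP.
        by have [] := dY x (ltW x0).
      + apply/cvg_at_right_filter/differentiable_continuous/derivable1_diffP.
        by have [] := dY 0 (lexx 0).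
      + apply/cvg_at_left_filter/differentiable_continuous/derivable1_diffP.
        by have [] := dY t t0.
  by apply => //; rewrite in_itv/= ?lexx ?t0.
apply: (le_trans (hz t _)); first by rewrite t0.
rewrite IG; [|lra..].
move: Yt; rewrite /Y mulr0 expR0 mulr1 subrr mulr0 addr0 mulNr expRN.
by rewrite ler_pdivrMr// expR_gt0.
Qed.

End Calc.

(** * The flow of a Lipschitz vector field *)

Section Flow.
Variable R : realType.
Notation mu := (@lebesgue_measure R).

Lemma lip_continuous_at (U W : normedModType R) (g : U -> W) K x :
  (forall y, `|g x - g y| <= K * `|x - y|) -> {for x, continuous g}.
Proof.
move=> gK; apply/cvgrPdist_lt => e e0.
have K0 : 0 < `|K| + 1 by rewrite ltr_wpDl.
near=> y; rewrite (le_lt_trans (gK y))//.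
rewrite (@le_lt_trans _ _ ((`|K| + 1) * `|x - y|))//.
  by rewrite ler_wpM2r// (le_trans (ler_norm K))// lerDl.
rewrite mulrC -ltr_pdivlMr//; near: y.
apply: (@cvgr_dist_lt _ _ _ _ _ idfun) => //; exact: divr_gt0.
Unshelve. all: by end_near. Qed.

Lemma lip_continuous (U W : normedModType R) (g : U -> W) K :
  (forall x y, `|g x - g y| <= K * `|x - y|) -> continuous g.
Proof. by move=> gK x; exact: (@lip_continuous_at _ _ _ K). Qed.

Lemma cv_continuous (T : topologicalType) n (g : T -> 'cV[R]_n) :
  (forall i, continuous (fun t => g t i ord0)) -> continuous g.
Proof.
move=> gi t; apply/cvgrPdist_le => e e0.
have : \forall s \near t, forall i, `|g t i ord0 - g s i ord0| <= e.
  by apply: filter_forall => i; have /cvgrPdist_le := gi i t; apply.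
apply: filterS => s hs; apply: cvnorm_le; first exact: ltW.
by move=> i; rewrite !mxE.
Qed.

Lemma coord_cont (T : topologicalType) n (g : T -> 'cV[R]_n) i :
  continuous g -> continuous (fun t => g t i ord0).
Proof.
move=> cg t; apply: (@continuous_comp _ _ _ g (fun x : 'cV[R]_n => x i ord0)); first exact: cg.
exact: coord_continuous.
Qed.

Lemma norm_cont (T : topologicalType) n (g : T -> 'cV[R]_n) :
  continuous g -> continuous (fun t => `|g t|).
Proof. by move=> cg t; apply: cvg_norm; exact: cg. Qed.

(** The limit is found without completeness of a function space: adding or
    subtracting the geometric tail makes u monotone, and the supremum of the
    lower sequence lies below all terms of the upper one. *)
Lemma halving_limit (u : nat -> R) c : 0 <= c ->
  (forall n, `|u n.+1 - u n| <= c * 2^-1 ^+ n) ->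
  exists l, forall n, `|l - u n| <= 2 * c * 2^-1 ^+ n.
Proof.
move=> c0 hu.
pose lo n := u n - 2 * c * 2^-1 ^+ n; pose hi n := u n + 2 * c * 2^-1 ^+ n.
have p0 n : 0 <= (2^-1 : R) ^+ n by rewrite exprn_ge0.
have lo_nd : {homo lo : n m / (n <= m)%N >-> n <= m}.
  apply: homo_leq => [//|? ? ? /le_trans|n]; first exact.
  by have := hu n; rewrite ler_norml /lo exprS => /andP[]; lra.
have hi_ni : {homo hi : n m / (n <= m)%N >-> m <= n}.
  apply: homo_leq => [//|? ? ? h1 h2|n]; first exact: le_trans h2 h1.
  by have := hu n; rewrite ler_norml /hi exprS => /andP[]; lra.
have lohi n m : lo n <= hi m.
  have [nm|/ltnW mn] := leqP n m.
    apply: (le_trans (lo_nd _ _ nm)); rewrite /lo /hi.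
    by have := mulr_ge0 c0 (p0 m); lra.
  apply: (le_trans _ (hi_ni _ _ mn)); rewrite /lo /hi.
  by have := mulr_ge0 c0 (p0 n); lra.
(* Each lo n is below each hi m, hence so is their supremum. *)
exists (sup (range lo)) => n.
have : lo n <= sup (range lo).
  apply: ub_le_sup; last by exists n.
  by exists (hi 0%N) => _ [m _ <-].
have : sup (range lo) <= hi n.
  by apply: ge_sup; [exists (lo 0%N), 0%N|move=> _ [m _ <-]].
by rewrite /lo /hi ler_norml; lra.
Qed.

Variable d : nat.
Local Notation vec := 'cV[R]_d.

Definition vint (g : R -> vec) a b : vec := \col_i \int[mu]_(s in `[a, b]) g s i ord0.

Lemma vint_norm (g : R -> vec) (h : R -> R) a b : continuous g -> continuous h ->
  (forall s, a <= s -> s <= b -> `|g s| <= h s) ->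
  `|vint g a b| <= \int[mu]_(s in `[a, b]) h s.
Proof.
move=> cg ch gh.
have h0 s : a <= s -> s <= b -> 0 <= h s by move=> sa sb; exact: le_trans (gh _ sa sb).
apply: cvnorm_le => [|i].
  by apply: Rintegral_ge0 => s /=; rewrite in_itv/= => /andP[]; exact: h0.
rewrite mxE; apply: normr_integral_le; [exact/cont_integrable/coord_cont|exact: cont_integrable|].
by move=> s sa sb; rewrite (le_trans _ (gh s sa sb))// mxnorm_coord.
Qed.

Lemma contB (g h : R -> vec) : continuous g -> continuous h ->
  continuous (fun s => g s - h s).
Proof. by move=> cg ch s; apply: cvgB; [exact: cg|exact: ch]. Qed.

Lemma vintB (g h : R -> vec) a b : continuous g -> continuous h ->
  vint g a b - vint h a b = vint (fun s => g s - h s) a b.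
Proof.
move=> cg ch; apply/colP => i; rewrite !mxE -RintegralB//; last 2 first.
- exact/cont_integrable/coord_cont.
- exact/cont_integrable/coord_cont.
by apply: eq_Rintegral => s _; rewrite !mxE.
Qed.

(** Clamping the upper bound at 0 makes the Picard iterates continuous on the
    whole line. *)
Lemma vint_cont (g : R -> vec) : continuous g ->
  continuous (fun t : R => vint g 0 (Num.max t 0)).
Proof.
move=> cg; apply: cv_continuous => i.
have [G [dG IG]] := primitive (-1) (@coord_cont _ _ _ i cg).
rewrite (_ : (fun _ => _) = fun t : R => G (Num.max t 0) - G 0); last first.
  by apply/funext => t; rewrite mxE IG// ?le_max ?lexx ?orbT//; lra.
move=> t; apply: cvgB; last exact: cvg_cst.
apply: (@continuous_comp _ _ _ (fun t : R => Num.max t 0) G).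
  by apply: continuous_max; [exact: cvg_id|exact: cvg_cst].
apply: differentiable_continuous; apply/derivable1_diffP.
have : -1 < Num.max t 0 by rewrite lt_max; apply/orP; right; lra.
by move=> /dG[].
Qed.

Variables (F : vec -> vec) (K : R).
Hypothesis FK : forall x y, `|F x - F y| <= K * `|x - y|.
Hypothesis K0 : 0 < K.

Let cF : continuous F := lip_continuous FK.

Let cFo (y : R -> vec) : continuous y -> continuous (fun s => F (y s)).
Proof. by move=> cy s; apply: continuous_comp; [exact: cy|exact: cF]. Qed.

(** The solution is extended to negative times by its initial value, so that
    continuity can be stated on the whole line. *)
Definition solution (x : vec) (y : R -> vec) :=
  [/\ continuous y, (forall t, t <= 0 -> y t = x) &
   forall t, 0 <= t -> y t = x + vint (fun s => F (y s)) 0 t].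

Fixpoint picard (x : vec) n : R -> vec :=
  if n is n'.+1 then fun t => x + vint (fun s => F (picard x n' s)) 0 (Num.max t 0)
  else fun=> x.

Lemma picard_cont x n : continuous (picard x n).
Proof.
elim: n => [|n IH]; first exact: cst_continuous.
move=> t; apply: cvgD; first exact: cvg_cst.
by apply: vint_cont; exact: cFo.
Qed.

Lemma picardS x n t : 0 <= t ->
  picard x n.+1 t = x + vint (fun s => F (picard x n s)) 0 t.
Proof. by move=> t0; rewrite /= max_l. Qed.

Let cFp x n : continuous (fun s => F (picard x n s)).
Proof. exact: cFo (@picard_cont x n). Qed.

(** In the norm with weight e^(-2 K t) the Picard operator contracts by the
    factor 1/2 on all of [0, +oo[, so no gluing of local solutions is needed. *)
Lemma picard_step x n t : 0 <= t -> `|picard x n.+1 t - picard x n t| <=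
  `|F x| / (2 * K) * 2^-1 ^+ n * expR (2 * K * t).
Proof.
elim: n t => [|n IH] t t0.
  rewrite /= max_l// addrC addKr expr0 mulr1.
  have := @vint_norm (fun=> F x) (fun=> `|F x|) 0 t.
  rewrite integral_cst_itv// subr0 => /(_ _ _ _)/le_trans; apply.
  - exact: cst_continuous.
  - exact: cst_continuous.
  - by [].
  rewrite -mulrA ler_wpM2l// mulrC ler_pdivlMr ?mulr_gt0//.
  by have := expR_ge1Dx (2 * K * t); lra.
rewrite (picardS _ n.+1)// (picardS _ n)// opprD addrACA subrr add0r.
rewrite vintB; [|exact: cFp|exact: cFp].
set c := `|F x| / (2 * K) * 2^-1 ^+ n.
have c0 : 0 <= c by rewrite mulr_ge0 ?divr_ge0 ?exprn_ge0// mulr_ge0// ltW.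
apply: (@le_trans _ _ (\int[mu]_(s in `[0, t]) (c / 2 * (2 * K * expR (2 * K * s))))).
  apply: vint_norm.
    exact: (contB (@cFp x n.+1) (@cFp x n)).
  - move=> s; apply: cvgMr; apply: cvgMr; exact: continuous_expRM.
  - move=> s s0 st; apply: (le_trans (FK _ _)).
    have := IH s s0; rewrite -/c => h.
    have -> : c / 2 * (2 * K * expR (2 * K * s)) = K * (c * expR (2 * K * s)) by field.
    by rewrite ler_wpM2l// ltW.
rewrite RintegralZl//; last first.
  by apply: cont_integrable => s; apply: cvgMr; exact: continuous_expRM.
rewrite integral_expRM// mulr0 expR0.
have -> : `|F x| / (2 * K) * 2^-1 ^+ n.+1 = c / 2 by rewrite /c exprSr mulrA.
by rewrite ler_wpM2l ?divr_ge0// lerBlDr lerDl.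
Qed.

Lemma picard_neg x n t : t <= 0 -> picard x n t = x.
Proof.
case: n => [//|n] t0; rewrite /= max_r//.
by apply/colP => i; rewrite !mxE set_itv1 Rintegral_set1 addr0.
Qed.

Lemma small_half c e : 0 < e -> exists n, c * (2^-1 : R) ^+ n <= e.
Proof.
move=> e0; have c1 : 0 < `|c| + 1 by rewrite ltr_wpDl.
have : (2^-1 : R) ^+ n @[n --> \oo] --> 0 by apply: cvg_expr; rewrite ger0_norm; lra.
move=> /cvgrPdist_le/(_ _ (divr_gt0 e0 c1))[n _ /(_ n (leqnn n))].
rewrite sub0r normrN ger0_norm ?exprn_ge0// ler_pdivlMr// => h.
exists n; apply: le_trans h; rewrite mulrC ler_wpM2l ?exprn_ge0//.
by rewrite (le_trans (ler_norm c))// lerDl.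
Qed.

Lemma solution_exists x : exists y, solution x y.
Proof.
have [C C0 step] : exists2 C, 0 <= C & forall n t, 0 <= t ->
    `|picard x n.+1 t - picard x n t| <= C * 2^-1 ^+ n * expR (2 * K * t).
  exists (`|F x| / (2 * K)) => [|n t]; last exact: picard_step.
  by rewrite divr_ge0// mulr_ge0// ltW.
have hb t n : 0 <= 2 * (C * expR (2 * K * t)) * 2^-1 ^+ n.
  by apply: mulr_ge0; rewrite ?exprn_ge0//; apply: mulr_ge0 => //; apply: mulr_ge0 => //; exact: expR_ge0.
have /choice[y Hy] : forall t, exists l : vec, forall n,
    `|l - picard x n t| <= 2 * (C * expR (2 * K * t)) * 2^-1 ^+ n /\ (t <= 0 -> l = x).
  move=> t; have [t0|t_gt0] := leP t 0.
    exists x => n; split => //; rewrite picard_neg// subrr normr0.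
    exact: hb.
  have t0 := ltW t_gt0.
  have /choice[l Hl] : forall i : 'I_d, exists l : R, forall n,
     `|l - picard x n t i ord0| <= 2 * (C * expR (2 * K * t)) * 2^-1 ^+ n.
    move=> i; apply: halving_limit; first by rewrite mulr_ge0// expR_ge0.
    move=> n; have := mxnorm_coord (picard x n.+1 t - picard x n t) i ord0.
    rewrite !mxE => /le_trans; apply.
    by apply: (le_trans (step n t t0)); rewrite mulrAC.
  exists (\col_i l i) => n; split => //.
  apply: cvnorm_le => [|i]; last by rewrite !mxE Hl.
  exact: hb.
have yx t n : `|y t - picard x n t| <= 2 * C * expR (2 * K * t) * 2^-1 ^+ n.
  by rewrite -(mulrA 2 C); exact: (Hy t n).1.
have cy : continuous y.
  move=> t; apply/cvgrPdist_le => e e0.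
  have e3 : 0 < e / 3 by rewrite divr_gt0.
  have [n Hn] := small_half (2 * C * expR (2 * K * (t + 1))) e3.
  have yn s : s <= t + 1 -> `|y s - picard x n s| <= e / 3.
    move=> st; apply: (le_trans (yx s n)); apply: le_trans Hn.
    rewrite ler_wpM2r ?exprn_ge0// ler_wpM2l ?mulr_ge0//.
    by rewrite ler_expR ler_wpM2l// mulr_ge0// ltW.
  have /cvgrPdist_le/(_ _ e3) := @picard_cont x n t.
  move=> hp; near=> s.
  have h1 : `|y t - picard x n t| <= e / 3 by apply: yn; rewrite lerDl.
  have h2 : `|y s - picard x n s| <= e / 3.
    apply: yn; rewrite ltW//; near: s.
    by apply: (@lt_nbhsl R t (t + 1)); rewrite ltrDl.
  have h3 : `|picard x n t - picard x n s| <= e / 3 by near: s.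
  have -> : y t - y s = (y t - picard x n t) + (picard x n t - picard x n s) - (y s - picard x n s).
    by rewrite opprB !addrA !subrK.
  rewrite (le_trans (ler_normB _ _))//.
  by have := ler_normD (y t - picard x n t) (picard x n t - picard x n s); lra.
exists y; split => //; first by move=> t; exact: (Hy t 0%N).2.
move=> t t0; apply/eqP; rewrite -subr_eq0 -normr_le0; apply/ler_addgt0Pl => e e0; rewrite addr0.
set c := 2 * C * expR (2 * K * t).
have c0 : 0 <= c by rewrite !mulr_ge0// expR_ge0.
have [n Hn] := small_half (c * (1 + K * t)) e0.
apply: le_trans Hn.
have -> : y t - (x + vint (fun s => F (y s)) 0 t) =
   (y t - picard x n.+1 t) + (vint (fun s => F (picard x n s)) 0 t - vint (fun s => F (y s)) 0 t).
  by rewrite /= max_l// !opprD !addrA subrK.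
apply: (le_trans (ler_normD _ _)).
rewrite mulrDr mulr1 mulrDl lerD//.
  apply: (le_trans (yx _ _)); rewrite ler_wpM2l// exprS.
  by rewrite ler_piMl ?exprn_ge0//; lra.
rewrite vintB; [|exact: cFp|exact: cFo].
have -> : c * (K * t) * 2^-1 ^+ n = \int[mu]_(s in `[0, t]) (K * (c * 2^-1 ^+ n)).
  by rewrite integral_cst_itv// subr0; ring.
apply: vint_norm.
- by move=> s; apply: cvgB; [exact: cFp|exact: cFo].
- exact: cst_continuous.
- move=> s s0 st; apply: (le_trans (FK _ _)); rewrite ler_wpM2l ?(ltW K0)// distrC.
  apply: (le_trans (yx _ _)); rewrite ler_wpM2r ?exprn_ge0// ler_wpM2l ?mulr_ge0//.
  by rewrite ler_expR ler_wpM2l// mulr_ge0// ltW.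
Unshelve. all: by end_near. Qed.

Lemma solution_dist x x' y y' : solution x y -> solution x' y' ->
  forall t, 0 <= t -> `|y t - y' t| <= expR (K * t) * `|x - x'|.
Proof.
move=> [cy _ ye] [cy' _ ye'] t t0; rewrite mulrC.
have cz : continuous (fun s => `|y s - y' s|).
  by apply: norm_cont => s; apply: cvgB; [exact: cy|exact: cy'].
apply: (@gronwall _ (fun s => `|y s - y' s|) _ K t) => //; [exact: ltW| |by rewrite t0 lexx].
move=> s /andP[s0 st]; rewrite ye// ye'//.
rewrite opprD addrACA (le_trans (ler_normD _ _))// lerD2l.
rewrite vintB; [|exact: cFo|exact: cFo].
rewrite -RintegralZl//; last exact: cont_integrable.
apply: vint_norm => //.
- by move=> r; apply: cvgB; exact: cFo.
- by move=> r; apply: cvgMr; exact: cz.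
Qed.

Lemma solution_tangent x y v c t : solution x y -> 0 <= t ->
  (forall s, 0 <= s -> s <= t -> `|F (y s) - v| <= c) -> `|y t - x - t *: v| <= t * c.
Proof.
move=> [cy _ ye] t0 hv; rewrite ye// [x + _]addrC addrK.
have -> : t *: v = vint (fun=> v) 0 t.
  by apply/colP => i; rewrite !mxE integral_cst_itv// subr0 mulrC.
have := @vint_norm (fun s => F (y s) - v) (fun=> c) 0 t.
rewrite integral_cst_itv// subr0 mulrC -vintB; [|exact: cFo|exact: cst_continuous].
apply => //; last exact: cst_continuous.
by move=> s; apply: cvgB; [exact: cFo|exact: cvg_cst].
Qed.

Lemma solution_displacement x y c : (forall x, `|F x| <= c) -> solution x y ->
  forall s t, `|y t - y s| <= c * `|t - s|.
Proof.
move=> Fc sy.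
have c0 : 0 <= c by apply: le_trans (Fc 0).
have [cy yn ye] := sy.
suff H s t : s <= t -> `|y t - y s| <= c * `|t - s|.
  move=> s t; have [|/ltW] := leP s t; first exact: H.
  by move=> /H; rewrite distrC (distrC s).
move=> st.
have H0 a b : 0 <= a -> a <= b -> `|y b - y a| <= c * (b - a).
  move=> a0 ab; have b0 := le_trans a0 ab.
  rewrite !ye// opprD addrACA subrr add0r; apply: cvnorm_le => [|i].
    by rewrite mulr_ge0// subr_ge0.
  have ci : continuous (fun s => F (y s) i ord0) by exact/coord_cont/cFo.
  rewrite !mxE (integral_split (cont_integrable _ _ ci) a0 ab) addrC addKr.
  apply: normr_integral_bound => //; first exact: cont_integrable.
  by move=> r _ _; apply: le_trans (Fc (y r)); exact: mxnorm_coord.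
have ymax r : y r = y (Num.max r 0).
  by have [r0|//] := leP r 0; rewrite yn// yn.
rewrite (ymax s) (ymax t); apply: (le_trans (H0 _ _ _ _)).
- by rewrite le_max lexx orbT.
- by rewrite ge_max !le_max st lexx orbT.
- rewrite ler_wpM2l// ger0_norm ?subr_ge0//.
  by have [] := leP t 0; have [] := leP s 0; lra.
Qed.

(** Applied to integer translations c: the flow of a periodic field descends
    to the torus. *)
Lemma solution_shift x y c : (forall x, F (x + c) = F x) -> solution x y ->
  solution (x + c) (fun t => y t + c).
Proof.
move=> Fc [cy yn ye]; split.
- by move=> t; apply: cvgD; [exact: cy|exact: cvg_cst].
- by move=> t t0; rewrite yn.
- move=> t t0; rewrite ye// addrAC; congr (_ + vint _ _ _).
  by apply/funext => s; rewrite Fc.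
Qed.

End Flow.

(** * Smoothing by averages along coordinate directions *)

Section Averages.
Variables (R : realType) (d : nat).
Notation mu := (@lebesgue_measure R).
Local Notation vec := 'cV[R]_d.
Local Notation ei i := (delta_mx i ord0 : vec).
Implicit Types (g h : vec -> R) (x y : vec) (i j : 'I_d).

Definition klip (K : R) g := forall x y, `|g x - g y| <= K * `|x - y|.

Lemma norm_ei i : `|ei i| <= 1.
Proof.
by apply: cvnorm_le => // j; rewrite mxE; case: (_ && _) => /=; rewrite ?normr1 ?normr0.
Qed.

Lemma line_cont K g x v : klip K g -> continuous (fun s : R => g (x + s *: v)).
Proof.
move=> gK; apply: (@lip_continuous R R R _ (`|K| * `|v|)) => s t.
apply: (le_trans (gK _ _)); rewrite opprD addrACA subrr add0r -scalerBl normrZ.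
by rewrite -mulrA [X in _ * X]mulrC ler_wpM2r ?ler_norm// mulr_ge0.
Qed.

Arguments line_cont {K g} x v.

Definition avg (r : R) i g x : R :=
  r^-1 * \int[mu]_(s in `[0, r]) g (x + s *: ei i).

Variable r : R.
Hypothesis r0 : 0 < r.

(** Averages preserve affine inequalities between a function and another one
    at a translated point; this is how an approximate dynamic programming
    inequality passes to the averaged function. *)
Lemma avg_le i g h K K' x y k c : klip K g -> klip K' h ->
  (forall s, 0 <= s -> s <= r -> g (x + s *: ei i) <= k + c * h (y + s *: ei i)) ->
  avg r i g x <= k + c * avg r i h y.
Proof.
move=> gK hK gh; rewrite /avg mulrCA -[k](mulKf (lt0r_neq0 r0)) -mulrDr.
have cg := line_cont x (ei i) gK; have ch := line_cont y (ei i) hK.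
rewrite ler_wpM2l ?invr_ge0 ?(ltW r0)// -RintegralZl//; last exact: cont_integrable.
rewrite [r * k]mulrC -[X in k * X](subr0 r) -integral_cst_itv ?(ltW r0)// -RintegralD//; last 2 first.
- exact: cont_integrable (@cst_continuous _ _ _).
- by apply: cont_integrable => s; apply: cvgMr; exact: ch.
apply: integral_le => //; first exact: cont_integrable.
apply: (@cont_integrable R (fun s => k + c * h (y + s *: ei i))) => s.
by apply: cvgD; [exact: cvg_cst|apply: cvgMr; exact: ch].
Qed.

Lemma avg_cst i k x : avg r i (fun=> k) x = k.
Proof.
by rewrite /avg integral_cst_itv ?(ltW r0)// subr0 mulrCA mulVf ?mulr1// lt0r_neq0.
Qed.

Lemma klip_cst k : klip 0 (fun=> k).
Proof. by move=> x y; rewrite subrr normr0 mul0r. Qed.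

Lemma avg_lip K i g : klip K g -> klip K (avg r i g).
Proof.
move=> gK.
have H x y : avg r i g x - avg r i g y <= K * `|x - y|.
  rewrite lerBlDr -[avg r i g y]mul1r; apply: (avg_le gK gK) => s _ _.
  rewrite mul1r -lerBlDr (le_trans (ler_norm _))// (le_trans (gK _ _))//.
  by rewrite opprD addrACA subrr addr0.
by move=> x y; rewrite ler_norml H andbT lerNl opprB distrC.
Qed.

Lemma avg_close K i g x : 0 <= K -> klip K g -> `|avg r i g x - g x| <= K * r.
Proof.
move=> K0 gK.
have H s : 0 <= s -> s <= r -> `|g (x + s *: ei i) - g x| <= K * r.
  move=> s0 sr; rewrite (le_trans (gK _ _))// ler_wpM2l//.
  by rewrite addrAC subrr add0r normrZ ger0_norm// -[leRHS]mulr1 ler_pM// norm_ei.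
rewrite ler_norml; apply/andP; split.
  rewrite lerBrDr addrC lerBlDr addrC -[avg r i g x]mul1r -{1}(avg_cst i (g x) x).
  apply: (avg_le (klip_cst _) gK) => s s0 sr.
  by have := H s s0 sr; rewrite ler_norml; lra.
rewrite lerBlDr -[X in _ + X]mul1r -(avg_cst i (g x) x).
apply: (avg_le gK (klip_cst _)) => s s0 sr.
by have := H s s0 sr; rewrite ler_norml; lra.
Qed.

Lemma avg_periodic i g : Zperiodic g -> Zperiodic (avg r i g).
Proof.
move=> gp x j; rewrite /avg; congr (_ * _).
by apply: eq_Rintegral => s _; rewrite addrAC gp.
Qed.

(** G is the j-th partial derivative of g, is Lipschitz, and approximates the
    increments of g with a quadratic remainder uniform in x.  Unlike mere
    differentiability this is stable under further averaging, and having it for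
    all j gives differentiability. *)
Definition has_partial g j G := (exists K, klip K G) /\
  exists2 C, 0 <= C & forall x t, `|g (x + t *: ei j) - g x - t * G x| <= C * t ^+ 2.

(** Averaging in direction i gains one derivative in that direction: the
    derivative of the integral over [0, r] is the difference of the values at its
    end points, and the remainder is quadratic because g is Lipschitz. *)
Lemma avg_partial_self K i g : 0 <= K -> klip K g ->
  has_partial (avg r i g) i (fun x => r^-1 * (g (x + r *: ei i) - g x)).
Proof.
move=> K0 gK; split.
  exists (r^-1 * (2 * K)) => x y.
  rewrite -mulrBr normrM ger0_norm ?invr_ge0 ?(ltW r0)// -mulrA ler_wpM2l ?invr_ge0 ?(ltW r0)//.
  have := gK (x + r *: ei i) (y + r *: ei i); rewrite opprD addrACA subrr addr0 => h1.
  have := ler_normB (g (x + r *: ei i) - g (y + r *: ei i)) (g x - g y).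
  have := gK x y.
  rewrite (_ : g (x + _) - g x - _ = g (x + r *: ei i) - g (y + r *: ei i) - (g x - g y)); first lra.
  by lra.
exists (r^-1 * (2 * K)); first by rewrite mulr_ge0 ?invr_ge0 ?(ltW r0)// mulr_ge0.
move=> x t; rewrite /avg -mulrBr mulrCA -mulrBr normrM ger0_norm ?invr_ge0 ?(ltW r0)//.
rewrite -mulrA ler_wpM2l ?invr_ge0 ?(ltW r0)//.
pose gam s := g (x + s *: ei i).
have cgam : continuous gam by exact: line_cont gK.
have [G [_ IG]] := primitive (Num.min t 0) cgam.
have -> : \int[mu]_(s in `[0, r]) g (x + t *: ei i + s *: ei i) = G (r + t) - G t.
  rewrite -(IG t (r + t)); [|by rewrite ge_min lexx|by rewrite lerDr ltW].
  rewrite -[X in `[X, _]](add0r t) -integral_shift// ?(ltW r0)//.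
  by apply: eq_Rintegral => s _; rewrite /gam scalerDl addrAC addrA.
rewrite -/(gam r) -[g x](_ : gam 0 = _); last by rewrite /gam scale0r addr0.
rewrite (_ : \int[mu]_(s in _) _ = G r - G 0); last first.
  by rewrite -IG ?(ltW r0)// ge_min lexx orbT.
have H a b : Num.min t 0 <= a -> a <= b -> forall c, a <= c -> c <= b ->
   `|G b - G a - (b - a) * gam c| <= K * (b - a) ^+ 2.
  move=> ta ab c ac cb; rewrite -IG// mulrC -integral_cst_itv// -RintegralB//; last 2 first.
  - exact: cont_integrable.
  - exact: cont_integrable (@cst_continuous _ _ _).
  rewrite expr2 mulrA; apply: normr_integral_bound => //.
    apply: (@cont_integrable R (fun s => gam s - gam c)) => s.
    by apply: cvgB; [exact: cgam|exact: cvg_cst].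
  move=> s sa sb; rewrite (le_trans (gK _ _))// ler_wpM2l//.
  rewrite opprD addrACA subrr add0r -scalerBl normrZ.
  rewrite -[leRHS]mulr1 ler_pM// ?norm_ei//.
  by rewrite ler_norml; apply/andP; split; lra.
have H' a : Num.min t 0 <= a -> Num.min t 0 <= a + t -> `|G (a + t) - G a - t * gam a| <= K * t ^+ 2.
  move=> ta tat; have [t0|/ltW t0] := leP 0 t.
    by have := H a (a + t) ta; rewrite addrAC subrr add0r; apply; lra.
  have := H (a + t) a tat _ a; rewrite (_ : a - (a + t) = - t); last by lra.
  move=> /(_ ltac:(lra) ltac:(lra) ltac:(lra)); rewrite sqrrN -normrN.
  by have -> : - (G a - G (a + t) - - t * gam a) = G (a + t) - G a - t * gam a by ring.
have h1 : `|G t - G 0 - t * gam 0| <= K * t ^+ 2.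
  by rewrite -{1}(add0r t); apply: H'; rewrite ?add0r ge_min lexx ?orbT.
have h2 : `|G (r + t) - G r - t * gam r| <= K * t ^+ 2.
  by apply: H'; rewrite ge_min ?(ltW r0) ?orbT// lerDr (ltW r0).
have := ler_normB (G (r + t) - G r - t * gam r) (G t - G 0 - t * gam 0).
rewrite (_ : G (r + t) - G t - _ - _ = G (r + t) - G r - t * gam r - (G t - G 0 - t * gam 0)); last by ring.
by lra.
Qed.

(** Averaging in a direction i keeps the partial derivatives that were gained
    in other directions. *)
Lemma avg_partial_keep K i j g G : klip K g -> has_partial g j G ->
  has_partial (avg r i g) j (avg r i G).
Proof.
move=> gK [[K' GK] [C C0 hC]]; split; first by exists K'; exact: avg_lip.
exists C => // x t; rewrite ler_norml.
have cg y := line_cont y (ei i) gK; have cG y := line_cont y (ei i) GK.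
have cgt : continuous (fun s : R => g (x + s *: ei i + t *: ei j)).
  rewrite (_ : (fun _ => _) = fun s : R => g (x + t *: ei j + s *: ei i)); first exact: cg.
  by apply/funext => s; rewrite addrAC.
have -> : avg r i g (x + t *: ei j) - avg r i g x - t * avg r i G x =
  r^-1 * \int[mu]_(s in `[0, r]) (g (x + s *: ei i + t *: ei j) - g (x + s *: ei i) - t * G (x + s *: ei i)).
  rewrite /avg mulrCA -!mulrBr; congr (_ * _).
  have -> : \int[mu]_(s in `[0, r]) g (x + t *: ei j + s *: ei i) =
            \int[mu]_(s in `[0, r]) g (x + s *: ei i + t *: ei j).
    by apply: eq_Rintegral => s _; rewrite addrAC.
  rewrite RintegralB//; last 2 first.
  - apply: (@cont_integrable R (fun s => g (x + s *: ei i + t *: ei j) - g (x + s *: ei i))) => s.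
    by apply: cvgB; [exact: cgt|exact: cg].
  - by apply: (@cont_integrable R (fun s => t * G (x + s *: ei i))) => s; apply: cvgMr; exact: cG.
  rewrite RintegralB//; last 2 first.
  - exact: cont_integrable.
  - exact: cont_integrable.
  by rewrite RintegralZl; [reflexivity|by []|exact: cont_integrable].
have : `|\int[mu]_(s in `[0, r]) (g (x + s *: ei i + t *: ei j) - g (x + s *: ei i) - t * G (x + s *: ei i))| <= C * t ^+ 2 * (r - 0).
  apply: normr_integral_bound; rewrite ?(ltW r0)//.
  apply: (@cont_integrable R (fun s => g (x + s *: ei i + t *: ei j) - g (x + s *: ei i) - t * G (x + s *: ei i))) => s.
  apply: cvgB; last by apply: cvgMr; exact: cG.
  by apply: cvgB; [exact: cgt|exact: cg].
rewrite subr0 => h; rewrite -ler_norml normrM (ger0_norm (_ : 0 <= r^-1)) ?invr_ge0 ?(ltW r0)//.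
by rewrite mulrC ler_pdivrMr.
Qed.

End Averages.

Section Smooth.
Variables (R : realType) (d : nat).
Local Notation vec := 'cV[R]_d.
Local Notation ei i := (delta_mx i ord0 : vec).
Implicit Types (g : vec -> R) (x y h : vec) (i j : 'I_d).

Lemma col_sum_ei x : x = \sum_(i < d) x i ord0 *: ei i.
Proof.
apply/colP => i; rewrite summxE (bigD1 i)//= big1 => [|j ji].
  by rewrite !mxE !eqxx mulr1 addr0.
by rewrite !mxE eq_sym (negbTE ji) mulr0.
Qed.

Lemma sum_ei_norm (s : seq 'I_d) x :
  `|\sum_(i <- s) x i ord0 *: ei i| <= (size s)%:R * `|x|.
Proof.
elim: s => [|i s IH]; first by rewrite big_nil normr0 mul0r.
rewrite big_cons/= -natr1 addrC mulrDl mul1r (le_trans (ler_normD _ _))// lerD// normrZ.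
by rewrite -[leRHS]mulr1 ler_pM// ?mxnorm_coord// norm_ei.
Qed.

(** The increment from x to x + h is split into d steps along the
    coordinates; moving the base point of the i-th partial derivative back to x
    costs a quadratic term, since it is Lipschitz. *)
Lemma partials_taylor g (G : 'I_d -> vec -> R) : (forall i, has_partial g i (G i)) ->
  exists2 C : R, 0 <= C & forall x h, `|g (x + h) - g x - \sum_(i < d) h i ord0 * G i x| <= C * `|h| ^+ 2.
Proof.
move=> gG.
have [K KG] : exists K, forall i, klip K (G i).
  have /choice[K hK] : forall i, exists K, klip K (G i) by move=> i; have [] := gG i.
  exists (\sum_i `|K i|) => i x y; rewrite (le_trans (hK i x y))// ler_wpM2r//.
  rewrite (le_trans (ler_norm _))// (bigD1 i)//= lerDl; exact: sumr_ge0.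
have [C C0 CG] : exists2 C, 0 <= C &
    forall i x t, `|g (x + t *: ei i) - g x - t * G i x| <= C * t ^+ 2.
  have /choice[C hC] : forall i, exists C, forall x t,
      `|g (x + t *: ei i) - g x - t * G i x| <= C * t ^+ 2.
    by move=> i; have [_ [C _ h]] := gG i; exists C.
  exists (\sum_i `|C i|) => [|i x t]; first exact: sumr_ge0.
  rewrite (le_trans (hC i x t))// ler_wpM2r ?sqr_ge0//.
  rewrite (le_trans (ler_norm _))// (bigD1 i)//= lerDl; exact: sumr_ge0.
have K0 : 0 <= `|K| by [].
suff H (s : seq 'I_d) : exists2 D, 0 <= D & forall x h,
    `|g (x + \sum_(i <- s) h i ord0 *: ei i) - g x - \sum_(i <- s) h i ord0 * G i x| <= D * `|h| ^+ 2.
  have [D D0 hD] := H (index_enum 'I_d); exists D => // x h.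
  by have := hD x h; rewrite -col_sum_ei.
elim: s => [|i s [D D0 hD]].
  by exists 0 => // x h; rewrite !big_nil addr0 subrr subr0 normr0 mul0r.
exists (D + C + `|K| * (size s)%:R) => [|x h].
  by rewrite !addr_ge0// mulr_ge0.
rewrite !big_cons.
set S := \sum_(j <- s) h j ord0 *: ei j; set T := \sum_(j <- s) h j ord0 * G j x.
set hi := h i ord0.
have h1 : `|hi| <= `|h| by exact: mxnorm_coord.
have h2 : hi ^+ 2 <= `|h| ^+ 2 by rewrite -real_normK ?num_real// lerXn2r ?nnegrE.
have h3 := CG i (x + S) hi.
have h4 : `|G i (x + S) - G i x| <= `|K| * ((size s)%:R * `|h|).
  rewrite (le_trans (KG i _ _))// addrAC subrr add0r.
  rewrite (@le_trans _ _ (`|K| * `|S|))//; first by rewrite ler_wpM2r// ler_norm.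
  by rewrite ler_wpM2l// sum_ei_norm.
have h5 := hD x h; rewrite -/S -/T in h5.
have h6 : `|hi * (G i (x + S) - G i x)| <= `|K| * (size s)%:R * `|h| ^+ 2.
  rewrite normrM expr2 (_ : _ * (_ * _) = `|h| * (`|K| * ((size s)%:R * `|h|))).
    by rewrite ler_pM.
  by ring.
have h7 : C * hi ^+ 2 <= C * `|h| ^+ 2 by rewrite ler_wpM2l.
rewrite (addrC (hi *: _)) addrA.
have -> : g (x + S + hi *: ei i) - g x - (hi * G i x + T) =
  (g (x + S + hi *: ei i) - g (x + S) - hi * G i (x + S)) + (g (x + S) - g x - T)
   + hi * (G i (x + S) - G i x) by ring.
rewrite !mulrDl.
rewrite (le_trans (ler_normD _ _))// lerD//.
rewrite (le_trans (ler_normD _ _))// addrC lerD//.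
exact: le_trans h3 h7.
Qed.

Lemma partials_C1 g (G : 'I_d -> vec -> R) : (forall i, has_partial g i (G i)) ->
  (forall x, differentiable g x) /\ (forall x, grad g x = \col_i G i x) .
Proof.
move=> gG; have [C C0 hC] := partials_taylor gG.
suff H x : differentiable g x /\ forall i, 'D_(ei i) g x = G i x.
  split=> x; first by have [] := H x.
  by apply/colP => i; rewrite !mxE; have [_ ->] := H x.
pose L (h : vec) : R := \sum_(i < d) h i ord0 * G i x.
have Llin : linear L.
  move=> a u v; rewrite /L /GRing.scale/= mulr_sumr -big_split/=.
  by apply: eq_bigr => i _; rewrite !mxE; ring.
pose LL : {linear vec -> R^o} := HB.pack L (GRing.isLinear.Build _ _ _ _ L Llin).
have cLL : continuous LL.
  apply: (@lip_continuous R vec R^o L (\sum_i `|G i x|)) => u v.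
  rewrite /L -sumrB (le_trans (ler_norm_sum _ _ _))// mulr_suml ler_sum// => i _.
  rewrite -mulrBl normrM mulrC ler_wpM2l//.
  by have := mxnorm_coord (u - v) i ord0; rewrite !mxE.
have dLL : g \o shift x = cst (g x) + LL +o_ (0 : vec) id.
  have C1 : 0 < C + 1 by rewrite ltr_wpDl.
  apply/eqaddoP => _/posnumP[e].
  have hn : \forall h \near (0 : vec), `|h| <= e%:num / (C + 1) by apply: nbhs0_le; rewrite divr_gt0.
  near=> h.
  have -> : (g \o shift x - (cst (g x) + LL)) h = g (x + h) - g x - L h.
    by rewrite !fctE /= (addrC h) opprD addrA.
  rewrite (le_trans (hC x h))// expr2 mulrA ler_wpM2r//.
  rewrite (@le_trans _ _ ((C + 1) * `|h|))//; first by rewrite ler_wpM2r// lerDl.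
  rewrite mulrC -ler_pdivlMr//; near: h.
  exact: hn.
have dE := diff_unique cLL dLL.
have dg : differentiable g x by apply/diff_locallyP; rewrite dE.
split => // i; rewrite deriveE// dE /= /L (bigD1 i)//= big1 => [|j ji].
  by rewrite mxE !eqxx mul1r addr0.
by rewrite mxE (negbTE ji) mul0r.
Unshelve. all: by end_near. Qed.

(** Averages over [0, r] in each of the d directions, that is, convolution with
    the uniform law of a cube. *)
Definition smooth r g := foldr (avg r) g (enum 'I_d).

Section fold.
Variables (r K : R) (g : vec -> R).
Hypotheses (r0 : 0 < r) (K0 : 0 <= K) (gK : klip K g).

Lemma foldr_avg_lip (s : seq 'I_d) : klip K (foldr (avg r) g s).
Proof. by elim: s => //= i s IH; exact: avg_lip. Qed.

Lemma smooth_close x : `|smooth r g x - g x| <= K * r * d%:R.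
Proof.
rewrite /smooth -[X in _ * X%:R](size_enum_ord d).
elim: (enum _) => [|i s IH] /=; first by rewrite subrr normr0 mulr0.
rewrite -natr1 mulrDr mulr1 [leRHS]addrC.
have h := avg_close r0 i x K0 (foldr_avg_lip s).
by rewrite (le_trans (ler_distD (foldr (avg r) g s x) _ _))// lerD.
Qed.

Lemma smooth_periodic : Zperiodic g -> Zperiodic (smooth r g).
Proof. by move=> gp; rewrite /smooth; elim: (enum _) => //= i s IH; exact: avg_periodic. Qed.

Lemma smooth_partial j : exists G, has_partial (smooth r g) j G.
Proof.
rewrite /smooth; have : j \in enum 'I_d by rewrite mem_enum.
elim: (enum 'I_d) => //= i s IH; rewrite inE => /predU1P[->|/IH[G hG]].
  by eexists; exact: avg_partial_self (foldr_avg_lip s).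
by eexists; exact: avg_partial_keep (foldr_avg_lip s) hG.
Qed.

Lemma smooth_C1 : Zperiodic g -> C1_torus (smooth r g).
Proof.
move=> gp; have /choice[G hG] := smooth_partial.
have [d1 d2] := partials_C1 hG; split => //; first exact: smooth_periodic.
rewrite (_ : grad _ = fun x => \col_i G i x); last by apply/funext.
apply: cv_continuous => i; under eq_fun do rewrite mxE.
by have [[K' GK] _] := hG i; exact: (@lip_continuous R vec R^o _ K').
Qed.

(** The smoothed function at x0 only depends on the values of g at distance
    at most d r of x0. *)
Lemma smooth_shift_le x0 w k c :
  (forall z, `|z - x0| <= d%:R * r -> g z <= k + c * g (z + w)) ->
  smooth r g x0 <= k + c * smooth r g (x0 + w).
Proof.
rewrite /smooth -[X in X%:R * _](size_enum_ord d).
elim: (enum _) x0 => [|i s IH] x0 hz /=.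
  by apply: hz; rewrite subrr normr0 mul0r.
apply: (avg_le r0 (foldr_avg_lip s) (foldr_avg_lip s)) => t t0 tr.
rewrite addrAC; apply: IH => z hzt; apply: hz.
rewrite (le_trans (ler_distD (x0 + t *: ei i) _ _))//=.
rewrite -natr1 mulrDl mul1r lerD// addrC addKr normrZ ger0_norm//.
by rewrite -[leRHS]mulr1 ler_pM// norm_ei.
Qed.

End fold.
End Smooth.

(** * Plans and their value; the logarithmic sup-convolution *)

Section Discount.
Variables (R : realType) (rho : R).
Notation mu := (@lebesgue_measure R).
Hypothesis rho0 : 0 < rho.

Definition disc t : R := expR (- (rho * t)).

Lemma disc_gt0 t : 0 < disc t. Proof. exact: expR_gt0. Qed.

Lemma disc_le1 t : 0 <= t -> disc t <= 1.
Proof. by move=> t0; rewrite -expR0 ler_expR lerNl oppr0 mulr_ge0// ltW. Qed.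

Lemma discD s t : disc (s + t) = disc s * disc t.
Proof. by rewrite /disc mulrDr opprD expRD. Qed.

(** 1 - e^(-rho t) is rho t up to a quadratic term. *)
Lemma disc_bounds t : 0 <= t ->
  rho * t - (rho * t) ^+ 2 <= 1 - disc t /\ 1 - disc t <= rho * t.
Proof.
move=> t0; have h0 : 0 <= rho * t by rewrite mulr_ge0// ltW.
split; last by have := expR_ge1Dx (- (rho * t)); rewrite -/(disc t); lra.
have : disc t * (1 + rho * t) <= 1.
  rewrite -ler_pdivlMl ?disc_gt0// mulr1 /disc -expRN opprK.
  exact: expR_ge1Dx.
have := disc_gt0 t; set D := disc t; set h := rho * t in h0 * => D0 h1.
have h1' : 0 < 1 + h by lra.
have : D <= (1 + h)^-1 by rewrite -[leRHS]mul1r ler_pdivlMr.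
suff : (1 + h)^-1 <= 1 - h + h ^+ 2 by lra.
rewrite -[leLHS]mul1r ler_pdivrMr// (_ : _ * _ = 1 + h ^+ 3); last by ring.
by rewrite lerDl exprn_ge0.
Qed.

Lemma disc0 : disc 0 = 1. Proof. by rewrite /disc mulr0 oppr0 expR0. Qed.

Lemma disc_small c e : 0 < e -> exists2 t, 0 <= t & disc t * c <= e.
Proof.
move=> e0; have ce : 0 <= `|c| / e by rewrite divr_ge0// ltW.
exists (`|c| / e / rho); first by rewrite divr_ge0// ltW.
have E : rho * (`|c| / e / rho) = `|c| / e by field; rewrite !gt_eqF.
rewrite (@le_trans _ _ (disc (`|c| / e / rho) * `|c|))//.
  by rewrite ler_wpM2l ?ler_norm// ltW// disc_gt0.
rewrite /disc E expRN mulrC ler_pdivrMr ?expR_gt0//.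
have := expR_ge1Dx (`|c| / e); rewrite -(ler_pM2l e0); apply: le_trans.
by rewrite mulrDr mulr1 mulrC divfK ?gt_eqF// lerDr ltW.
Qed.

Lemma is_derive_disc c x : is_derive x (1 : R) (fun s => - (c * disc s)) (rho * disc x * c).
Proof.
have E : (fun s => - (c * disc s)) = fun s => (- c) * expR (- rho * s).
  by apply/funext => s; rewrite /disc !mulNr.
rewrite E; have := is_derive_expRM (- rho) x => dE.
by apply: is_derive_eq; rewrite /GRing.scale/= /disc !mulNr; ring.
Qed.

Lemma continuous_disc : continuous disc.
Proof.
move=> s; rewrite /disc; under eq_fun do rewrite -mulNr; exact: continuous_expRM.
Qed.

Lemma measurable_disc : measurable_fun setT disc.
Proof. exact: measurable_realfun.continuous_measurable_fun continuous_disc. Qed.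

Lemma cont_disc c : continuous (fun s => rho * disc s * c).
Proof. by move=> s; apply: cvgMl; apply: cvgMr; exact: continuous_disc. Qed.

Lemma disc_segment a b c : a <= b ->
  \int[mu]_(s in `[a, b]) (rho * disc s * c) = c * disc a - c * disc b.
Proof.
move=> ab; rewrite (FTC2 (@cont_disc c) (fun x => is_derive_disc c x) ab).
by rewrite opprK addrC.
Qed.

Lemma disc_cvg0 : disc s @[s --> +oo] --> (0 : R).
Proof.
apply/cvgrPdist_le => e e0; have [t t0 ht] := disc_small 1 e0.
near=> s; rewrite sub0r normrN ger0_norm ?(ltW (disc_gt0 _))//.
rewrite mulr1 in ht; apply: le_trans ht.
rewrite /disc ler_expR lerN2 ler_wpM2l ?(ltW rho0)//.
Unshelve. all: by end_near. Qed.

Lemma disc_tail a c : 0 <= c ->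
  (\int[mu]_(s in `[a, +oo[) (rho * disc s * c)%:E = (c * disc a)%:E)%E.
Proof.
move=> c0; rewrite (@ge0_continuous_FTC2y _ _ (fun s => - (c * disc s)) _ 0).
- by rewrite -EFinB sub0r opprK.
- by move=> x _; rewrite !mulr_ge0 ?(ltW rho0)// ltW// disc_gt0.
- exact: continuous_subspaceT (@cont_disc c).
- rewrite -oppr0 -(mulr0 c); apply: cvgN; apply: cvgMr; exact: disc_cvg0.
- by move=> x _; have [] := is_derive_disc c x.
- apply: cvg_at_right_filter; have cF : {for a, continuous (fun s => - (c * disc s))}.
    apply: differentiable_continuous.
    by apply/derivable1_diffP; have [] := is_derive_disc c a.
  exact: cF.
- by move=> x _; rewrite derive1E; have [_ ->] := is_derive_disc c x.
Qed.

End Discount.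

(** The data of the control problem with explicit constants: one Lipschitz
    constant for f and, up to the factor 1 + |u|, for the drift with control u;
    bounds for the speed and for f; and a choice of the flows of all constant
    controls. *)
Record regular (R : realType) (d m : nat) (rho q : R) (f : 'cV[R]_d -> R)
    (a : 'cV[R]_d -> 'cV[R]_d) (B : 'cV[R]_d -> 'M[R]_(d, m)) := Regular {
  reg_rho : 0 < rho;
  reg_q1 : 1 < q;
  reg_q2 : q <= 2;
  reg_fper : Zperiodic f;
  reg_aper : Zperiodic a;
  reg_Bper : Zperiodic B;
  reg_f0 : forall x, 0 <= f x;
  lipc : R;
  lipc_gt0 : 0 < lipc;
  reg_flip : forall x y, `|f x - f y| <= lipc * `|x - y|;
  reg_blip : forall u x y,
    `|drift a B x u - drift a B y u| <= lipc * (1 + `|u|) * `|x - y|;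
  speed : R;
  reg_speed : forall x u, `|drift a B x u| <= speed * (1 + `|u|);
  fmax : R;
  reg_fmax : forall x, f x <= fmax;
  flow : 'cV[R]_m -> 'cV[R]_d -> R -> 'cV[R]_d;
  flowP : forall u x, solution (fun y => drift a B y u) x (flow u x) }.

Section PlanValue.
Variables (R : realType) (d m : nat) (rho q : R) (f : 'cV[R]_d -> R).
Variables (a : 'cV[R]_d -> 'cV[R]_d) (B : 'cV[R]_d -> 'M[R]_(d, m)).
Variable P : regular rho q f a B.
Local Notation vec := 'cV[R]_d.
Local Notation ctl := 'cV[R]_m.
Local Notation L := (lipc P).
Local Notation M := (fmax P).
Local Notation phi := (flow P).
Local Notation cost u := (ctrl_cost q u).
Local Notation disc := (disc rho).
Implicit Types (x y z : vec) (u : ctl).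

Let rho0 := reg_rho P.
Let L0 := lipc_gt0 P.

(** Lipschitz constant of the drift for the control u: its flow separates
    points at this exponential rate at most. *)
Definition growth u := L * (1 + `|u|).
Definition vel u := speed P * (1 + `|u|).

Lemma u1_gt0 u : 0 < 1 + `|u|. Proof. by rewrite ltr_wpDr. Qed.

Lemma growth_gt0 u : 0 < growth u.
Proof. by rewrite mulr_gt0// u1_gt0. Qed.

Lemma vel_ge0 u : 0 <= vel u.
Proof. exact: le_trans (reg_speed P 0 u). Qed.

Lemma fmax_ge0 : 0 <= M.
Proof. exact: le_trans (reg_f0 P 0) (reg_fmax P 0). Qed.

Lemma cost_ge0 u : 0 <= cost u.
Proof. by rewrite divr_ge0 ?powR_ge0//; have := reg_q1 P; lra. Qed.

Lemma growth_le u : growth u <= 2 * L * (1 + cost u).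
Proof.
rewrite /growth (mulrC 2) -mulrA ler_wpM2l ?(ltW L0)//.
by have := norm_le_ctrl_cost u (reg_q1 P) (reg_q2 P); lra.
Qed.

Lemma flow0 u x t : t <= 0 -> phi u x t = x.
Proof. by case: (flowP P u x) => _ + _; exact. Qed.

Lemma flow_cont u x : continuous (phi u x).
Proof. by case: (flowP P u x). Qed.

Lemma flow_dist u x y t : 0 <= t ->
  `|phi u x t - phi u y t| <= expR (growth u * t) * `|x - y|.
Proof. exact: solution_dist (reg_blip P u) (growth_gt0 u) _ _ _ _ (flowP P u x) (flowP P u y) _. Qed.

Lemma flow_lip u x s t : `|phi u x t - phi u x s| <= vel u * `|t - s|.
Proof.
exact: (solution_displacement (reg_blip P u) (fun x => reg_speed P x u) (flowP P u x)).
Qed.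

Lemma drift_per u x i : drift a B (x + delta_mx i ord0) u = drift a B x u.
Proof. by rewrite /drift (reg_aper P) (reg_Bper P). Qed.

(** The translate of a solution by an integer vector is a solution with the
    same initial value, and solutions are unique. *)
Lemma flow_shift u x i t : phi u (x + delta_mx i ord0) t = phi u x t + delta_mx i ord0.
Proof.
have [t0|/ltW t0] := leP t 0; first by rewrite !flow0.
apply/eqP; rewrite -subr_eq0 -normr_le0.
have := solution_dist (reg_blip P u) (growth_gt0 u) (flowP P u (x + delta_mx i ord0))
  (solution_shift (fun x => drift_per u x i) (flowP P u x)) t0.
by rewrite subrr normr0 mulr0.
Qed.

Lemma flow_tangent u x v c t : 0 <= t ->
  (forall s, 0 <= s -> s <= t -> `|drift a B (phi u x s) u - v| <= c) ->
  `|phi u x t - x - t *: v| <= t * c.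
Proof. by move=> t0; exact: (solution_tangent (reg_blip P u) (flowP P u x)). Qed.

(** Controls that are constant on finitely many successive intervals suffice to
    approach the optimal value, and their trajectories are compositions of
    flows. *)
Definition plan := seq ({nonneg R} * ctl)%type.

(** During a stage of length h the state stays within h vel(u) of x, so this
    bounds the running cost of the whole stage by a constant.  With a constant,
    the integral of the discounted cost over the stage is
    (1 - e^(-rho h)) stage_cost. *)
Definition stage_cost x u h : R := f x + L * h * vel u + cost u.

(** When the plan is over, the control 0 is applied for ever: the discounted
    cost to go is then at most the bound M of f. *)
Fixpoint plan_cost (l : plan) x : R :=
  if l is (h, u) :: l' then
    (1 - disc h%:num) * stage_cost x u h%:num
      + disc h%:num * plan_cost l' (phi u x h%:num)
  else M.

Definition plan_value x : R := inf (range (plan_cost ^~ x)).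
Local Notation V := plan_value.

Lemma stage_cost_ge0 x u h : 0 <= h -> 0 <= stage_cost x u h.
Proof.
move=> h0; rewrite addr_ge0 ?cost_ge0// addr_ge0 ?(reg_f0 P)//.
by rewrite mulr_ge0 ?vel_ge0// mulr_ge0// ltW.
Qed.

Lemma plan_cost_ge0 l x : 0 <= plan_cost l x.
Proof.
elim: l x => [|[h u] l IH] x /=; first exact: fmax_ge0.
apply: addr_ge0; apply: mulr_ge0; rewrite ?IH ?(ltW (disc_gt0 _ _))//.
  by rewrite subr_ge0 (disc_le1 rho0).
exact: stage_cost_ge0.
Qed.

Lemma plan_cost_inf x : has_inf (range (plan_cost ^~ x)).
Proof.
split; first by exists (plan_cost [::] x), [::].
by exists 0 => _ [l _ <-]; exact: plan_cost_ge0.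
Qed.

Lemma plan_value_le l x : V x <= plan_cost l x.
Proof. by apply: ge_inf; [exact: (plan_cost_inf x).2|exists l]. Qed.

Lemma plan_value_ge x c : (forall l, c <= plan_cost l x) -> c <= V x.
Proof.
move=> h; apply: lb_le_inf; first exact: (plan_cost_inf x).1.
by move=> _ [l _ <-].
Qed.

Lemma plan_value_ge0 x : 0 <= V x.
Proof. by apply: plan_value_ge => l; exact: plan_cost_ge0. Qed.

Lemma plan_value_max x : V x <= M. Proof. exact: (plan_value_le [::]). Qed.

(** A stage followed by an almost optimal plan is a plan. *)
Lemma plan_value_dpp x u h : 0 <= h ->
  V x <= (1 - disc h) * stage_cost x u h + disc h * V (phi u x h).
Proof.
move=> h0; rewrite -lerBlDl -ler_pdivrMl ?disc_gt0//; apply: plan_value_ge => l.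
rewrite ler_pdivrMl ?disc_gt0// lerBlDl.
exact: (plan_value_le ((NngNum h0, u) :: l)).
Qed.

Lemma plan_cost_per l : Zperiodic (plan_cost l).
Proof.
elim: l => [//|[h u] l IH] x i /=.
by rewrite flow_shift IH /stage_cost (reg_fper P).
Qed.

Lemma plan_value_per : Zperiodic V.
Proof.
by move=> x i; rewrite /plan_value; under eq_fun do rewrite plan_cost_per.
Qed.

(** The logarithm turns the multiplicative growth of distances under the flow
    into an additive growth of the penalty (penalty_exp), uniformly in the
    distance, while keeping the penalty Lipschitz (penalty_add). *)
Definition penalty (th eta D : R) := th * ln (1 + D / eta).

Section Penalty.
Variables th eta : R.
Hypotheses (th0 : 0 < th) (eta0 : 0 < eta).
Local Notation F := (penalty th eta).

Lemma penalty_arg D : 0 <= D -> 1 <= 1 + D / eta.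
Proof. by move=> D0; rewrite lerDl divr_ge0// ltW. Qed.

Lemma penalty_ge0 D : 0 <= D -> 0 <= F D.
Proof. by move=> D0; rewrite mulr_ge0 ?ln_ge0 ?penalty_arg// ltW. Qed.

Lemma penalty0 : F 0 = 0. Proof. by rewrite /penalty mul0r addr0 ln1 mulr0. Qed.

Lemma penalty_mono D D' : 0 <= D -> D <= D' -> F D <= F D'.
Proof.
move=> D0 DD'; rewrite /penalty ler_wpM2l ?(ltW th0)// ler_ln ?posrE.
- by rewrite lerD2l ler_wpM2r// invr_ge0 ltW.
- exact: lt_le_trans (penalty_arg D0).
- exact: lt_le_trans (penalty_arg (le_trans D0 DD')).
Qed.

Lemma penalty_add D j : 0 <= D -> 0 <= j -> F (D + j) <= F D + th / eta * j.
Proof.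
move=> D0 j0; rewrite /penalty -mulrA -mulrDr ler_wpM2l ?(ltW th0)//.
have D1 := lt_le_trans ltr01 (penalty_arg D0).
have j1 := lt_le_trans ltr01 (penalty_arg j0).
rewrite [_^-1 * j]mulrC.
apply: (@le_trans _ _ (ln ((1 + D / eta) * (1 + j / eta)))).
  rewrite ler_ln ?posrE ?mulr_gt0//.
    have := divr_ge0 D0 (ltW eta0); have := divr_ge0 j0 (ltW eta0).
    by rewrite mulrDl => x0 y0; have := mulr_ge0 x0 y0; lra.
  by rewrite (lt_le_trans ltr01)// penalty_arg// addr_ge0.
rewrite lnM ?posrE// lerD2l; apply: le_ln1Dx.
by rewrite (lt_le_trans (ltrN10 _))// divr_ge0// ltW.
Qed.

Lemma penalty_exp D c : 0 <= D -> 0 <= c -> F (expR c * D) <= F D + th * c.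
Proof.
move=> D0 c0; rewrite /penalty -mulrDr ler_wpM2l ?(ltW th0)//.
have D1 := lt_le_trans ltr01 (penalty_arg D0).
have -> : ln (1 + D / eta) + c = ln ((1 + D / eta) * expR c).
  by rewrite lnM ?posrE ?expR_gt0// expRK.
rewrite ler_ln ?posrE ?mulr_gt0 ?expR_gt0//.
  rewrite mulrDl mul1r (_ : D / eta * expR c = expR c * D / eta); last by ring.
  by rewrite lerD2r; have := expR_ge1Dx c; lra.
by rewrite (lt_le_trans ltr01)// penalty_arg// mulr_ge0// expR_ge0.
Qed.

Lemma penalty_inv D c : 0 <= D -> F D <= c -> D <= eta * expR (c / th).
Proof.
move=> D0; rewrite /penalty mulrC -ler_pdivlMr// -ler_expR lnK ?posrE; last first.
  exact: lt_le_trans ltr01 (penalty_arg D0).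
move=> h; have : D / eta <= expR (c / th) by lra.
by rewrite ler_pdivrMr// mulrC.
Qed.

Definition supconv x : R := sup (range (fun y => V y - F `|x - y|)).
Local Notation W := supconv.

Lemma supconv_sup x : has_sup (range (fun y => V y - F `|x - y|)).
Proof.
split; first by exists (V x - F `|x - x|), x.
exists M => _ [y _ <-]; rewrite (le_trans _ (plan_value_max y))//.
by rewrite lerBlDr lerDl penalty_ge0.
Qed.

Lemma supconv_ge x y : V y - F `|x - y| <= W x.
Proof. by apply: ub_le_sup; [exact: (supconv_sup x).2|exists y]. Qed.

Lemma supconv_le x c : (forall y, V y - F `|x - y| <= c) -> W x <= c.
Proof.
move=> h; apply: ge_sup; first exact: (supconv_sup x).1.
by move=> _ [y _ <-].
Qed.

Lemma plan_value_le_supconv x : V x <= W x.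
Proof. by have := supconv_ge x x; rewrite subrr normr0 penalty0 subr0. Qed.

Lemma supconv_max x : W x <= M.
Proof.
by apply: supconv_le => y; rewrite (le_trans _ (plan_value_max y))// lerBlDr lerDl penalty_ge0.
Qed.

Lemma supconv_ge0 x : 0 <= W x. Proof. exact: le_trans (plan_value_ge0 x) (plan_value_le_supconv x). Qed.

(** A supremum of translates of one Lipschitz function, whatever the regularity
    of plan_value. *)
Lemma supconv_lip : klip (th / eta) W.
Proof.
have H x y : W x - W y <= th / eta * `|x - y|.
  rewrite lerBlDr; apply: supconv_le => z.
  have : F `|y - z| <= F `|x - z| + th / eta * `|x - y|.
    apply: le_trans (penalty_add _ _) => //; apply: penalty_mono => //.
    by have := ler_distD x y z; rewrite (distrC y x); lra.
  by have := supconv_ge y z; lra.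
by move=> x y; rewrite ler_norml H andbT lerNl opprB distrC.
Qed.

Lemma supconv_per : Zperiodic W.
Proof.
move=> x i; apply/eqP; rewrite eq_le; apply/andP; split; apply: supconv_le => y.
  have := supconv_ge x (y - delta_mx i ord0).
  by rewrite -[V (y - _)](plan_value_per _ i) subrK opprB addrA.
have := supconv_ge (x + delta_mx i ord0) (y + delta_mx i ord0).
by rewrite plan_value_per opprD addrACA subrr addr0.
Qed.

(** A point y with penalty above M does not compete, as 0 <= V <= M; otherwise
    z and y are within eta e^(M/th) of each other, and the inequality for V at y
    is transported to z along the two flows. *)
Lemma supconv_dpp z u h : 0 <= h ->
  W z <= (1 - disc h) * (stage_cost z u h + L * (eta * expR (M / th)))
         + disc h * W (phi u z h) + th * (growth u * h).
Proof.
move=> h0; have e0 := ltW (disc_gt0 rho h); have e1 : 0 <= 1 - disc h by rewrite subr_ge0 (disc_le1 rho0).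
have g0 : 0 <= growth u * h by rewrite mulr_ge0// ltW// growth_gt0.
set c := L * (eta * _).
have c0 : 0 <= c by rewrite !mulr_ge0 ?expR_ge0 ?(ltW L0) ?(ltW eta0).
apply: supconv_le => y; have [big|small] := leP M (F `|z - y|).
  apply: (@le_trans _ _ 0); first by have := plan_value_max y; lra.
  have := mulr_ge0 e0 (supconv_ge0 (phi u z h)).
  have := mulr_ge0 (ltW th0) g0.
  have := mulr_ge0 e1 (addr_ge0 (stage_cost_ge0 z u h0) c0); lra.
have Dc : L * `|z - y| <= c by rewrite ler_wpM2l ?(ltW L0)// penalty_inv// ltW.
have fy : stage_cost y u h <= stage_cost z u h + c.
  rewrite /stage_cost; have := le_trans (reg_flip P z y) Dc.
  by rewrite ler_norml; lra.
have h1 := plan_value_dpp y u h0.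
have h2 := supconv_ge (phi u z h) (phi u y h).
have h3 : F `|phi u z h - phi u y h| <= F `|z - y| + th * (growth u * h).
  by apply: le_trans (penalty_exp _ g0) => //; apply: penalty_mono => //; exact: flow_dist.
have h4 := ler_wpM2l e1 fy.
have h5 := ler_wpM2l e0 h2.
have h6 := ler_wpM2l e0 h3.
have h7 : disc h * (F `|z - y| + th * (growth u * h)) <= F `|z - y| + th * (growth u * h).
  by rewrite ler_piMl ?(disc_le1 rho0)// addr_ge0 ?penalty_ge0// mulr_ge0// ltW.
by move: h1 h4 h5 h6 h7; rewrite mulrBr; lra.
Qed.

End Penalty.
End PlanValue.

(** * Almost optimal subsolutions *)

Lemma le_of_le_smallM (R : realType) (x y b : R) :
  (forall h, 0 < h -> h <= 1 -> x <= y + h * b) -> x <= y.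
Proof.
move=> H; apply/ler_addgt0Pl => e e0; rewrite addrC.
have b0 : 0 < `|b| + 1 by rewrite ltr_wpDl.
pose h := Num.min 1 (e / (`|b| + 1)).
have h0 : 0 < h by rewrite lt_min ltr01 divr_gt0.
apply: (le_trans (H h h0 _)); first by rewrite ge_min lexx.
rewrite lerD2l (@le_trans _ _ (h * (`|b| + 1)))//.
  by rewrite ler_wpM2l ?(ltW h0)// (le_trans (ler_norm b))// lerDl.
by rewrite -ler_pdivlMr// ge_min lexx orbT.
Qed.

Lemma C1_affine (R : realType) (d : nat) (g : 'cV[R]_d -> R) (k e : R) :
  C1_torus g -> C1_torus (fun x => k * g x - e) /\
  forall x, grad (fun x => k * g x - e) x = k *: grad g x.
Proof.
move=> [gp dg cg].
have dk x : differentiable (fun x => k * g x) x.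
  by apply: (@differentiableZ _ _ R^o g k x); exact: dg.
have gk x : grad (fun x => k * g x - e) x = k *: grad g x.
  apply/colP => i; rewrite !mxE.
  rewrite (@deriveB _ _ R^o (fun x => k * g x) (cst e)); [|exact: diff_derivable|exact: derivable_cst].
  rewrite derive_cst subr0 (@deriveZ _ _ R^o g k)//; exact: diff_derivable.
split; [split|exact: gk].
- by move=> x i; rewrite gp.
- by move=> x; apply: (@differentiableB _ _ R^o (fun x => k * g x) (cst e)).
- rewrite (_ : grad _ = fun x => k *: grad g x); last by apply/funext.
  by move=> x; exact: (cvgZl_tmp (k := k) (cg x)).
Qed.

Section Subsolution.
Variables (R : realType) (d m : nat) (rho q : R) (f : 'cV[R]_d -> R).
Variables (a : 'cV[R]_d -> 'cV[R]_d) (B : 'cV[R]_d -> 'M[R]_(d, m)).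
Variable P : regular rho q f a B.
Local Notation vec := 'cV[R]_d.
Local Notation ctl := 'cV[R]_m.
Local Notation L := (lipc P).
Local Notation M := (fmax P).
Local Notation phi := (flow P).
Local Notation cost u := (ctrl_cost q u).
Local Notation disc := (disc rho).
Implicit Types (x y z : vec) (u : ctl).

Let rho0 := reg_rho P.
Let L0 := lipc_gt0 P.

(** A Lipschitz function with an approximate dynamic programming inequality
    becomes, once smoothed, an approximate subsolution of the
    Hamilton-Jacobi inequality: smoothing keeps the inequality with phi^u_h z
    replaced by the translation z + h v, where v is the drift at the centre x; a
    second order Taylor expansion, division by h and h -> 0 finish. *)
Lemma smooth_subsolution (w : vec -> R) (k r r' c th : R) x u :
  0 <= k -> klip k w -> 0 < r -> d%:R * r <= r' -> 0 <= c -> (forall x, 0 <= w x) ->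
  (forall z h, 0 <= h -> w z <= (1 - disc h) * (stage_cost P z u h + c)
         + disc h * w (phi u z h) + th * (growth P u * h)) ->
  calL rho a B (smooth r w) x u <=
    f x + cost u + L * r' + c + rho^-1 * (k * r' + th) * growth P u.
Proof.
move=> k0 wk r0 rr' c0 w0 wdpp.
have r'0 : 0 <= r' by apply: le_trans rr'; rewrite mulr_ge0// ltW.
set v := drift a B x u; set Lam := growth P u; set g := smooth r w.
have Lam0 : 0 <= Lam := ltW (growth_gt0 P u).
have [G hG] := choice (smooth_partial r0 k0 wk).
have [C C0 hC] := partials_taylor hG.
have [_ gradg] := partials_C1 hG.
set D := dotv (grad g x) v.
have {}hC h : g (x + h *: v) <= g x + h * D + C * `|v| ^+ 2 * h ^+ 2.
  have := hC x (h *: v); rewrite -/g.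
  have -> : \sum_(i < d) (h *: v) i ord0 * G i x = h * D.
    rewrite /D gradg /dotv mulr_sumr; apply: eq_bigr => i _; rewrite !mxE; ring.
  by rewrite normrZ exprMn real_normK ?num_real// ler_norml => /andP[_]; lra.
have g0 : 0 <= g x.
  rewrite /g /smooth; elim: (enum _) x {v D hC} => [|i s IH] x /=; first exact: w0.
  by rewrite mulr_ge0 ?invr_ge0 ?(ltW r0)// Rintegral_ge0.
set S0 := f x + cost u + L * r' + c.
set vu := vel P u.
have vu0 : 0 <= vu := vel_ge0 P u.
have main h : 0 < h -> h <= 1 ->
    rho * g x - D <= rho * S0 + (k * r' + th) * Lam +
      h * (rho ^+ 2 * g x + rho * (L * vu) + k * Lam * vu + rho * `|D| + C * `|v| ^+ 2).
  move=> h_gt0 h1; have h0 := ltW h_gt0.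
  have e0 := ltW (disc_gt0 rho h); have e1 : 0 <= 1 - disc h by rewrite subr_ge0 (disc_le1 rho0).
  have [p1 p2] := disc_bounds rho0 h0.
  set p := 1 - disc h in e1 p1 p2.
  have pE : disc h = 1 - p by rewrite /p; ring.
  (* Kh collects the cost of the stage of length h and the two errors, from
     replacing the flow by the translation h *: v and from the penalty. *)
  pose Kh := p * (S0 + L * h * vu) + k * (h * (Lam * (r' + h * vu))) + th * (Lam * h).
  have step : g x <= Kh + disc h * g (x + h *: v).
    apply: (smooth_shift_le r0 wk) => z hz.
    have zr := le_trans hz rr'.
    apply: (le_trans (wdpp z h h0)).
    have h2 : f z <= f x + L * r'.
      have := le_trans (reg_flip P z x) (ler_wpM2l (ltW L0) zr).
      by rewrite ler_norml; lra.
    have h3 : `|phi u z h - z - h *: v| <= h * (Lam * (r' + h * vu)).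
      apply: flow_tangent => // s s0 sh; apply: (le_trans (reg_blip P u _ _)).
      rewrite -/(growth P u) -/Lam ler_wpM2l//.
      have := flow_lip P u z 0 s; rewrite (flow0 P u z (lexx 0)) subr0 (ger0_norm s0) => h4.
      rewrite (le_trans (ler_distD z _ _))// addrC lerD// (le_trans h4)// mulrC.
      by rewrite ler_wpM2r.
    have h4 : w (phi u z h) <= w (z + h *: v) + k * (h * (Lam * (r' + h * vu))).
      have := wk (phi u z h) (z + h *: v); rewrite opprD addrA => h5.
      have := le_trans h5 (ler_wpM2l k0 h3).
      by rewrite ler_norml; lra.
    have h5 := ler_wpM2l e0 h4.
    have h6 : disc h * (k * (h * (Lam * (r' + h * vu)))) <= k * (h * (Lam * (r' + h * vu))).
      rewrite ler_piMl ?(disc_le1 rho0)//.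
      exact: mulr_ge0 k0 (mulr_ge0 h0 (mulr_ge0 Lam0 (addr_ge0 r'0 (mulr_ge0 h0 vu0)))).
    have h7 : p * (stage_cost P z u h + c) <= p * (S0 + L * h * vu).
      by rewrite ler_wpM2l// /stage_cost -/vu /S0; lra.
    by rewrite /Kh -/Lam -/p; move: h5 h6 h7; rewrite mulrDr; lra.
  have s1 := ler_wpM2l e0 (hC h).
  have S00 : 0 <= S0 + L * h * vu.
    apply: addr_ge0; last exact: mulr_ge0 (mulr_ge0 (ltW L0) h0) vu0.
    apply: addr_ge0 c0; apply: addr_ge0 (mulr_ge0 (ltW L0) r'0).
    exact: addr_ge0 (reg_f0 P x) (cost_ge0 P u).
  (* The factor p = 1 - disc h is now replaced by rho * h, from above where it
     multiplies a cost and from below where it multiplies g x. *)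
  have s2 : p * (S0 + L * h * vu) <= rho * h * (S0 + L * h * vu) by rewrite ler_wpM2r.
  have s3 : (rho * h - (rho * h) ^+ 2) * g x <= p * g x by rewrite ler_wpM2r.
  have s4 : disc h * (C * `|v| ^+ 2 * h ^+ 2) <= C * `|v| ^+ 2 * h ^+ 2.
    rewrite ler_piMl ?(disc_le1 rho0)//.
    exact: mulr_ge0 (mulr_ge0 C0 (sqr_ge0 _)) (sqr_ge0 _).
  have s5 : - (p * (h * D)) <= rho * h * (h * `|D|).
    rewrite -mulrN -mulrN (@le_trans _ _ (p * (h * `|D|)))//.
      by rewrite ler_wpM2l// ler_wpM2l// -normrN ler_norm.
    by rewrite ler_wpM2r// mulr_ge0.
  rewrite -(ler_pM2l h_gt0).
  rewrite pE in step s1 s4.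
  have : (1 - p) * (g x + h * D + C * `|v| ^+ 2 * h ^+ 2) =
     g x - p * g x + h * D - p * (h * D) + (1 - p) * (C * `|v| ^+ 2 * h ^+ 2) by ring.
  move: step s1 s2 s3 s4 s5; rewrite /Kh => step s1 s2 s3 s4 s5 s6.
  have hh : h * (h * (k * (Lam * vu))) = k * (h * (Lam * (h * vu))) by ring.
  suff : h * (rho * g x - D) <= rho * h * (S0 + L * h * vu) + k * (h * (Lam * (r' + h * vu)))
     + th * (Lam * h) + (rho * h) ^+ 2 * g x + rho * h * (h * `|D|) + C * `|v| ^+ 2 * h ^+ 2.
    move/le_trans; apply; rewrite le_eqVlt; apply/orP; left; apply/eqP; ring.
  rewrite (_ : h * (rho * g x - D) = rho * h * g x - h * D); last by ring.
  move: s3; rewrite mulrBl => s3.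
  by lra.
have := le_of_le_smallM main => fin.
rewrite /calL -/v -/D -(ler_pM2l rho0) mulrBr mulVKf ?gt_eqF// -/g.
rewrite (le_trans fin)// [leRHS]mulrDr -/S0 lerD2l.
by rewrite -mulrA mulVKf ?gt_eqF.
Qed.

(** The constants are chosen in the order e, th, eta, r: th makes the drift of
    the penalty cost at most (e/4)(1 + R(u)), eta makes the competitors in the
    sup-convolution e/4-close in running cost, and r makes each smoothing error
    at most e/4, up to a factor 1 + R(u).  Division of the smoothed function by
    1 + e then brings the coefficient of R(u) back to 1, and e is subtracted to
    remove the remaining constant. *)
Lemma near_optimal_subsolution eps : 0 < eps -> exists U : vec -> R,
  dual_feasible rho q f a B U /\ forall x, plan_value P x <= U x + eps.
Proof.
move=> eps0.
have M0 : 0 <= M := fmax_ge0 P; have L1 : 0 < L := lipc_gt0 P.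
have [e [e0 eE]] : exists e, 0 < e /\ e * (M + 2) = eps.
  exists (eps / (M + 2)); rewrite divr_gt0//; last by lra.
  by rewrite divfK// gt_eqF//; lra.
(* Each constant is only known through its equation: the linear arithmetic
   below would otherwise unfold these definitions. *)
have [th [th0 thE]] : exists th, 0 < th /\ th = e * rho / (8 * L).
  by eexists; split; [|reflexivity]; rewrite divr_gt0 ?mulr_gt0.
have [eta [eta0 etaE]] : exists eta, 0 < eta /\ L * (eta * expR (M / th)) = e / 4.
  exists (e / (4 * L) * expR (- (M / th))); split.
    by rewrite mulr_gt0 ?expR_gt0// divr_gt0 ?mulr_gt0.
  by rewrite expRN -(mulrA (e / _)) mulVf ?gt_eqF ?expR_gt0// mulr1; field; rewrite gt_eqF.
have [k [k0 kE]] : exists k, 0 < k /\ k = th / eta.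
  by eexists; split; [|reflexivity]; rewrite divr_gt0.
have kL0 : 0 < k * (2 * L / rho) by rewrite mulr_gt0// divr_gt0 ?mulr_gt0.
have [N [N0 NE]] : exists N, 0 < N /\ N = L + k * (2 * L / rho) + k.
  by eexists; split; [|reflexivity]; rewrite addr_gt0// addr_gt0.
have [r' [r'0 Nr]] : exists r', 0 < r' /\ N * r' = e / 4.
  exists (e / (4 * N)); rewrite divr_gt0 ?mulr_gt0//; split => //.
  by field; rewrite gt_eqF.
have d1 : 0 < (d%:R + 1 : R) by rewrite ltr_wpDl.
have [r [r0 rr']] : exists r, 0 < r /\ d%:R * r <= r'.
  exists (r' / (d%:R + 1)); rewrite divr_gt0//; split => //.
  by rewrite mulrA ler_pdivrMr// mulrC ler_wpM2l ?(ltW r'0)// lerDl.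
pose w := supconv P th eta.
have wlip : klip k w by rewrite kE; exact: supconv_lip.
have wper : Zperiodic w by exact: supconv_per.
pose g := smooth r w.
have gC1 : C1_torus g := smooth_C1 r0 (ltW k0) wlip wper.
have [UC1 Ugrad] := C1_affine (1 + e)^-1 e gC1.
have e1 : 0 < 1 + e by lra.
have Lr : L * r' <= e / 4.
  rewrite -Nr ler_wpM2r ?(ltW r'0)//  NE; lra.
have kr : k * r' <= e / 4 by rewrite -Nr ler_wpM2r ?(ltW r'0)//  NE; lra.
have kLr : k * (2 * L / rho) * r' <= e / 4 by rewrite -Nr ler_wpM2r ?(ltW r'0)//  NE; lra.
have thL : rho^-1 * th * (2 * L) = e / 4.
  by rewrite thE; field; rewrite !gt_eqF.
exists (fun x => (1 + e)^-1 * g x - e); split; first split => // x u.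
  have c0 : 0 <= L * (eta * expR (M / th)) by rewrite etaE; lra.
  have := @smooth_subsolution w k r r' _ th x u (ltW k0) wlip r0 rr' c0
    (supconv_ge0 P th0 eta0) (fun z h h0 => supconv_dpp P th0 eta0 z u h0).
  rewrite -/g etaE => sub.
  have cu := cost_ge0 P u.
  have gr : rho^-1 * (k * r' + th) * growth P u <= e / 2 * (1 + cost u).
    have h1 := growth_le P u.
    have h2 : 0 <= rho^-1 * (k * r' + th).
      by rewrite mulr_ge0 ?invr_ge0 ?(ltW rho0)// addr_ge0 ?(ltW th0)// mulr_ge0// ltW.
    rewrite (le_trans (ler_wpM2l h2 h1))// mulrA ler_wpM2r//; first by lra.
    rewrite mulrDr mulrDl thL.
    rewrite (_ : rho^-1 * (k * r') * (2 * L) = k * (2 * L / rho) * r'); last by ring.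
    by lra.
  have {}sub : calL rho a B g x u <= f x + (1 + e) * cost u + e.
    by apply: (le_trans sub); have := mulr_ge0 (ltW e0) cu; lra.
  have -> : calL rho a B (fun x => (1 + e)^-1 * g x - e) x u =
            (1 + e)^-1 * calL rho a B g x u - e.
    rewrite /calL Ugrad /dotv mulrBr addrAC; congr (_ - _ - _).
    rewrite !mulr_sumr; apply: eq_bigr => i _; rewrite !mxE; ring.
  rewrite lerBlDr ler_pdivrMl// (le_trans sub)//.
  by have := mulr_ge0 (ltW e0) (reg_f0 P x); have := mulr_gt0 e0 e0; lra.
move=> x; have h1 := plan_value_le_supconv P th0 eta0 x.
have := smooth_close r0 (ltW k0) wlip x; rewrite -/g => h2.
have h3 : k * r * d%:R <= e / 4.
  by rewrite (le_trans _ kr)// -mulrA ler_wpM2l ?(ltW k0)// mulrC.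
have {h2 h3} h2 := le_trans h2 h3.
have h3 : w x <= g x + e / 4 by move: h2; rewrite ler_norml; lra.
have h4 : g x <= M + e / 4.
  by have := supconv_max P th0 eta0 x; move: h2; rewrite ler_norml -/w; lra.
set y := (1 + e)^-1 * g x.
have yE : g x = y + e * y by rewrite /y; field; rewrite gt_eqF.
have yM : y <= M + 4^-1.
  rewrite -(ler_pM2l e1) mulrDl mul1r -yE (le_trans h4)//.
  by have := mulr_ge0 (ltW e0) M0; lra.
have h5 := ler_wpM2l (ltW e0) yM.
by rewrite -eE; move: h1 h3; rewrite yE -/w; lra.
Qed.
End Subsolution.

(** * Uniform continuity and the chain rule along trajectories *)

Section Heine.
Variables (R : realType).

Lemma heine (U W : normedModType R) (K : set U) (g : U -> W) : compact K ->
  (forall x, K x -> g @ within K (nbhs x) --> g x) ->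
  forall e, 0 < e -> exists2 r, 0 < r &
    forall x y, K x -> K y -> `|x - y| < r -> `|g x - g y| < e.
Proof.
move=> cK cg e e0; have /compact_near_coveringP covK := cK.
have e2 : 0 < e / 2 by rewrite divr_gt0.
have := covK R (0 : R)^'+ (fun r x => K x -> forall y, K y -> `|x - y| < r -> `|g x - g y| < e).
case.
  move=> x Kx; have /cvgrPdist_lt/(_ _ e2) := cg x Kx.
  rewrite near_withinE => /nbhs_normP[r /= r0 hr].
  have r2 : 0 < r / 2 by rewrite divr_gt0.
  exists ([set z | `|x - z| < r / 2], [set s | s < r / 2]).
    split => /=; last exact: nbhs_right_lt.
    by apply/nbhs_normP; exists (r / 2).
  move=> [z s] /= [xz sr] Kz y Ky zy.
  have h1 : `|g x - g z| < e / 2 by apply: hr => //=; rewrite (lt_trans xz)//; lra.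
  have h2 : `|g x - g y| < e / 2.
    apply: hr => //=; rewrite (le_lt_trans (ler_distD z _ _))//; lra.
  rewrite (le_lt_trans (ler_distD (g x) _ _))// (distrC (g z)); lra.
move=> r /= r0 hr.
exists (r / 2); first by rewrite divr_gt0.
move=> x y Kx Ky xy; apply: (hr (r / 2)) => //=; last by rewrite divr_gt0.
by rewrite sub0r normrN ger0_norm ?divr_ge0 ?(ltW r0)//; lra.
Qed.

Lemma compact_cvball n (c : R) : compact [set v : 'cV[R]_n | `|v| <= c].
Proof.
have [c0|c0] := ltP c 0.
  rewrite (_ : [set _ | _] = set0); first exact: compact0.
  by apply/seteqP; split => // v /= vc; have := lt_le_trans (le_lt_trans vc c0) (normr_ge0 v); rewrite ltxx.
have tr_norm (v : 'rV[R]_n) : `|v^T| <= `|v|.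
  by apply: mxnorm_le => // i j; rewrite mxE mxnorm_coord.
have -> : [set v : 'cV[R]_n | `|v| <= c] =
    (fun v : 'rV[R]_n => v^T) @` [set v : 'rV[R]_n | forall i : 'I_n, `[-c, c]%classic (v ord0 i)].
  apply/seteqP; split => [v /= vc|_ [v /= vc <-]].
    exists v^T; last by rewrite trmxK.
    by move=> i; rewrite mxE in_itv/= -ler_norml (le_trans (mxnorm_coord _ _ _)).
  by apply: cvnorm_le => // i; rewrite mxE ler_norml; have := vc i; rewrite in_itv.
apply: continuous_compact.
  apply: continuous_subspaceT; apply: (@lip_continuous R _ _ _ 1) => u v.
  rewrite -linearB mul1r; exact: tr_norm.
by apply: (@rV_compact R _ (fun=> `[- c, c]%classic)) => _; exact: segment_compact.
Qed.

Lemma periodic_unif d (W : normedModType R) (g : 'cV[R]_d -> W) :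
  Zperiodic g -> continuous g -> forall e, 0 < e -> exists2 r, 0 < r &
    forall x y, `|x - y| < r -> `|g x - g y| < e.
Proof.
move=> gp cg e e0.
have [x _|r r0 hr] := heine (@compact_cvball d 2) _ e0 (g := g).
  by apply: cvg_within_filter; exact: cg.
exists (Num.min r 1); first by rewrite lt_min r0 ltr01.
move=> x y; rewrite lt_min => /andP[xr x1].
pose z := (fun i => - Num.floor (x i ord0)) : 'I_d -> int.
rewrite -(Zperiodic_zvec gp x z) -(Zperiodic_zvec gp y z).
have nx : `|x + zvec R z| <= 1 by rewrite -torus_repE cube_norm//; exact: torus_rep_cube.
have xy : x + zvec R z - (y + zvec R z) = x - y by rewrite opprD addrACA subrr addr0.
apply: hr; rewrite ?xy//=; first by rewrite (le_trans nx)//; lra.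
rewrite -[y + zvec R z](subrK (x + zvec R z)) (le_trans (ler_normD _ _))//.
by rewrite distrC xy; lra.
Qed.

Lemma periodic_bounded d (W : normedModType R) (g : 'cV[R]_d -> W) :
  Zperiodic g -> continuous g -> exists2 c, 0 <= c & forall x, `|g x| <= c.
Proof.
move=> gp cg.
have /compact_bounded : compact (g @` [set v : 'cV[R]_d | `|v| <= 1]).
  by apply: continuous_compact; [exact: continuous_subspaceT|exact: compact_cvball].
move=> [c [_ hc]]; exists (`|c| + 1); first by rewrite addr_ge0.
move=> x; rewrite -(Zperiodic_rep gp); apply: (hc (`|c| + 1)).
  by rewrite (le_lt_trans (ler_norm c))// ltrDl.
exists (torus_rep x) => //=; rewrite cube_norm//; exact: torus_rep_cube.
Qed.

End Heine.

Section ChainRule.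
Variables (R : realType).
Notation mu := (@lebesgue_measure R).

(** A substitute for the fundamental theorem of calculus when the integrand w
    is merely integrable: over a partition of [0, T] into short intervals the
    errors add up to at most e int_0^T G. *)
Lemma increments_integral (Y w G : R -> R) T : 0 <= T ->
  mu.-integrable `[0, T] (EFin \o w) -> mu.-integrable `[0, T] (EFin \o G) ->
  (forall e, 0 < e -> exists2 r, 0 < r & forall s t, 0 <= s -> s <= t -> t <= T -> t - s < r ->
     `|Y t - Y s - \int[mu]_(x in `[s, t]) w x| <= e * \int[mu]_(x in `[s, t]) G x) ->
  Y T - Y 0 = \int[mu]_(x in `[0, T]) w x.
Proof.
move=> T0 iw iG H; apply/eqP; rewrite -subr_eq0 -normr_le0.
apply/ler_addgt0Pl => e e0; rewrite addr0.
set I := \int[mu]_(x in `[0, T]) G x.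
have I1 : 0 < `|I| + 1 by rewrite ltr_wpDl.
have [r r0 hr] := H (e / (`|I| + 1)) (divr_gt0 e0 I1).
(* The mesh T / n of the uniform partition is smaller than r. *)
pose n := (Num.truncn (T / r)).+1.
have n0 : (0 : R) < n%:R by rewrite ltr0n.
have Tn : T / n%:R < r.
  rewrite ltr_pdivrMr// mulrC -ltr_pdivrMr//.
  by have /andP[] := truncn_itv (divr_ge0 T0 (ltW r0)).
pose t k := k%:R * (T / n%:R).
have t0 k : 0 <= t k by rewrite mulr_ge0// divr_ge0// ltW.
have tT k : (k <= n)%N -> t k <= T.
  move=> kn; rewrite /t mulrA ler_pdivrMr// mulrC ler_wpM2l// ler_nat//.
have tS k : t k.+1 - t k = T / n%:R by rewrite /t -natr1; ring.
have tle k : t k <= t k.+1 by rewrite -subr_ge0 tS divr_ge0// ltW.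
have sub (g : R -> R) b : mu.-integrable `[0, T] (EFin \o g) -> b <= T ->
    mu.-integrable `[0, b] (EFin \o g).
  by move=> ig bT; apply: integrableS ig => //; apply: subset_itvl; rewrite bnd_simp.
have step k : (k <= n)%N ->
  `|Y (t k) - Y 0 - \int[mu]_(x in `[0, t k]) w x| <=
     e / (`|I| + 1) * \int[mu]_(x in `[0, t k]) G x.
  elim: k => [_|k IH kn].
    by rewrite /t mul0r set_itv1 !Rintegral_set1 mulr0 !subrr normr0.
  have tk := tT _ kn.
  rewrite (integral_split (sub _ _ iw tk) (t0 k) (tle k)).
  rewrite (integral_split (sub _ _ iG tk) (t0 k) (tle k)) mulrDr.
  have h1 := IH (ltnW kn).
  have h2 := hr (t k) (t k.+1) (t0 k) (tle k) tk; rewrite tS in h2.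
  have := lerD h1 (h2 Tn); apply: le_trans.
  apply: le_trans (ler_normD _ _); rewrite le_eqVlt; apply/orP; left; apply/eqP.
  by congr (`|_|); ring.
have tn : t n = T by rewrite /t mulrC divfK// gt_eqF.
have := step n (leqnn n); rewrite tn -/I => /le_trans; apply.
rewrite -mulrA ler_piMr ?(ltW e0)// mulrC ler_pdivrMr// mul1r.
by rewrite (le_trans (ler_norm I))// lerDl.
Qed.

Variable d : nat.
Local Notation vec := 'cV[R]_d.

Lemma derive_dotv (phi : vec -> R) x v : differentiable phi x ->
  'D_v phi x = dotv (grad phi x) v.
Proof.
move=> dphi; rewrite deriveE// [in LHS](col_sum_ei v) linear_sum /dotv.
by apply: eq_bigr => i _; rewrite linearZ/= !mxE deriveE// mulrC.
Qed.

Lemma mean_value (phi : vec -> R) x y : (forall z, differentiable phi z) ->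
  exists2 c, 0 <= c <= 1 & phi y - phi x = dotv (grad phi (x + c *: (y - x))) (y - x).
Proof.
move=> dphi.
pose psi (s : R) := phi (x + s *: (y - x)).
have dpsi s : is_derive s (1 : R) psi (dotv (grad phi (x + s *: (y - x))) (y - x)).
  have dp : derivable phi (x + s *: (y - x)) (y - x) by exact: diff_derivable.
  have E : (fun h : R => h^-1 *: (psi (h *: 1 + s) - psi s)) =
      fun h : R => h^-1 *: (phi (h *: (y - x) + (x + s *: (y - x))) - phi (x + s *: (y - x))).
    apply/funext => h; rewrite /psi; congr (_ *: (phi _ - _)).
    by rewrite scalerDl addrCA /GRing.scale/= mulr1.
  apply: DeriveDef.
    by rewrite /derivable /= E; exact: dp.
  by rewrite /derive /= E -derive_dotv.
have cpsi : continuous psi.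
  by move=> s; apply: differentiable_continuous; apply/derivable1_diffP; have [] := dpsi s.
have [c] := MVT_segment ler01 (fun s _ => dpsi s) (continuous_subspaceT cpsi).
rewrite in_itv/= => c01; rewrite /psi scale1r scale0r addr0 subr0 mulr1 [x + (y - x)]addrC subrK => E.
by exists c.
Qed.

Lemma grad_periodic (phi : vec -> R) : Zperiodic phi -> Zperiodic (grad phi).
Proof.
move=> pp z i; apply/colP => j; rewrite !mxE /derive pp.
have -> // : phi \o shift (z + delta_mx i ord0) = phi \o shift z.
by apply/funext => h; rewrite /= addrA pp.
Qed.

End ChainRule.

Section Trajectories.
Variables (R : realType).
Notation mu := (@lebesgue_measure R).

Lemma half_bound (p c k e : R) : 0 <= p -> p * (2 * (c * k + 1)) < e -> k * p * c <= e / 2.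
Proof. by move=> *; lra. Qed.

Lemma within_clamp (g : R -> R) (a b : R) : a <= b -> {within `[a, b], continuous g} ->
  continuous (fun s => g (Num.min (Num.max s a) b)).
Proof.
move=> ab /subspace_continuousP cg s; pose c := Num.min (Num.max s a) b.
have cab t : Num.min (Num.max t a) b \in `[a, b].
  by rewrite in_itv/= le_min le_max lexx orbT ab ge_min lexx orbT.
apply/cvgrPdist_lt => e e0; rewrite -/c.
have /cvgrPdist_lt/(_ _ e0) := cg c (cab s).
rewrite near_withinE => h.
have cc : (fun t : R => Num.min (Num.max t a) b) @ s --> c.
  apply: (@continuous_min _ _ (fun t : R => Num.max t a) (fun=> b)); last exact: cvg_cst.
  by apply: continuous_max; [exact: cvg_id|exact: cvg_cst].
have hh := cc _ h; near=> t; have : `[a, b]%classic (Num.min (Num.max t a) b) by exact: cab.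
by near: t; exact: hh.
Unshelve. all: by end_near. Qed.

Lemma integrable_addR (D : set R) (g h : R -> R) : measurable D ->
  mu.-integrable D (EFin \o g) -> mu.-integrable D (EFin \o h) ->
  mu.-integrable D (EFin \o (fun s => g s + h s)).
Proof.
move=> mD ig ih; apply: (@eq_integrable _ _ _ mu D mD ((EFin \o g) \+ (EFin \o h))%E).
  by move=> s _.
exact: integrableD.
Qed.

Lemma integrable_subR (D : set R) (g h : R -> R) : measurable D ->
  mu.-integrable D (EFin \o g) -> mu.-integrable D (EFin \o h) ->
  mu.-integrable D (EFin \o (fun s => g s - h s)).
Proof.
move=> mD ig ih; apply: (@eq_integrable _ _ _ mu D mD ((EFin \o g) \- (EFin \o h))%E).
  by move=> s _.
exact: integrableB.
Qed.

Lemma Rintegral_sum_fun (I : Type) (r : seq I) (h : I -> R -> R) (D : set R) : measurable D ->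
  (forall i, mu.-integrable D (EFin \o h i)) ->
  mu.-integrable D (EFin \o (fun x => \sum_(i <- r) h i x)) /\
  \int[mu]_(x in D) (\sum_(i <- r) h i x) = \sum_(i <- r) \int[mu]_(x in D) h i x.
Proof.
move=> mD ih; elim: r => [|i r [IH1 IH2]].
  have -> : (fun x : R => \sum_(i <- [::]) h i x) = fun=> 0 by apply/funext => x; rewrite big_nil.
  by rewrite big_nil; split; [exact: integrable0|rewrite Rintegral_cst// mul0r].
have -> : (fun x : R => \sum_(j <- i :: r) h j x) = fun x => h i x + \sum_(j <- r) h j x.
  by apply/funext => x; rewrite big_cons.
by rewrite big_cons RintegralD// IH2; split => //; exact: integrable_addR.
Qed.

Lemma contM_integrable (h w : R -> R) a b : continuous h ->
  mu.-integrable `[a, b] (EFin \o w) -> mu.-integrable `[a, b] (EFin \o (fun s => h s * w s)).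
Proof.
move=> ch iw.
have mh : measurable_fun `[a, b] h.
  by apply: measurable_funTS; exact: measurable_realfun.continuous_measurable_fun.
have mI : measurable (`[a, b]%classic : set R) by exact: measurable_itv.
have bh : [bounded h s | s in `[a, b]%classic].
  have := continuous_compact (continuous_subspaceT (A := `[a, b]) ch) (@segment_compact R a b).
  move=> /compact_bounded [c [cr hc]]; exists c; split => // M cM x xab.
  by apply: hc => //; exists x.
apply: (@eq_integrable _ _ _ mu _ mI ((EFin \o h) \* (EFin \o w))%E); first by move=> s _.
move: (@integrableMr _ _ _ mu _ mI h (EFin \o w) mh bh iw). exact.
Qed.

Variables (d m : nat).
Variables (rho : R) (a : 'cV[R]_d -> 'cV[R]_d) (B : 'cV[R]_d -> 'M[R]_(d, m)).
Hypothesis rho0 : 0 < rho.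
Local Notation vec := 'cV[R]_d.
Local Notation disc := (disc rho).
Variables (x : vec) (u : R -> 'cV[R]_m) (y : R -> vec).
Hypothesis tr : trajectory a B x u y.

Let w i s : R := drift a B (y s) (u s) i ord0.

Let iw i t : 0 <= t -> mu.-integrable `[0, t] (EFin \o w i).
Proof. by move=> t0; have [] := tr t0 i. Qed.

Lemma traj0 : y 0 = x.
Proof.
apply/colP => i; have [_ ->] := tr (lexx 0) i.
by rewrite set_itv1 Rintegral_set1 addr0.
Qed.

Lemma traj_incr s t i : 0 <= s -> s <= t ->
  y t i ord0 - y s i ord0 = \int[mu]_(r in `[s, t]) w i r.
Proof.
move=> s0 st; have t0 := le_trans s0 st.
have [_ ->] := tr t0 i; have [_ ->] := tr s0 i.
by rewrite (integral_split (iw i t0) s0 st) -/(w i); ring.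
Qed.

(** A trajectory is an indefinite integral, and such integrals are continuous
    on each segment [0, T]. *)
Lemma traj_cont : continuous (fun s : R => y (Num.max s 0)).
Proof.
apply: cv_continuous => i s.
pose T := Num.max s 0 + 1.
have T0 : 0 <= T by rewrite addr_ge0// le_max lexx orbT.
have cI := within_clamp T0 (parameterized_integral_continuous T0 (iw i T0)).
have : continuous (fun t : R => y (Num.min (Num.max t 0) T) i ord0).
  rewrite (_ : (fun _ => _) = fun t : R => x i ord0 +
      \int[mu]_(r in `[0, (Num.min (Num.max t 0) T)]) w i r).
    by move=> t; apply: cvgD; [exact: cvg_cst|exact: cI].
  apply/funext => t; have t0 : 0 <= Num.min (Num.max t 0) T.
    by rewrite le_min le_max lexx orbT.
  by have [_ ->] := tr t0 i.
move=> /(_ s); rewrite /continuous_at => h.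
have E t : Num.max t 0 <= T -> y (Num.min (Num.max t 0) T) i ord0 = y (Num.max t 0) i ord0.
  by move=> tT; rewrite min_l.
rewrite /= E ?lerDl// in h.
have hs : \forall t \near s, t < s + 1 by apply: lt_nbhsl; rewrite ltrDl.
apply: cvg_trans h; apply: near_eq_cvg; near=> t; rewrite E// /T.
have : t < s + 1 by near: t; exact: hs.
rewrite ge_max; have := le_max s s 0; rewrite lexx /= => h1.
have := le_max 0 s 0; rewrite lexx orbT => h2 ?.
by apply/andP; split; lra.
Unshelve. all: by end_near. Qed.

(** The control, hence the velocity, is only measurable in time, so the chain
    rule holds almost everywhere at best.  It is proved in integrated form by
    increments_integral: on a short interval [s, t] the mean value theorem
    expresses the increment of phi by the gradient at one intermediate point,
    which differs little from the gradient along the interval, and the error is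
    controlled by the integral of G = 1 + sum_i |dy_i/dt|. *)
Lemma chain_rule (phi : vec -> R) T : C1_torus phi -> 0 <= T ->
  let om s := - (rho * disc s * calL rho a B phi (y s) (u s)) in
  mu.-integrable `[0, T] (EFin \o om) /\
  disc T * phi (y T) - phi x = \int[mu]_(s in `[0, T]) om s.
Proof.
move=> [pp dp cp] T0 om.
pose yy (s : R) := y (Num.max s 0).
have yyE s : 0 <= s -> yy s = y s by move=> s0; rewrite /yy max_l.
pose g := grad phi.
have gp : Zperiodic g := grad_periodic pp.
have cphi : continuous phi.
  by move=> z; apply: differentiable_continuous; exact: dp.
have cdisc : continuous disc := @continuous_disc R rho.
have cphiy : continuous (fun s => phi (yy s)).
  by move=> s; apply: continuous_comp; [exact: traj_cont|exact: cphi].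
have cgy i : continuous (fun s => g (yy s) i ord0).
  by apply: coord_cont => s; apply: continuous_comp; [exact: traj_cont|exact: cp].
pose h0 s := - (rho * disc s) * phi (yy s).
pose h i s := disc s * g (yy s) i ord0 * w i s.
have ch0 : continuous h0.
  by move=> s; apply: cvgM; [apply: cvgN; apply: cvgMr; exact: cdisc|exact: cphiy].
have ih i : mu.-integrable `[0, T] (EFin \o h i).
  apply: (contM_integrable (h := fun s => disc s * g (yy s) i ord0)); last exact: iw.
  by move=> s; apply: cvgM; [exact: cdisc|exact: cgy].
pose om' s := h0 s + \sum_(i < d) h i s.
have omE s : 0 <= s -> om s = om' s.
  move=> s0; rewrite /om /om' /h0 /calL yyE//.
  have -> : \sum_(i < d) h i s = disc s * dotv (grad phi (y s)) (drift a B (y s) (u s)).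
    by rewrite /dotv mulr_sumr; apply: eq_bigr => i _; rewrite /h yyE// mulrA.
  by field; rewrite gt_eqF.
have iom' : mu.-integrable `[0, T] (EFin \o om').
  apply: integrable_addR => //; first exact: cont_integrable.
  by have [] := Rintegral_sum_fun (index_enum _) _ ih.
have omI : {in `[0, T], om =1 om'}.
  by move=> s; rewrite in_itv/= => /andP[s0 _]; exact: omE.
have iom : mu.-integrable `[0, T] (EFin \o om).
  apply: eq_integrable iom' => // s; rewrite inE/= => sT.
  by rewrite omI.
split => //.
have -> : \int[mu]_(s in `[0, T]) om s = \int[mu]_(s in `[0, T]) om' s.
  by apply: eq_Rintegral => s; rewrite inE/= => sT; exact: omI.
pose Y s := disc s * phi (y s).
have -> : disc T * phi (y T) - phi x = Y T - Y 0 by rewrite /Y disc0 mul1r traj0.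
pose G s := 1 + \sum_(i < d) `|w i s|.
have [is_ _] := Rintegral_sum_fun (index_enum 'I_d) (measurable_itv `[0, T]) (fun i => integrable_norm (iw i T0)).
have iG : mu.-integrable `[0, T] (EFin \o G).
  apply: integrable_addR => //; exact: (cont_integrable _ _ (@cst_continuous _ _ _)).
apply: (increments_integral T0 iom' iG) => e e0.
have [C C0 gC] := periodic_bounded gp cp.
have e1 : 0 < e / rho by rewrite divr_gt0.
have e2 : 0 < e / 2 by rewrite divr_gt0.
have [r1 r10 hr1] := periodic_unif pp cphi e1.
have [r2 r20 hr2] := periodic_unif gp cp e2.
pose r3 := Num.min r1 r2 / 2.
have r30 : 0 < r3 by rewrite divr_gt0// lt_min r10.
have tc := traj_cont.
have hh s : `[0, T]%classic s -> yy @ within `[0, T]%classic (nbhs s) --> yy s.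
  by move=> _; apply: cvg_within_filter; exact: tc.
have [r4 r40 hr4] := heine (@segment_compact R 0 T) hh r30.
have r50 : 0 < e / (2 * (C * rho + 1)).
  by rewrite divr_gt0// mulr_gt0// ltr_wpDl// mulr_ge0// ltW.
exists (Num.min r4 (e / (2 * (C * rho + 1)))); first by rewrite lt_min r40.
move=> s t s0 st tT; rewrite lt_min => /andP[tsr4 tsr5].
have t0 := le_trans s0 st.
have [c /andP[c0 c1] mv] := mean_value (y s) (y t) dp.
(* Write the increment of Y as an integral over [s, t] with frozen gradient:
   the increment of disc with phi (y t), that of phi with the gradient at xi. *)
set xi := y s + c *: (y t - y s) in mv.
have yclose r r' : s <= r -> r <= t -> s <= r' -> r' <= t -> `|y r - y r'| < r3.
  move=> sr rt sr' r't; rewrite -!yyE ?(le_trans s0)//.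
  apply: hr4; rewrite /= ?in_itv/= ?(le_trans s0)// ?(le_trans _ tT)//.
  rewrite (le_lt_trans _ tsr4)// ler_norml; apply/andP; split; lra.
have sub (k : R -> R) : mu.-integrable `[0, T] (EFin \o k) -> mu.-integrable `[s, t] (EFin \o k).
  by move=> ik; apply: integrableS ik => //; apply: subset_itv; rewrite bnd_simp.
pose num r := - (rho * disc r) * phi (y t) + \sum_(i < d) (disc s * g xi i ord0) * w i r.
have iwi i : mu.-integrable `[s, t] (EFin \o (fun r => (disc s * g xi i ord0) * w i r)).
  apply: (contM_integrable (h := fun=> disc s * g xi i ord0)); first exact: cst_continuous.
  exact: sub (iw i T0).
have [isum Isum] := Rintegral_sum_fun (index_enum 'I_d) (measurable_itv `[s, t]) iwi.
have c1' : continuous (fun r => - (rho * disc r) * phi (y t)).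
  by move=> r; apply: cvgMl; apply: cvgN; apply: cvgMr; exact: cdisc.
have inum : mu.-integrable `[s, t] (EFin \o num).
  by apply: integrable_addR => //; exact: cont_integrable.
have numE : Y t - Y s = \int[mu]_(r in `[s, t]) num r.
  rewrite /num RintegralD//; last exact: cont_integrable.
  rewrite Isum.
  have -> : \int[mu]_(r in `[s, t]) (- (rho * disc r) * phi (y t)) = (disc t - disc s) * phi (y t).
    rewrite RintegralZr//; last first.
      by apply: cont_integrable => r; apply: cvgN; apply: cvgMr; exact: cdisc.
    congr (_ * _); have := integral_expRM (- rho) st; rewrite !mulNr -/(disc t) -/(disc s) => <-.
    by apply: eq_Rintegral => r _; rewrite /disc !mulNr.
  have -> : \sum_(i < d) \int[mu]_(r in `[s, t]) (disc s * g xi i ord0 * w i r) = disc s * (phi (y t) - phi (y s)).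
    rewrite mv /dotv mulr_sumr; apply: eq_bigr => i _.
    rewrite RintegralZl//; last exact: sub (iw i T0).
    by rewrite -traj_incr// !mxE mulrA.
  by rewrite /Y; ring.
rewrite numE -RintegralB//; last exact: sub.
rewrite -RintegralZl//; last exact: sub.
apply: normr_integral_le.
- by apply: integrable_subR => //; exact: sub.
- apply: (contM_integrable (h := fun=> e)); first exact: cst_continuous.
  exact: sub.
move=> r sr rt.
have r0 := le_trans s0 sr.
have dr0 := ltW (disc_gt0 rho r); have dr1 := disc_le1 rho0 r0.
have ds0 := ltW (disc_gt0 rho s); have ds1 := disc_le1 rho0 s0.
have -> : num r - om' r = - (rho * disc r) * (phi (y t) - phi (y r))
   + \sum_(i < d) (disc s * g xi i ord0 - disc r * g (y r) i ord0) * w i r.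
  rewrite /num /om' /h0 /h yyE// mulrBr opprD addrACA; congr (_ + _).
  by rewrite -sumrB; apply: eq_bigr => i _; rewrite mulrBl.
rewrite /G [leRHS]mulrDr mulr1 (le_trans (ler_normD _ _))// lerD//.
  rewrite normrM normrN (ger0_norm (mulr_ge0 (ltW rho0) dr0)).
  have : `|phi (y t) - phi (y r)| < e / rho.
    apply: hr1; rewrite (lt_le_trans (yclose _ _ _ _ _ _))// /r3.
    by rewrite ler_pdivrMr// (@le_trans _ _ r1)// ?ge_min ?lexx//; lra.
  move/ltW => h1; rewrite (@le_trans _ _ (rho * `|phi (y t) - phi (y r)|))//.
    by rewrite ler_wpM2r// ler_piMr// ltW.
  by rewrite -ler_pdivlMl// mulrC.
rewrite mulr_sumr (le_trans (ler_norm_sum _ _ _))// ler_sum// => i _.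
rewrite normrM ler_wpM2r//.
have -> : disc s * g xi i ord0 - disc r * g (y r) i ord0 =
   disc s * (g xi - g (y r)) i ord0 + (disc s - disc r) * g (y r) i ord0 by rewrite !mxE; ring.
rewrite (le_trans (ler_normD _ _))//.
have h1 : `|disc s * (g xi - g (y r)) i ord0| <= e / 2.
  rewrite normrM (ger0_norm ds0) (le_trans (ler_piMl _ ds1))//.
  rewrite (le_trans (mxnorm_coord _ _ _))// ltW// hr2//.
  have -> : xi - y r = (y s - y r) + c *: (y t - y s) by rewrite /xi addrAC.
  rewrite (le_lt_trans (ler_normD _ _))// normrZ (ger0_norm c0).
  have h2 : c * `|y t - y s| <= r3.
    rewrite (le_trans (ler_piMl _ c1))// ltW// yclose//.
  have h3 : `|y s - y r| < r3 by rewrite yclose.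
  have h4 : r3 + r3 <= r2 by rewrite /r3 -splitr ge_min lexx orbT.
  by apply: lt_le_trans h4; exact: ltr_leD.
have h2 : `|(disc s - disc r) * g (y r) i ord0| <= e / 2.
  have rs : 0 <= r - s by rewrite subr_ge0.
  have E : disc s - disc r = disc s * (1 - disc (r - s)).
    by rewrite mulrBr mulr1 -discD [s + (r - s)]addrC subrK.
  have [_ h3] := disc_bounds rho0 rs.
  have h4 := disc_le1 rho0 rs.
  rewrite normrM E normrM (ger0_norm ds0) [X in _ * X * _]ger0_norm ?subr_ge0//.
  have h5 : disc s * (1 - disc (r - s)) <= rho * (t - s).
    rewrite (le_trans (ler_piMl _ ds1)) ?subr_ge0// (le_trans h3)//.
    by rewrite ler_wpM2l ?(ltW rho0)// lerD2r.
  have h6 : `|g (y r) i ord0| <= C by rewrite (le_trans (mxnorm_coord _ _ _)).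
  rewrite (le_trans (ler_pM _ _ h5 h6)) ?mulr_ge0 ?subr_ge0//.
  have D0 : 0 < 2 * (C * rho + 1) by rewrite mulr_gt0// ltr_wpDl// mulr_ge0// ltW.
  move: tsr5; rewrite ltr_pdivlMr// => h7.
  have ts0 : 0 <= t - s by rewrite subr_ge0.
  exact: half_bound ts0 h7.
by rewrite [leRHS]splitr lerD.
Qed.

End Trajectories.

(** * Subsolutions lie below the value function *)

Section Measurability.
Variable R : realType.

Lemma cont_measurable_Rvec n (g : 'cV[R]_n -> R) : continuous g ->
  measurable_fun setT (g : Rvec R n -> R).
Proof.
move=> cg; apply: (@measurability _ _ (Rvec R n) R setT _ _ (measurable_realfun.RGenOpens.measurableE R)).
move=> _ [_ [a [b ->]] <-]; rewrite setTI; apply: sub_sigma_algebra.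
by have /continuousP := cg; apply; exact: itv_open.
Qed.

(** Rational balls generate the open sets, and they are boxes for the sup
    norm. *)
Lemma measurable_into_Rvec dd (T : measurableType dd) n (D : set T) (g : T -> Rvec R n) : measurable D ->
  (forall i, measurable_fun D (fun t => (g t : 'cV[R]_n) i ord0)) -> measurable_fun D g.
Proof.
move=> mD mg; apply: (@measurability _ _ _ (Rvec R n) D g (@open 'cV[R]_n)) => // _ [U oU <-].
rewrite (open_rat_balls oU) preimage_bigcup setI_bigcupr bigcup_mkcond.
apply: countable_bigcupT_measurable => [|[p k]]; first exact: countableP.
case: ifPn => // _ /=.
have k0 : (0 : R) < k.+1%:R^-1 by rewrite invr_gt0 ltr0n.
rewrite [X in measurable X](_ : _ = \bigcap_(i : 'I_n)
   (D `&` (fun t => (g t : 'cV[R]_n) i ord0) @^-1` ball (ratr (p i ord0) : R) k.+1%:R^-1) `&` D); last first.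
  apply/seteqP; split => t /=.
    move=> [Dt [_ h]]; split => // i _; split => //=.
    by have := h i ord0; rewrite mxE.
  move=> [h Dt]; split => //; split => // i j.
  by have [_] := h i I; rewrite (ord1 j) !mxE.
apply: measurableI => //; apply: fin_bigcap_measurable => // i _.
by apply: mg => //; exact: measurable_realfun.measurable_ball.
Qed.

Lemma measurable_ctrl_cost n q : measurable_fun setT ((fun u => ctrl_cost q u) : Rvec R n -> R).
Proof.
rewrite /ctrl_cost; apply: measurable_funM => //.
apply: (measurableT_comp (measurable_powR q)).
have ms : measurable_fun setT (@Num.sqrt R : R -> R).
  by apply: continuous_measurable_fun; exact: sqrt_continuous.
apply: (measurableT_comp ms).
rewrite /dotv; apply: measurable_sum => i.
by apply: measurable_funM; exact: measurable_coord.
Qed.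

Lemma ctrl_cost_ge0 n q (u : 'cV[R]_n) : 0 <= q -> 0 <= ctrl_cost q u.
Proof. by move=> q0; rewrite divr_ge0 ?powR_ge0. Qed.

End Measurability.

Section Verification.
Variables (R : realType) (d m : nat) (rho q : R) (f : 'cV[R]_d -> R).
Variables (a : 'cV[R]_d -> 'cV[R]_d) (B : 'cV[R]_d -> 'M[R]_(d, m)).
Hypotheses (rho0 : 0 < rho) (q0 : 0 <= q) (f0 : forall x, 0 <= f x) (cf : continuous f).
Notation mu := (@lebesgue_measure R).
Local Notation vec := 'cV[R]_d.
Local Notation disc := (disc rho).

Let k (u : R -> 'cV[R]_m) (y : R -> vec) t := disc t * (f (y t) + ctrl_cost q (u t)).

Let k0 u y t : 0 <= k u y t.
Proof. by rewrite mulr_ge0 ?addr_ge0 ?ctrl_cost_ge0// ltW// disc_gt0. Qed.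

Lemma measurable_discounted_cost x (u : R -> 'cV[R]_m) y :
  measurable_fun (`[0, +oo[ : set R) (u : R -> Rvec R m) -> trajectory a B x u y ->
  measurable_fun (`[0, +oo[ : set R) (fun t => disc t * (f (y t) + ctrl_cost q (u t))).
Proof.
move=> mu_ tr; apply: measurable_funM.
  exact: measurable_funTS (@measurable_disc R rho).
apply: measurable_funD; last by apply: measurableT_comp mu_; exact: measurable_ctrl_cost.
apply: (@eq_measurable_fun _ _ _ _ _ (fun t : R => f (y (Num.max t 0)))); rewrite ?inE/=.
  by move=> t; rewrite inE/= in_itv/= andbT => t0; rewrite max_l.
apply: measurable_funTS; apply: measurable_realfun.continuous_measurable_fun => s.
apply: (@continuous_comp _ _ _ (fun t : R => y (Num.max t 0)) f); last exact: cf.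
by have := traj_cont tr; apply.
Qed.

(** By the chain rule on [0, T], U x is a discounted integral of calL U plus
    disc T * U (y T); the constraint bounds the integrand by the running cost,
    and the last term is smaller than e for T large since U is bounded. *)
Lemma dual_feasible_le_Vstar (U : vec -> R) x : dual_feasible rho q f a B U ->
  ((U x)%:E <= Vstar rho q f a B x)%E.
Proof.
move=> [UC Usub]; apply: le_ereal_inf_tmp => _ [u [y [mu_ tr ->]]].
have [Up dU _] := UC.
have cU : continuous U by move=> z; apply: differentiable_continuous; exact: dU.
have [C C0 hC] := periodic_bounded Up cU.
apply/lee_addgt0Pr => e e0.
have [T T0 hT] := disc_small rho0 C e0.
pose p s := rho * disc s * calL rho a B U (y s) (u s).
have mI : measurable (`[0, T]%classic : set R) by exact: measurable_itv.
have [ip pE] : mu.-integrable `[0, T] (EFin \o p) /\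
    U x = disc T * U (y T) + \int[mu]_(s in `[0, T]) p s.
  have [iom] := chain_rule rho0 tr UC T0.
  under eq_Rintegral do rewrite -mulN1r.
  have ip : mu.-integrable `[0, T] (EFin \o p).
    rewrite (_ : p = fun s => -1 * - p s); last by apply/funext => s; rewrite mulN1r opprK.
    by apply: (contM_integrable (h := fun=> -1)); [exact: cst_continuous|exact: iom].
  by rewrite RintegralZl// => E; split => //; rewrite -/p in E; lra.
have mk : measurable_fun (`[0, +oo[ : set R) (k u y) by exact: measurable_discounted_cost mu_ tr.
have UE : U x <= \int[mu]_(s in `[0, T]) p s + e.
  rewrite pE addrC lerD2l; apply: le_trans hT; rewrite ler_wpM2l// ?(ltW (disc_gt0 _ _))//.
  by rewrite (le_trans (ler_norm _)).
apply: (@le_trans _ _ ((\int[mu]_(s in `[0, T]) p s)%:E + e%:E)%E).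
  by rewrite -EFinD lee_fin.
apply: leeD => //.
rewrite /ocp_cost -ge0_integralZl_EFin//; last 3 first.
- by move=> t _; rewrite lee_fin; exact: k0.
- by apply/measurable_EFinP; exact: mk.
- exact: ltW.
have mrk : measurable_fun (`[0, +oo[%classic : set R) (fun s => (rho * k u y s)%:E).
  by apply/measurable_EFinP; apply: measurable_funM => //; exact: mk.
have rk0 s : (0 <= (rho * k u y s)%:E)%E by rewrite lee_fin mulr_ge0// ltW.
apply: (@le_trans _ _ (\int[mu]_(s in `[0%R, T]) (rho * k u y s)%:E)%E); last first.
  by apply: ge0_subset_integral => //; apply: subset_itvl; rewrite bnd_simp.
rewrite /Rintegral fineK; last exact: integrable_fin_num.
have [lty|] := ltP (\int[mu]_(s in `[0%R, T]) (rho * k u y s)%:E)%E +oo%E; last first.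
  by rewrite leye_eq => /eqP ->; rewrite leey.
have mrk' : measurable_fun (`[0, T]%classic : set R) (fun s => (rho * k u y s)%:E).
  by apply: measurable_funS mrk => //; apply: subset_itvl; rewrite bnd_simp.
apply: le_integral => //.
  apply/integrableP; split => //.
  by under eq_integral do rewrite gee0_abs//.
move=> s _; rewrite lee_fin /p /k mulrA ler_wpM2l//.
by rewrite mulr_ge0 ?ltW// disc_gt0.
Qed.

End Verification.

(** * Plans as admissible controls *)

Section PlanTrajectory.
Variables (R : realType) (d m : nat) (rho q : R) (f : 'cV[R]_d -> R).
Variables (a : 'cV[R]_d -> 'cV[R]_d) (B : 'cV[R]_d -> 'M[R]_(d, m)).
Variable P : regular rho q f a B.
Notation mu := (@lebesgue_measure R).
Local Notation vec := 'cV[R]_d.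
Local Notation ctl := 'cV[R]_m.
Local Notation L := (lipc P).
Local Notation phi := (flow P).
Local Notation plan := (plan R m).
Implicit Types (x z : vec) (u : ctl) (l : plan).

Lemma f_cont : continuous f.
Proof. exact: (@lip_continuous R vec R^o f L (reg_flip P)). Qed.

Lemma drift_cont u i : continuous (fun x => drift a B x u i ord0).
Proof. exact: coord_cont (lip_continuous (reg_blip P u)). Qed.

(** The drift is affine in the control; writing it through its values at
    finitely many fixed controls reduces joint measurability in (x, u) to
    continuity in x. *)
Lemma drift_expand x u i : drift a B x u i ord0 = drift a B x 0 i ord0 +
  \sum_(j < m) u j ord0 * (drift a B x (delta_mx j ord0) i ord0 - drift a B x 0 i ord0).
Proof.
rewrite /drift !mulmx0 addr0 {1}(col_sum_ei u) mulmx_sumr !mxE summxE; congr (_ + _).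
apply: eq_bigr => j _; rewrite -scalemxAr !mxE; congr (_ * _).
by ring.
Qed.

Lemma measurable_drift dd (T : measurableType dd) (D : set T) (X : T -> Rvec R d) (U : T -> Rvec R m) i :
  measurable D -> measurable_fun D X -> measurable_fun D U ->
  measurable_fun D (fun t => drift a B (X t) (U t) i ord0).
Proof.
move=> mD mX mU.
have md u : measurable_fun D (fun t => drift a B (X t) u i ord0).
  exact: measurableT_comp (cont_measurable_Rvec (@drift_cont u i)) mX.
apply: (@eq_measurable_fun _ _ _ _ _ (fun t => drift a B (X t) 0 i ord0 +
  \sum_(j < m) (U t : ctl) j ord0 * (drift a B (X t) (delta_mx j ord0) i ord0 - drift a B (X t) 0 i ord0))).
  by move=> t _; rewrite [RHS]drift_expand.
apply: measurable_funD => //; apply: measurable_sum => j; apply: measurable_funM.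
  exact: measurableT_comp (measurable_coord j) mU.
exact: measurable_funB.
Qed.

(** State at time t when the plan l is started from x at time t0. *)
Fixpoint plan_state l (t0 : R) x t : vec :=
  if l is (h, u) :: l' then
    if t < t0 + h%:num then phi u x (t - t0) else plan_state l' (t0 + h%:num) (phi u x h%:num) t
  else phi 0 x (t - t0).

Fixpoint plan_ctl l (t0 t : R) : ctl :=
  if l is (h, u) :: l' then if t < t0 + h%:num then u else plan_ctl l' (t0 + h%:num) t else 0.

Lemma plan_ctl_bound l t0 t : `|plan_ctl l t0 t| <= \sum_(hu <- l) `|hu.2|.
Proof.
elim: l t0 => [|[h u] l IH] t0 /=; first by rewrite big_nil normr0.
rewrite big_cons/=; case: ifPn => _; first by rewrite lerDl sumr_ge0.
by rewrite (le_trans (IH _))// lerDr.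
Qed.

Lemma measurable_plan_ctl l t0 : measurable_fun setT (plan_ctl l t0 : R -> Rvec R m).
Proof.
elim: l t0 => [|[h u] l IH] t0 /=; first exact: measurable_cst.
apply: measurable_fun_ifT; [|exact: measurable_cst|exact: IH].
by apply: measurable_fun_ltr; [exact: measurable_id|exact: measurable_cst].
Qed.

(** The flow is jointly continuous in (t, x); regarding (t, x) as a vector of
    R^(d+1) through vcons transfers this to the product sigma-algebra. *)
Lemma measurable_flow u t0 :
  measurable_fun setT (fun p : Rvec R d * measurableTypeR R => phi u p.1 (p.2 - t0) : Rvec R d).
Proof.
apply: measurable_into_Rvec => // i.
(* Coordinate 0 of z is the time and the other ones, tl z, the state. *)
pose tl (z : 'cV[R]_d.+1) : vec := \col_j z (lift ord0 j) ord0.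
pose g (z : 'cV[R]_d.+1) := phi u (tl z) (z ord0 ord0 - t0) i ord0.
have cg : continuous g.
  apply: coord_cont => z.
  set T := z ord0 ord0 - t0.
  apply: (@lip_continuous_at R _ _ _ (expR (growth P u * Num.max T 0) + vel P u)) => z'.
  set T' := z' ord0 ord0 - t0.
  have h1 : `|phi u (tl z) T - phi u (tl z') T| <= expR (growth P u * Num.max T 0) * `|z - z'|.
    have h : `|tl z - tl z'| <= `|z - z'|.
      apply: cvnorm_le => // j; have := mxnorm_coord (z - z') (lift ord0 j) ord0.
      by rewrite !mxE.
    have [T0|T0] := leP T 0.
      by rewrite !flow0// mulr0 expR0 mul1r.
    by rewrite (le_trans (flow_dist P u _ _ (ltW T0)))// ler_wpM2l// expR_ge0.
  have h2 : `|phi u (tl z') T - phi u (tl z') T'| <= vel P u * `|z - z'|.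
    rewrite (le_trans (flow_lip P u _ _ _))// ler_wpM2l ?vel_ge0//.
    have := mxnorm_coord (z - z') ord0 ord0; rewrite !mxE /T /T'.
    by rewrite opprB addrA subrK.
  by rewrite mulrDl (le_trans (ler_distD (phi u (tl z') T) _ _))// lerD.
have mc : measurable_fun setT (fun p : Rvec R d * measurableTypeR R => vcons (p.2, p.1)).
  apply: (measurableT_comp (@measurable_vcons R d)).
  exact: measurable_fun_pair.
have := measurableT_comp (cont_measurable_Rvec cg) mc.
apply: eq_measurable_fun => p _ /=; rewrite /g /vcons !mxE unlift_none/=.
by congr (phi u _ _ i ord0); apply/colP => j; rewrite !mxE liftK.
Qed.

Lemma measurable_flow_at u h : measurable_fun setT (fun x : Rvec R d => phi u x h : Rvec R d).
Proof.
have mp : measurable_fun setT (fun x : Rvec R d => (x, h) : Rvec R d * measurableTypeR R).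
  exact: measurable_fun_pair.
have := measurableT_comp (measurable_flow u 0) mp.
by apply: eq_measurable_fun => x _ /=; rewrite subr0.
Qed.

Lemma measurable_plan_state l t0 :
  measurable_fun setT (fun p : Rvec R d * measurableTypeR R => plan_state l t0 p.1 p.2 : Rvec R d).
Proof.
elim: l t0 => [|[h u] l IH] t0 /=; first exact: measurable_flow.
apply: measurable_fun_ifT; [|exact: measurable_flow|].
  by apply: measurable_fun_ltr; [exact: measurable_snd|exact: measurable_cst].
have mp : measurable_fun setT (fun p : Rvec R d * measurableTypeR R =>
    ((phi u p.1 h%:num : Rvec R d), p.2) : Rvec R d * measurableTypeR R).
  apply: measurable_fun_pair => //.
  exact: measurableT_comp (measurable_flow_at u h%:num) _.
exact: measurableT_comp (IH _) mp.
Qed.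

Lemma measurable_plan_state_at l t0 x : measurable_fun setT (plan_state l t0 x : R -> Rvec R d).
Proof.
have mp : measurable_fun setT (fun t => (x, t) : Rvec R d * measurableTypeR R).
  exact: measurable_fun_pair.
exact: measurableT_comp (measurable_plan_state l t0) mp.
Qed.

Lemma integrable_plan_drift l t0 x b c i : mu.-integrable `[b, c]
  (EFin \o (fun s => drift a B (plan_state l t0 x s) (plan_ctl l t0 s) i ord0)).
Proof.
apply: measurable_bounded_integrable; first exact: measurable_itv.
- by rewrite /= lebesgue_measure_itv /=; case: ifP; rewrite ?ltry// -EFinB ltry.
- apply: measurable_drift => //; apply: measurable_funTS.
    exact: measurable_plan_state_at.
  exact: measurable_plan_ctl.
pose N := speed P * (1 + \sum_(hu <- l) `|hu.2|).
exists N; split; first exact: num_real.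
move=> N' NN' s _ /=; apply: (le_trans _ (ltW NN')).
rewrite (le_trans (mxnorm_coord _ _ _))// (le_trans (reg_speed P _ _))//.
rewrite ler_wpM2l ?lerD2l ?plan_ctl_bound//.
by have := vel_ge0 P 0; rewrite /vel normr0 addr0 mulr1.
Qed.

Lemma flow_drift_cont u t0 x i : continuous (fun s => drift a B (phi u x (s - t0)) u i ord0).
Proof.
move=> s; apply: (@continuous_comp _ _ _ (fun s => phi u x (s - t0)) (fun z => drift a B z u i ord0)).
  apply: (@continuous_comp _ _ _ (fun s : R => s - t0) (phi u x)); last exact: flow_cont.
  by apply: cvgB; [exact: cvg_id|exact: cvg_cst].
exact: drift_cont.
Qed.

Lemma flow_integral u t0 x t i : t0 <= t ->
  phi u x (t - t0) i ord0 =
  x i ord0 + \int[mu]_(s in `[t0, t]) drift a B (phi u x (s - t0)) u i ord0.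
Proof.
move=> t0t; have [_ _ ->] := flowP P u x; last by rewrite subr_ge0.
rewrite !mxE; congr (_ + _).
have cg : continuous (fun s => drift a B (phi u x s) u i ord0).
  by have := @flow_drift_cont u 0 x i; under eq_fun do rewrite subr0.
have := integral_shift (- t0) cg t0t; rewrite subrr => <-.
by [].
Qed.

Lemma plan_state_solution l t0 x t i : t0 <= t ->
  plan_state l t0 x t i ord0 = x i ord0 +
    \int[mu]_(s in `[t0, t]) drift a B (plan_state l t0 x s) (plan_ctl l t0 s) i ord0.
Proof.
elim: l t0 x => [|[h u] l IH] t0 x t0t; first exact: flow_integral.
have t0h : t0 <= t0 + h%:num by rewrite lerDl.
have seg b : b <= t0 + h%:num ->
  \int[mu]_(s in `[t0, b]) drift a B (plan_state ((h, u) :: l) t0 x s) (plan_ctl ((h, u) :: l) t0 s) i ord0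
  = \int[mu]_(s in `[t0, b]) drift a B (phi u x (s - t0)) u i ord0.
  move=> bh.
  have sub (g : R -> R) : mu.-integrable `[t0, b] (EFin \o g) -> mu.-integrable `[t0, b[ (EFin \o g).
    by move=> ig; apply: integrableS ig => //; apply: subset_itvl; rewrite bnd_simp.
  rewrite -(Rintegral_itv_bndo_bndc (sub _ (integrable_plan_drift _ _ _ _ _ _))).
  rewrite -(Rintegral_itv_bndo_bndc (sub _ (cont_integrable _ _ (@flow_drift_cont u t0 x i)))).
  apply: eq_Rintegral => s; rewrite inE/= in_itv/= => /andP[_ sb].
  by rewrite (lt_le_trans sb bh).
rewrite [LHS]/=; case: ifPn => [th|].
  by rewrite seg ?ltW// -flow_integral.
rewrite -leNgt => ht; rewrite IH// (integral_split (integrable_plan_drift _ _ _ _ _ _) t0h ht).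
rewrite seg// addrA -flow_integral// addrAC subrr add0r; congr (_ + _).
apply: eq_Rintegral => s; rewrite inE/= in_itv/= => /andP[hs _].
by rewrite ltNge hs.
Qed.

Lemma plan_trajectory l x : trajectory a B x (plan_ctl l 0) (plan_state l 0 x).
Proof.
by move=> t t0 i; split; [exact: integrable_plan_drift|exact: plan_state_solution].
Qed.

End PlanTrajectory.

Section PlanUpperBound.
Variables (R : realType) (d m : nat) (rho q : R) (f : 'cV[R]_d -> R).
Variables (a : 'cV[R]_d -> 'cV[R]_d) (B : 'cV[R]_d -> 'M[R]_(d, m)).
Variable P : regular rho q f a B.
Notation mu := (@lebesgue_measure R).
Local Notation vec := 'cV[R]_d.
Local Notation ctl := 'cV[R]_m.
Local Notation phi := (flow P).
Local Notation cost u := (ctrl_cost q u).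
Local Notation disc := (disc rho).
Local Notation plan := (plan R m).
Implicit Types (x : vec) (u : ctl) (l : plan).

Let rho0 := reg_rho P.

Definition discounted_cost l t0 x t := rho * disc t * (f (plan_state P l t0 x t) + cost (plan_ctl l t0 t)).

Lemma discounted_cost_ge0 l t0 x t : 0 <= discounted_cost l t0 x t.
Proof.
by rewrite !mulr_ge0 ?addr_ge0 ?(reg_f0 P) ?(cost_ge0 P) ?(ltW rho0) ?(ltW (disc_gt0 _ _)).
Qed.

Lemma measurable_plan_cost_rate l t0 x : measurable_fun setT (discounted_cost l t0 x).
Proof.
apply: measurable_funM.
  apply: measurable_funM => //; exact: measurable_disc.
have mf : measurable_fun setT (f : Rvec R d -> R).
  by apply: cont_measurable_Rvec; exact: (f_cont P).
apply: measurable_funD; first exact: (measurableT_comp mf (measurable_plan_state_at P l t0 x)).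
exact: (measurableT_comp (@measurable_ctrl_cost R m q) (@measurable_plan_ctl R m l t0)).
Qed.

(** Stage by stage: the running cost of a stage is at most stage_cost, and
    after the last stage it is at most M. *)
Lemma plan_discounted_cost_le l t0 x : 0 <= t0 ->
  (\int[mu]_(t in `[t0, +oo[) (discounted_cost l t0 x t)%:E <= (disc t0 * plan_cost P l x)%:E)%E.
Proof.
elim: l t0 x => [|[h u] l IH] t0 x t00.
  rewrite [plan_cost _ _ _]/= mulrC -(disc_tail rho0)//; last exact: fmax_ge0.
  apply: ge0_le_integral => //.
  - by move=> t _; rewrite lee_fin discounted_cost_ge0.
  - by apply/measurable_EFinP/measurable_funTS; exact: measurable_plan_cost_rate.
  - apply/measurable_EFinP/measurable_funTS; apply: measurable_realfun.continuous_measurable_fun.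
    exact: cont_disc.
  move=> t _; rewrite lee_fin /discounted_cost /= ler_wpM2l ?mulr_ge0 ?(ltW rho0) ?(ltW (disc_gt0 _ _))//.
  rewrite /ctrl_cost (_ : enorm 0 = 0); last first.
    rewrite /enorm /dotv big1 ?sqrtr0// => j _.
    by rewrite mxE mul0r.
  by rewrite powR0 ?mul0r ?addr0 ?(reg_fmax P)// gt_eqF// (lt_trans _ (reg_q1 P)).
set t1 := t0 + h%:num.
have t01 : t0 <= t1 by rewrite lerDl.
have mrun D : measurable D -> measurable_fun D (fun t => (discounted_cost ((h, u) :: l) t0 x t)%:E).
  by move=> mD; apply/measurable_EFinP/measurable_funTS; exact: measurable_plan_cost_rate.
rewrite (@itv_bndbnd_setU _ _ (BLeft t0) (BLeft t1))//.
rewrite ge0_integral_setU//; last 3 first.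
- by apply: mrun; exact: measurableU.
- by move=> t _; rewrite lee_fin discounted_cost_ge0.
- apply/disj_setPS => t [/=]; rewrite !in_itv/= andbT => /andP[_ tt1].
  by rewrite leNgt tt1.
have -> : plan_cost P ((h, u) :: l) x = (1 - disc h%:num) * stage_cost P x u h%:num
      + disc h%:num * plan_cost P l (phi u x h%:num) by [].
have -> : disc t0 * ((1 - disc h%:num) * stage_cost P x u h%:num + disc h%:num * plan_cost P l (phi u x h%:num))
  = (stage_cost P x u h%:num * disc t0 - stage_cost P x u h%:num * disc t1)
    + disc t1 * plan_cost P l (phi u x h%:num) by rewrite /t1 discD; ring.
rewrite EFinD; apply: leeD.
  set S := stage_cost P x u h%:num.
  have S0 : 0 <= S by exact: stage_cost_ge0.
  have mS : measurable_fun setT (fun s => rho * disc s * S).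
    by apply: measurable_realfun.continuous_measurable_fun; exact: cont_disc.
  apply: (@le_trans _ _ (\int[mu]_(t in `[t0, t1[) (rho * disc t * S)%:E)%E).
    apply: ge0_le_integral => //.
    + by move=> t _; rewrite lee_fin discounted_cost_ge0.
    + by apply: mrun.
    + exact/measurable_EFinP/measurable_funTS.
    move=> t /=; rewrite in_itv/= => /andP[t0t tt1]; rewrite lee_fin /discounted_cost /= -/t1 tt1.
    rewrite ler_wpM2l ?mulr_ge0 ?(ltW rho0) ?(ltW (disc_gt0 _ _))//.
    rewrite /S /stage_cost lerD2r.
    have s0 : 0 <= t - t0 by rewrite subr_ge0.
    have h1 := flow_lip P u x 0 (t - t0).
    rewrite (flow0 P u x (lexx 0)) subr0 (ger0_norm s0) in h1.
    have h2 : `|phi u x (t - t0) - x| <= h%:num * vel P u.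
      rewrite (le_trans h1)// mulrC ler_wpM2r ?vel_ge0//.
      by move: tt1; rewrite /t1; lra.
    have := le_trans (reg_flip P (phi u x (t - t0)) x) (ler_wpM2l (ltW (lipc_gt0 P)) h2).
    by rewrite ler_norml mulrA; lra.
  rewrite le_eqVlt; apply/orP; left; apply/eqP.
  rewrite -(disc_segment rho S t01) /Rintegral fineK; last first.
    by apply: integrable_fin_num => //; apply: cont_integrable; exact: cont_disc.
  rewrite integral_itv_bndo_bndc//; exact/measurable_EFinP/measurable_funTS.
apply: le_trans (IH t1 (phi u x h%:num) _); last by rewrite addr_ge0.
rewrite le_eqVlt; apply/orP; left; apply/eqP; apply: eq_integral => t.
rewrite inE/= in_itv/= andbT => t1t.
by rewrite /discounted_cost /= -/t1 ltNge t1t.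
Qed.

Lemma Vstar_le_plan l x : (Vstar rho q f a B x <= (plan_cost P l x)%:E)%E.
Proof.
apply: (@le_trans _ _ (ocp_cost rho q f (plan_ctl l 0) (plan_state P l 0 x))).
  apply: ereal_inf_lbound; exists (plan_ctl l 0), (plan_state P l 0 x); split => //.
    by apply: measurable_funTS; exact: measurable_plan_ctl.
  exact: plan_trajectory.
have := plan_discounted_cost_le l x (lexx 0); rewrite disc0 mul1r; apply: le_trans.
rewrite /ocp_cost -ge0_integralZl_EFin//; last 3 first.
- by move=> t _; rewrite lee_fin mulr_ge0 ?expR_ge0// addr_ge0 ?(reg_f0 P) ?(cost_ge0 P).
- apply/measurable_EFinP; apply: (measurable_discounted_cost rho _ (f_cont P)); last exact: plan_trajectory.
  by apply: measurable_funTS; exact: measurable_plan_ctl.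
- exact: ltW.
rewrite le_eqVlt; apply/orP; left; apply/eqP; apply: eq_integral => t _.
by rewrite /discounted_cost /disc -mulrA.
Qed.

Lemma Vstar_le_plan_value x : (Vstar rho q f a B x <= (plan_value P x)%:E)%E.
Proof.
apply/lee_addgt0Pr => e e0.
have [_ [l _ <-] hl] := inf_adherent e0 (plan_cost_inf P x).
by apply: (le_trans (Vstar_le_plan l x)); rewrite -EFinD lee_fin ltW.
Qed.

End PlanUpperBound.

(** * Weighted images of measures *)

Import HBNNSimple.

Section WeightedImage.
Context d1 d2 (T : measurableType d1) (Y : measurableType d2) (R : realType).
Variables (mu : {measure set T -> \bar R}) (G : T -> Y) (k : T -> R).
Hypotheses (mG : measurable_fun setT G) (mk : measurable_fun setT k).
Hypothesis k0 : forall x, 0 <= k x.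
Local Open Scope ereal_scope.

(** The image under G of the measure with density k.  The measurability and
    positivity proofs are arguments so that the measure structure can be
    attached to the function. *)
Definition wimage of measurable_fun setT G & measurable_fun setT k & (forall x, (0 <= k x)%R) :=
  fun A : set Y => \int[mu]_(x in G @^-1` A) (k x)%:E.

Local Notation nu := (wimage mG mk k0).

Let mGA A : measurable A -> measurable (G @^-1` A).
Proof. by move=> mA; rewrite -[X in measurable X]setTI; exact: mG. Qed.

Let wimage0 : nu set0 = 0.
Proof. by rewrite /wimage preimage_set0 integral_set0. Qed.

Let wimage_ge0 A : 0 <= nu A.
Proof. by apply: integral_ge0 => x _; rewrite lee_fin. Qed.

Let wimage_sigma : semi_sigma_additive nu.
Proof.
move=> /= F mF tF mUF; rewrite /wimage; apply: cvg_toP.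
  apply: ereal_nondecreasing_is_cvgn => m n mn.
  apply: lee_sum_nneg_natr => // i _ _.
  by apply: integral_ge0 => x _; rewrite lee_fin.
rewrite preimage_bigcup ge0_integral_bigcup//=.
- by move=> i; exact: mGA.
- exact/measurable_EFinP/measurable_funTS.
- by move=> x _; rewrite lee_fin.
- move=> i j _ _ [x [Fi Fj]]; apply: tF => //; by exists (G x).
Qed.

HB.instance Definition _ := isMeasure.Build _ _ _ nu wimage0 wimage_ge0 wimage_sigma.

Let mfGk (f : Y -> R) : measurable_fun setT f -> measurable_fun setT (fun x => (f (G x) * k x)%:E).
Proof.
move=> mf; apply/measurable_EFinP; apply: measurable_funM => //.
exact: measurableT_comp mf mG.
Qed.

Let int_nnsfun (f : {nnsfun Y >-> R}) : \int[nu]_y (f y)%:E = \int[mu]_x (f (G x) * k x)%:E.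
Proof.
under [LHS]eq_integral do rewrite fimfunE -fsumEFin//.
rewrite [LHS]ge0_integral_fsum//; last 2 first.
- by move=> r; exact/measurable_EFinP/measurableT_comp.
- by move=> n x _; rewrite EFinM nnfun_muleindic_ge0.
under [RHS]eq_integral.
  move=> x _; rewrite fimfunE EFinM -fsumEFin// ge0_mule_fsuml; last first.
    by move=> r; rewrite EFinM nnfun_muleindic_ge0.
  over.
rewrite [RHS]ge0_integral_fsum//; last 2 first.
- move=> r; apply: emeasurable_funM; last exact/measurable_EFinP.
  apply/measurable_EFinP; apply: measurable_funM => //.
  by apply: measurableT_comp mG.
- move=> n x _; apply: mule_ge0; last by rewrite lee_fin.
  by rewrite EFinM nnfun_muleindic_ge0.
apply: eq_fsbigr => r; rewrite inE/= => -[y _ fyr].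
have r0 : (0 <= r)%R by rewrite -fyr.
have mr : measurable (f @^-1` [set r]) by exact: measurable_sfunP.
rewrite integralZl_indic_nnsfun//= integral_indic// setIT.
transitivity (r%:E * \int[mu]_(x in G @^-1` (f @^-1` [set r])) (k x)%:E); first by [].
transitivity (\int[mu]_x (r%:E * (\1_(G @^-1` (f @^-1` [set r])) x * k x)%:E)); last first.
  apply: eq_integral => x _; rewrite -!EFinM; apply: congr1; rewrite mulrA; congr (r * _ * _)%R.
rewrite ge0_integralZl_EFin//; last 2 first.
- by move=> x _; rewrite lee_fin mulr_ge0.
- apply/measurable_EFinP; apply: measurable_funM => //.
  by apply: measurable_indic; exact: mGA.
congr (_ * _); rewrite integral_mkcond; apply: eq_integral => x _.
rewrite patchE indicE; case: ifPn => _; first by rewrite mul1r.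
by rewrite mul0r.
Qed.

(** From simple functions by monotone convergence. *)
Lemma integral_wimage_ge0 (f : Y -> R) : measurable_fun setT f -> (forall y, (0 <= f y)%R) ->
  \int[nu]_y (f y)%:E = \int[mu]_x (f (G x) * k x)%:E.
Proof.
move=> mf f0.
have mEf : measurable_fun setT (EFin \o f) by exact/measurable_EFinP.
pose f_ := nnsfun_approx measurableT mEf.
have fcvg y : (f_ n y)%:E @[n --> \oo] --> (f y)%:E.
  by apply: (cvg_nnsfun_approx measurableT mEf) => // z _; rewrite lee_fin.
have fnd y : {homo (fun n => f_ n y) : n p / (n <= p)%N >-> (n <= p)%R}.
  by move=> n p np; exact/lefP/nd_nnsfun_approx.
transitivity (lim (\int[nu]_y (f_ n y)%:E @[n --> \oo])).
  rewrite -monotone_convergence//=.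
  - by apply: eq_integral => y _; apply/esym/cvg_lim => //; exact: fcvg.
  - by move=> n; exact/measurable_EFinP/measurable_funTS.
  - by move=> n ? _; rewrite lee_fin.
  - by move=> y _ n p np; rewrite lee_fin; exact: fnd.
transitivity (lim (\int[mu]_x (f_ n (G x) * k x)%:E @[n --> \oo])).
  by apply: congr_lim; apply/funext => n; exact: int_nnsfun.
rewrite -monotone_convergence//=.
- apply: eq_integral => x _; apply/cvg_lim => //.
  by rewrite EFinM; under eq_fun do rewrite EFinM; apply: cvgeZr => //; exact: fcvg.
- by move=> n; exact: mfGk.
- by move=> n x _; rewrite lee_fin mulr_ge0.
- by move=> x _ n p np; rewrite lee_fin ler_wpM2r//; exact: fnd.
Qed.

Lemma integral_wimage (f : Y -> R) : measurable_fun setT f ->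
  \int[nu]_y (f y)%:E = \int[mu]_x (f (G x) * k x)%:E.
Proof.
move=> mf; rewrite [LHS]integralE [RHS]integralE.
have mp : measurable_fun setT (f^\+)%R by exact: measurable_funrpos.
have mn : measurable_fun setT (f^\-)%R by exact: measurable_funrneg.
have := integral_wimage_ge0 mp (funrpos_ge0 _); have := integral_wimage_ge0 mn (funrneg_ge0 _).
move=> E2 E1; congr (_ - _).
  transitivity (\int[nu]_y ((f^\+)%R y)%:E).
    by apply: eq_integral => y _; rewrite funeposE /funrpos EFin_max.
  rewrite E1; apply: eq_integral => x _; rewrite funeposE /funrpos -EFin_max maxr_pMl// mul0r.
  by [].
transitivity (\int[nu]_y ((f^\-)%R y)%:E).
  by apply: eq_integral => y _; rewrite funenegE /funrneg EFin_max.
rewrite E2; apply: eq_integral => x _; rewrite funenegE /funrneg -EFin_max maxr_pMl// mul0r mulNr.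
by [].
Qed.

End WeightedImage.

Lemma weighted_image d1 d2 (T : measurableType d1) (Y : measurableType d2) (R : realType)
    (mu : {measure set T -> \bar R}) (G : T -> Y) (k : T -> R) :
  measurable_fun setT G -> measurable_fun setT k -> (forall x, 0 <= k x) ->
  (\int[mu]_x (k x)%:E < +oo)%E ->
  exists nu : {finite_measure set Y -> \bar R},
    (forall A, nu A = \int[mu]_(x in G @^-1` A) (k x)%:E)%E /\
    forall f : Y -> R, measurable_fun setT f ->
      (\int[nu]_y (f y)%:E = \int[mu]_x (f (G x) * k x)%:E)%E.
Proof.
move=> mG mk k0 kfin.
pose nu : {measure set Y -> \bar R} := wimage mu mG mk k0.
have nufin : fin_num_fun nu.
  apply: lty_fin_num_fun; rewrite /nu /= /wimage preimage_setT.
  exact: kfin.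
pose nuf : {finite_measure set Y -> \bar R} := HB.pack (Measure.sort nu)
  (Measure_isFinite.Build _ _ _ _ nufin).
exists nuf; split => // f mf; exact: (integral_wimage mu mG mk k0 mf).
Qed.

(** * Occupation measures of almost optimal plans *)

Section Occupation.
Variables (R : realType) (d m : nat) (rho q : R) (f : 'cV[R]_d -> R).
Variables (a : 'cV[R]_d -> 'cV[R]_d) (B : 'cV[R]_d -> 'M[R]_(d, m)).
Variable P : regular rho q f a B.
Notation mu := (@lebesgue_measure R).
Local Notation vec := 'cV[R]_d.
Local Notation ctl := 'cV[R]_m.
Local Notation M := (fmax P).
Local Notation disc := (disc rho).
Local Notation plan := (plan R m).
Implicit Types (x z : vec) (u : ctl) (l : plan) (phi : vec -> R).

Let rho0 := reg_rho P.

(** The drift grows linearly in the control and the gradient is bounded. *)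
Lemma calL_bound phi : C1_torus phi -> exists2 C, 0 <= C &
  forall x u, `|calL rho a B phi x u| <= C * (1 + `|u|).
Proof.
move=> [pp dp cp].
have cphi : continuous phi by move=> z; apply: differentiable_continuous; exact: dp.
have [C1 C10 h1] := periodic_bounded pp cphi.
have [C2 C20 h2] := periodic_bounded (grad_periodic pp) cp.
have s0 : 0 <= speed P by have := vel_ge0 P 0; rewrite /vel normr0 addr0 mulr1.
pose C3 := rho^-1 * (d%:R * C2 * speed P).
have C30 : 0 <= C3 by rewrite !mulr_ge0// invr_ge0 ltW.
exists (C1 + C3) => [|x u]; first exact: addr_ge0.
rewrite /calL (le_trans (ler_normB _ _))// mulrDl lerD//.
  rewrite (le_trans (h1 x))// -[leLHS]mulr1 ler_wpM2l//.
  by rewrite lerDl.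
have -> : C3 * (1 + `|u|) = rho^-1 * (d%:R * (C2 * (speed P * (1 + `|u|)))) by rewrite /C3; ring.
have ri : 0 <= rho^-1 by rewrite invr_ge0 ltW.
rewrite normrM (ger0_norm ri) ler_wpM2l//.
rewrite /dotv (le_trans (ler_norm_sum _ _ _))//.
rewrite (le_trans (ler_sum _ (_ : forall i, true -> _ <= C2 * (speed P * (1 + `|u|)))))//.
  move=> i _; rewrite normrM ler_pM//.
    exact: le_trans (mxnorm_coord _ _ _) (h2 x).
  exact: le_trans (mxnorm_coord _ _ _) (reg_speed P x u).
by rewrite sumr_const card_ord -[leLHS]mulr_natl.
Qed.

Lemma measurable_calL phi : C1_torus phi ->
  measurable_fun setT (fun z : Rvec R d * Rvec R m => calL rho a B phi z.1 z.2).
Proof.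
move=> [pp dp cp].
have cphi : continuous phi by move=> z; apply: differentiable_continuous; exact: dp.
apply: measurable_funB.
  exact: measurableT_comp (cont_measurable_Rvec cphi) measurable_fst.
apply: measurable_funM => //; apply: measurable_sum => i; apply: measurable_funM.
  have cg : continuous (fun x => grad phi x i ord0) by exact: coord_cont.
  exact: measurableT_comp (cont_measurable_Rvec cg) measurable_fst.
exact: (measurable_drift P).
Qed.

(** The discounted occupation measure of the trajectory of a plan satisfies the
    constraint of (P) with the initial law concentrated at x.  This is the chain
    rule on [0, T], with T -> +oo. *)
Lemma plan_occupation l x phi : C1_torus phi ->
  let p t := rho * disc t * calL rho a B phi (plan_state P l 0 x t) (plan_ctl l 0 t) in
  mu.-integrable `[0, +oo[ (EFin \o p) /\ \int[mu]_(t in `[0, +oo[) p t = phi x.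
Proof.
move=> phiC p.
have tr := plan_trajectory P l x.
have [C C0 hC] := calL_bound phiC.
pose N := \sum_(hu <- l) `|hu.2|.
have N0 : 0 <= N by exact: sumr_ge0.
pose K := C * (1 + N).
have K0 : 0 <= K by rewrite mulr_ge0// addr_ge0.
have pK t : `|p t| <= rho * disc t * K.
  rewrite /p normrM ger0_norm ?mulr_ge0 ?(ltW rho0) ?(ltW (disc_gt0 _ _))//.
  rewrite ler_wpM2l ?mulr_ge0 ?(ltW rho0) ?(ltW (disc_gt0 _ _))//.
  by rewrite (le_trans (hC _ _))// ler_wpM2l// lerD2l plan_ctl_bound.
have mp : measurable_fun setT p.
  apply: measurable_funM.
    by apply: measurable_funM => //; exact: measurable_disc.
  have mg : measurable_fun setT (fun t : measurableTypeR R =>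
      (plan_state P l 0 x t, plan_ctl l 0 t) : Rvec R d * Rvec R m).
    apply: measurable_fun_pair; first exact: measurable_plan_state_at.
    exact: measurable_plan_ctl.
  exact: (measurableT_comp (measurable_calL phiC) mg).
have mK : measurable_fun setT (fun t => rho * disc t * K).
  by apply: measurable_realfun.continuous_measurable_fun; exact: cont_disc.
have rK0 t : 0 <= rho * disc t * K.
  by apply: mulr_ge0 K0; rewrite mulr_ge0 ?(ltW rho0) ?(ltW (disc_gt0 _ _)).
have iK b : mu.-integrable `[b, +oo[ (EFin \o (fun t => rho * disc t * K)).
  apply/integrableP; split; first exact/measurable_EFinP/measurable_funTS.
  under eq_integral do rewrite /= ger0_norm//.
  by rewrite disc_tail// ltry.
have ip b : mu.-integrable `[b, +oo[ (EFin \o p).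
  apply: (le_integrable _ _ _ (iK b)) => //.
    exact/measurable_EFinP/measurable_funTS.
  by move=> t _; rewrite /= lee_fin (ger0_norm (rK0 t)).
split; first exact: ip.
apply/eqP; rewrite -subr_eq0 -normr_le0; apply/ler_addgt0Pl => e e0; rewrite addr0.
have phip : Zperiodic phi by case: phiC.
have cphi : continuous phi.
  by case: phiC => _ dp _ z; apply: differentiable_continuous; exact: dp.
have [C1 C10 h1] := periodic_bounded phip cphi.
have [T T0 hT] := disc_small rho0 (C1 + K) e0.
have [_ E] := chain_rule rho0 tr phiC T0.
have {}E : \int[mu]_(t in `[0, T]) p t = phi x - disc T * phi (plan_state P l 0 x T).
  have : \int[mu]_(s in `[0, T]) (-1 * p s) = - \int[mu]_(s in `[0, T]) p s.
    rewrite RintegralZl ?mulN1r//.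
    by apply: integrableS (ip 0) => //; apply: subset_itvl; rewrite bnd_simp.
  under eq_Rintegral do rewrite mulN1r.
  by rewrite /p -E; lra.
(* The remainder beyond T is bounded by the tail of the discount factor. *)
have ET : \int[mu]_(t in `[0, +oo[) p t - \int[mu]_(t in `[0, T]) p t = \int[mu]_(t in `[T, +oo[) p t.
  rewrite (Rintegral_itvB (ip 0))// ?bnd_simp//.
  rewrite Rintegral_itv_obnd_cbnd//.
  by apply: integrableS (ip T) => //; apply: subset_itvr; rewrite bnd_simp.
have tail : `|\int[mu]_(t in `[T, +oo[) p t| <= K * disc T.
  apply: (le_trans (le_normr_Rintegral _ (ip T))) => //.
  rewrite (_ : K * disc T = \int[mu]_(t in `[T, +oo[) (rho * disc t * K)); last first.
    by rewrite /Rintegral disc_tail.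
  apply: le_Rintegral => //; first exact: integrable_norm.
have -> : \int[mu]_(t in `[0, +oo[) p t - phi x =
    \int[mu]_(t in `[T, +oo[) p t - disc T * phi (plan_state P l 0 x T).
  by rewrite -ET E; ring.
rewrite (le_trans (ler_normB _ _))// (le_trans _ hT)// mulrDr addrC lerD//; last by rewrite mulrC.
by rewrite normrM (ger0_norm (ltW (disc_gt0 _ _))) ler_wpM2l// ltW// disc_gt0.
Qed.

End Occupation.

Lemma continuousD_fun (R : realType) (T : topologicalType) (g h : T -> R) :
  continuous g -> continuous h -> continuous (fun x => g x + h x).
Proof. by move=> cg ch x; apply: cvgD; [exact: cg|exact: ch]. Qed.

Lemma continuousM_fun (R : realType) (T : topologicalType) (g h : T -> R) :
  continuous g -> continuous h -> continuous (fun x => g x * h x).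
Proof. by move=> cg ch x; apply: cvgM; [exact: cg|exact: ch]. Qed.

Lemma uniformly_approximated_continuous (R : realType) (T : topologicalType) (g : T -> R) :
  (forall e, 0 < e -> exists U, continuous U /\ forall x, `|g x - U x| <= e) -> continuous g.
Proof.
move=> gU x; apply/cvgrPdist_lt => e e0.
have e4 : 0 < e / 4 by lra.
have [U [cU hU]] := gU _ e4.
have /cvgrPdist_lt/(_ _ e4) := cU x; apply: filterS => y.
have := hU x; have := hU y; rewrite !ler_norml !ltr_norml.
move=> /andP[h1 h2] /andP[h3 h4] /andP[h5 h6]; apply/andP; split; lra.
Qed.

Section Density.
Variables (R : realType) (d : nat) (mu0 : 'cV[R]_d -> R).
Hypothesis dens : full_support_bounded_density mu0.

Lemma integrable_mu0 : (torus_leb R d).-integrable setT (EFin \o mu0).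
Proof.
have [[_ mmu0 mu00 _ mu01] _] := dens.
apply/integrableP; split; first exact/measurable_EFinP.
by under eq_integral do rewrite /= ger0_norm//; rewrite mu01 ltry.
Qed.

Lemma integrable_density (U : 'cV[R]_d -> R) : continuous U -> Zperiodic U ->
  (torus_leb R d).-integrable setT (EFin \o (fun x : Rvec R d => U x * mu0 x)).
Proof.
move=> cU pU; have [[_ mmu0 mu00 _ mu01] _] := dens.
have [C C0 hC] := periodic_bounded pU cU.
have iC : (torus_leb R d).-integrable setT (fun x : Rvec R d => C%:E * (EFin \o mu0) x)%E.
  exact: integrableZl integrable_mu0.
apply: (le_integrable _ _ _ iC) => //.
  by apply/measurable_EFinP; apply: measurable_funM => //; exact: cont_measurable_Rvec.
move=> x _; rewrite /= lee_fin !normrM (ger0_norm C0).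
by rewrite ler_wpM2r.
Qed.

Lemma dual_obj_fin U : continuous U -> Zperiodic U -> dual_obj mu0 U \is a fin_num.
Proof. by move=> cU pU; apply: integrable_fin_num => //; exact: integrable_density. Qed.

Lemma dual_obj_addc U e : continuous U -> Zperiodic U ->
  dual_obj mu0 (fun x => U x + e) = (dual_obj mu0 U + e%:E)%E.
Proof.
move=> cU pU; have [[_ mmu0 mu00 _ mu01] _] := dens.
have ie := integrableZl measurableT e integrable_mu0.
rewrite /dual_obj; under eq_integral do rewrite mulrDl EFinD.
rewrite integralD//; last exact: integrable_density.
by congr (_ + _)%E; have := integralZl measurableT integrable_mu0 e; rewrite /= mu01 mule1 => <-.
Qed.

Lemma dual_obj_le U V : continuous U -> Zperiodic U -> continuous V -> Zperiodic V ->
  (forall x, U x <= V x) -> (dual_obj mu0 U <= dual_obj mu0 V)%E.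
Proof.
move=> cU pU cV pV UV; have [[_ _ mu00 _ _] _] := dens.
apply: le_integral => //; try exact: integrable_density.
by move=> x _; rewrite lee_fin ler_wpM2r.
Qed.

End Density.

Section NearOptimalMeasure.
Variables (R : realType) (d m : nat) (rho q : R) (f : 'cV[R]_d -> R).
Variables (a : 'cV[R]_d -> 'cV[R]_d) (B : 'cV[R]_d -> 'M[R]_(d, m)).
Variable P : regular rho q f a B.
Notation mu := (@lebesgue_measure R).
Local Notation vec := 'cV[R]_d.
Local Notation ctl := 'cV[R]_m.
Local Notation M := (fmax P).
Local Notation cost u := (ctrl_cost q u).
Local Notation disc := (disc rho).
Local Notation plan := (plan R m).
Implicit Types (x y z : vec) (u : ctl) (l : plan) (phi : vec -> R).

Let rho0 := reg_rho P.

Lemma plan_cost_cont l : continuous (plan_cost P l).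
Proof.
elim: l => [|[h u] l IH] /=; first exact: cst_continuous.
have cfl : continuous (fun x => flow P u x h%:num).
  apply: (@lip_continuous R _ _ _ (expR (growth P u * h%:num))) => x y.
  by apply: flow_dist.
have cs : continuous (fun x => stage_cost P x u h%:num).
  apply: (@lip_continuous R vec R^o _ (lipc P)) => x y.
  rewrite (_ : stage_cost P x u h%:num - _ = f x - f y); first exact: reg_flip.
  by rewrite /stage_cost; ring.
have cl : continuous (fun x => plan_cost P l (flow P u x h%:num)).
  by move=> x; apply: (@continuous_comp _ _ _ (fun x => flow P u x h%:num) (plan_cost P l)); [exact: cfl|exact: IH].
by apply: continuousD_fun; (apply: continuousM_fun; first exact: cst_continuous).
Qed.

Lemma subsolution_le_Vstar U x : dual_feasible rho q f a B U ->
  ((U x)%:E <= Vstar rho q f a B x)%E.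
Proof.
have q0 : 0 <= q by rewrite (le_trans ler01)// ltW// (reg_q1 P).
exact: (dual_feasible_le_Vstar rho0 q0 (reg_f0 P) (@f_cont _ _ _ _ _ _ _ _ P)).
Qed.

(** By near_optimal_subsolution together with the bounds U <= V* <= plan_value:
    the value is a uniform limit of smooth functions. *)
Lemma plan_value_cont : continuous (plan_value P).
Proof.
apply: uniformly_approximated_continuous => e e0.
have [U [UF VU]] := near_optimal_subsolution P e0.
exists U; split=> [|x]; first by case: UF => -[_ dU _] _ z; exact: differentiable_continuous.
have UV : U x <= plan_value P x.
  by rewrite -lee_fin (le_trans (subsolution_le_Vstar x UF))// Vstar_le_plan_value.
by rewrite ger0_norm ?subr_ge0// lerBlDl VU.
Qed.

Section Selection.
Variables (e : R) (e0 : 0 < e).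

Definition good_plan l x := plan_cost P l x < plan_value P x + e.

Fixpoint select_plan (ls : seq plan) x : plan :=
  if ls is l :: ls' then if good_plan l x then l else select_plan ls' x else [::].

Lemma select_plan_good ls x : has (good_plan ^~ x) ls -> good_plan (select_plan ls x) x.
Proof.
by elim: ls => //= l ls IH; case: ifP => [//|_] /=; exact: IH.
Qed.

Lemma good_plan_per l : Zperiodic (good_plan l).
Proof. by move=> x i; rewrite /good_plan plan_cost_per plan_value_per. Qed.

(** The points where a given plan is e-optimal form an open set; finitely many
    of these sets cover the unit ball, which contains a representative of every
    point of the torus. *)
Lemma finite_plans : exists ls, forall x, good_plan (select_plan ls x) x.
Proof.
have /choice[L HL] : forall x, exists l, good_plan l x.
  move=> x; apply/not_existsP => nl; have : plan_value P x < plan_value P x + e by rewrite ltrDl.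
  rewrite ltNge => /negP; apply; apply: plan_value_ge => l; rewrite leNgt; apply/negP; exact: nl.
have := @compact_cvball R d 1; rewrite compact_cover => cover.
have [|x _|D _ hD] := cover _ setT (fun z => [set x | good_plan (L z) x]).
- move=> z _; rewrite /good_plan.
  rewrite (_ : [set x | _] = (fun x => plan_value P x + e - plan_cost P (L z) x) @^-1` [set r | 0 < r]).
    apply: open_comp; last exact: open_gt.
    have cUp : continuous (fun x => plan_value P x + e - plan_cost P (L z) x).
      have -> : (fun x => plan_value P x + e - plan_cost P (L z) x) =
          fun x => plan_value P x + (e + (-1) * plan_cost P (L z) x).
        by apply/funext => x; ring.
      apply: continuousD_fun; first exact: plan_value_cont.
      apply: continuousD_fun; first exact: cst_continuous.
      by apply: continuousM_fun; [exact: cst_continuous|exact: plan_cost_cont].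
    by move=> x _; exact: cUp.
  by apply/seteqP; split => x /=; rewrite subr_gt0.
- by exists x => //; exact: HL.
exists [seq L z | z <- finmap.enum_fset D] => x; apply: select_plan_good.
have [|z zD gz] := hD (torus_rep x).
  by rewrite /= cube_norm//; exact: torus_rep_cube.
apply/hasP; exists (L z); first exact: map_f.
by have := gz; rewrite /= (Zperiodic_rep (good_plan_per (L z))).
Qed.

Lemma measurable_good_plan l : measurable_fun setT (good_plan l : Rvec R d -> bool).
Proof.
apply: measurable_fun_ltr; first exact: cont_measurable_Rvec (@plan_cost_cont l).
by apply: measurable_funD => //; exact: cont_measurable_Rvec plan_value_cont.
Qed.

Lemma measurable_select_state ls : measurable_fun setT
  (fun p : Rvec R d * measurableTypeR R => plan_state P (select_plan ls p.1) 0 p.1 p.2 : Rvec R d).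
Proof.
elim: ls => [|l ls IH]; first exact: (measurable_plan_state P [::] 0).
rewrite (_ : (fun p => _) = fun p : Rvec R d * measurableTypeR R =>
    if good_plan l p.1 then plan_state P l 0 p.1 p.2 else plan_state P (select_plan ls p.1) 0 p.1 p.2); last first.
  by apply/funext => p /=; case: ifP.
apply: measurable_fun_ifT; [|exact: measurable_plan_state|exact: IH].
exact: measurableT_comp (measurable_good_plan l) measurable_fst.
Qed.

Lemma measurable_select_ctl ls : measurable_fun setT
  (fun p : Rvec R d * measurableTypeR R => plan_ctl (select_plan ls p.1) 0 p.2 : Rvec R m).
Proof.
have mp l : measurable_fun setT (fun p : Rvec R d * measurableTypeR R => plan_ctl l 0 p.2 : Rvec R m).
  exact: measurableT_comp (@measurable_plan_ctl R m l 0) measurable_snd.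
elim: ls => [|l ls IH]; first exact: (mp [::]).
rewrite (_ : (fun p => _) = fun p : Rvec R d * measurableTypeR R =>
    if good_plan l p.1 then plan_ctl l 0 p.2 else plan_ctl (select_plan ls p.1) 0 p.2); last first.
  by apply/funext => p /=; case: ifP.
apply: measurable_fun_ifT; [|exact: mp|exact: IH].
exact: measurableT_comp (measurable_good_plan l) measurable_fst.
Qed.

Lemma select_plan_bound ls : exists2 N, 0 <= N & forall x t, `|plan_ctl (select_plan ls x) 0 t| <= N.
Proof.
elim: ls => [|l ls [N N0 hN]] /=; first by exists 0 => // x t; rewrite normr0.
exists (N + \sum_(hu <- l) `|hu.2|) => [|x t]; first by rewrite addr_ge0// sumr_ge0.
case: ifP => _; first by rewrite (le_trans (plan_ctl_bound _ _ _))// lerDr.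
by rewrite (le_trans (hN x t))// lerDl sumr_ge0.
Qed.

End Selection.

Lemma measurable_torus_rep : measurable_fun setT (@torus_rep R d : Rvec R d -> Rvec R d).
Proof.
apply: measurable_into_Rvec => // i.
apply: (@eq_measurable_fun _ _ _ _ _ (fun x : Rvec R d => (x : vec) i ord0 - (Num.floor ((x : vec) i ord0))%:~R)).
  by move=> x _; rewrite /torus_rep mxE.
apply: measurable_funB; first exact: measurable_coord.
have mfl : measurable_fun setT (fun t : R => (Num.floor t)%:~R : R).
  apply: nondecreasing_measurable => // s t st.
  by rewrite ler_int; exact: le_floor.
exact: (measurableT_comp mfl (measurable_coord i)).
Qed.

Lemma calL_rep phi x u : C1_torus phi -> calL rho a B phi (torus_rep x) u = calL rho a B phi x u.
Proof.
move=> [pp _ _]; rewrite /calL /drift (Zperiodic_rep pp) (Zperiodic_rep (grad_periodic pp)).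
by rewrite (Zperiodic_rep (reg_aper P)) (Zperiodic_rep (reg_Bper P)).
Qed.

Lemma measurable_running_cost :
  measurable_fun setT (fun z : Rvec R d * Rvec R m => f z.1 + cost z.2).
Proof.
apply: measurable_funD.
  exact: measurableT_comp (cont_measurable_Rvec (@f_cont _ _ _ _ _ _ _ _ P)) measurable_fst.
exact: measurableT_comp (@measurable_ctrl_cost R m q) measurable_snd.
Qed.

(** The measure integrates over the starting point x with density mu0 the
    occupation measures of the plans selected at x.  Finiteness of the list of
    plans bounds the controls, hence gives the compact support. *)
Lemma near_optimal_measure (mu0 : vec -> R) e :
  full_support_bounded_density mu0 -> 0 < e ->
  exists2 nu, primal_feasible rho a B mu0 nu &
    (primal_obj q f nu <= dual_obj mu0 (plan_value P) + e%:E)%E.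
Proof.
move=> dens e0; have [[mu0p mmu0 mu00 _ mu01] _] := dens.
have [ls Hls] := finite_plans e0.
have [N N0 hN] := select_plan_bound e ls.
pose S x := select_plan e ls x.
pose Y (p : Rvec R d * measurableTypeR R) := plan_state P (S p.1) 0 p.1 p.2.
pose c (p : Rvec R d * measurableTypeR R) := plan_ctl (S p.1) 0 p.2.
pose G (p : Rvec R d * measurableTypeR R) : Rvec R d * Rvec R m := (torus_rep (Y p), c p).
(* The product measure lives on the whole time line: negative times get
   density 0. *)
pose kt (t : R) := if 0 <= t then rho * disc t else 0.
pose k (p : Rvec R d * measurableTypeR R) := mu0 p.1 * kt p.2.
have kt0 t : 0 <= kt t by rewrite /kt; case: ifP => // _; rewrite mulr_ge0 ?(ltW rho0) ?(ltW (disc_gt0 _ _)).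
have k0 p : 0 <= k p by rewrite mulr_ge0.
have mkt : measurable_fun setT kt.
  apply: measurable_fun_ifT => //; first exact: measurable_fun_ler.
  by apply: measurable_funM => //; exact: measurable_disc.
have mk : measurable_fun setT k.
  apply: measurable_funM; first exact: measurableT_comp mmu0 measurable_fst.
  exact: measurableT_comp mkt measurable_snd.
have mY : measurable_fun setT (Y : _ -> Rvec R d) by exact: measurable_select_state.
have mc : measurable_fun setT (c : _ -> Rvec R m) by exact: measurable_select_ctl.
have mG : measurable_fun setT G.
  by apply: measurable_fun_pair mc; exact: (measurableT_comp measurable_torus_rep mY).
have inner (g : R -> R) w : (\int[mu]_t (g t * (w * kt t))%:E =
    \int[mu]_(t in `[0%R, +oo[) (w * (rho * disc t * g t))%:E)%E.
  rewrite [RHS]integral_mkcond; apply: eq_integral => t _; rewrite patchE /kt.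
  rewrite mem_setE in_itv/= andbT; case: ifP => _; congr (_%:E); ring.
have kint x : (\int[mu]_t (k (x, t))%:E = (mu0 x)%:E)%E.
  have := inner (fun=> 1) (mu0 x); under eq_integral do rewrite mul1r.
  move=> ->; under eq_integral do rewrite mulr1 mulrC.
  by rewrite (disc_tail rho0)// disc0 mulr1.
have kfin : (\int[(torus_leb R d \x mu)%E]_p (k p)%:E < +oo)%E.
  rewrite fubini_tonelli1//; last exact/measurable_EFinP.
  rewrite (eq_integral (fun x : Rvec R d => (mu0 x)%:E)); last by move=> x _; exact: kint.
  by rewrite mu01 ltry.
have [nu [nuA nuf]] := weighted_image mG mk k0 kfin.
exists nu.
  split.
    exists [set v | `|v| <= N]; split; first exact: compact_cvball.
    rewrite nuA (_ : G @^-1` _ = set0) ?integral_set0//.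
    apply/seteqP; split => // p /=; apply; split => /=; first exact: torus_rep_cube.
    exact: hN.
  move=> phi phiC.
  rewrite /int_calL nuf; last exact: (measurable_calL P phiC).
  have [C C0 hC] := calL_bound P phiC.
  pose h p := calL rho a B phi (G p).1 (G p).2.
  have mh : measurable_fun setT h := measurableT_comp (measurable_calL P phiC) mG.
  have ih : (torus_leb R d \x mu)%E.-integrable setT (fun p => (h p * k p)%:E).
    pose K := C * (1 + N).
    have K0 : 0 <= K by rewrite mulr_ge0// addr_ge0.
    apply: (@le_integrable _ _ _ _ setT _ _ (fun p => (K * k p)%:E)) => //.
    - by apply/measurable_EFinP; exact: measurable_funM.
    - move=> p _; rewrite /= lee_fin [leLHS]normrM [leRHS]normrM (ger0_norm (k0 p)) (ger0_norm K0).
      by rewrite ler_wpM2r// (le_trans (hC _ _))// ler_wpM2l// lerD2l hN.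
    apply/integrableP; split; first by apply/measurable_EFinP; exact: measurable_funM.
    under eq_integral do rewrite /= ger0_norm ?(mulr_ge0 K0)// EFinM.
    rewrite ge0_integralZl_EFin//; last 2 first.
    - by move=> p _; rewrite lee_fin.
    - exact/measurable_EFinP.
    by apply: lte_mul_pinfty.
  rewrite -[LHS](integral12_prod_meas1 ih) /dual_obj; apply: eq_integral => x _.
  transitivity (\int[mu]_(t in `[0%R, +oo[) (mu0 x * (rho * disc t * h (x, t)))%:E)%E.
    exact: (inner (fun t => h (x, t)) (mu0 x)).
  have [ip pE] := plan_occupation P (S x) x phiC.
  have hE t : h (x, t) = calL rho a B phi (plan_state P (S x) 0 x t) (plan_ctl (S x) 0 t).
    by rewrite /h /= calL_rep.
  under eq_integral do rewrite hE EFinM.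
  rewrite integralZl//.
  by rewrite -(fineK (integrable_fin_num _ ip))// -EFinM mulrC; congr ((_ * _)%:E).
have mobj := measurable_running_cost.
have obj0 (z : Rvec R d * Rvec R m) : 0 <= f z.1 + cost z.2 by rewrite addr_ge0 ?(reg_f0 P) ?(cost_ge0 P).
have mprod : measurable_fun setT (fun p => ((f (G p).1 + cost (G p).2) * k p)%:E).
  by apply/measurable_EFinP; apply: measurable_funM => //; exact: (measurableT_comp mobj mG).
rewrite /primal_obj nuf// fubini_tonelli1//; last first.
  by move=> p; rewrite lee_fin mulr_ge0.
have mUe : measurable_fun setT (fun x : Rvec R d => ((plan_value P x + e) * mu0 x)%:E).
  apply/measurable_EFinP; apply: measurable_funM => //; apply: measurable_funD => //.
  exact: cont_measurable_Rvec plan_value_cont.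
apply: (@le_trans _ _ (\int[torus_leb R d]_x ((plan_value P x + e) * mu0 x)%:E)%E).
  apply: ge0_le_integral => //.
  - by move=> x _; apply: integral_ge0 => t _; rewrite lee_fin mulr_ge0.
  - by apply: measurable_fun_fubini_tonelli_F => // p; rewrite lee_fin mulr_ge0.
  move=> x _.
  have := inner (fun t => f (torus_rep (Y (x, t))) + cost (c (x, t))) (mu0 x).
  rewrite /fubini_F /= => ->.
  have := plan_discounted_cost_le P (S x) x (lexx 0); rewrite disc0 mul1r => hrun.
  have rE t : rho * disc t * (f (torus_rep (Y (x, t))) + cost (c (x, t))) = discounted_cost P (S x) 0 x t.
    by rewrite /discounted_cost (Zperiodic_rep (reg_fper P)).
  under eq_integral do rewrite rE EFinM.
  rewrite ge0_integralZl_EFin//; last 2 first.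
  - by move=> t _; rewrite lee_fin discounted_cost_ge0.
  - by apply/measurable_EFinP/measurable_funTS; exact: measurable_plan_cost_rate.
  rewrite mulrC EFinM; apply: lee_wpmul2l; first by rewrite lee_fin.
  by apply: le_trans hrun _; rewrite lee_fin ltW//; exact: Hls.
by rewrite -/(dual_obj mu0 (fun x => plan_value P x + e)) (dual_obj_addc dens _ plan_value_cont (plan_value_per P)).
Qed.

End NearOptimalMeasure.

(** * Duality *)

Lemma ctrl_cost_bounded (R : realType) n (q N : R) : 0 < q ->
  exists C, forall u : 'cV[R]_n, `|u| <= N -> ctrl_cost q u <= C.
Proof.
move=> q0; exists (Num.sqrt (n%:R * N ^+ 2) `^ q / q) => u uN.
rewrite /ctrl_cost ler_pM2r ?invr_gt0// ge0_ler_powR ?(ltW q0)// ?nnegrE ?sqrtr_ge0//.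
rewrite ler_wsqrtr// /dotv (le_trans (ler_sum _ (_ : forall i, true -> _ <= N ^+ 2)))//.
  move=> i _; rewrite -expr2 -real_normK ?num_real// lerXn2r// ?nnegrE//.
    by rewrite (le_trans _ uN).
  by rewrite (le_trans (mxnorm_coord _ _ _)).
by rewrite sumr_const card_ord mulr_natl.
Qed.

Lemma measurable_carrier (R : realType) d m (K : set 'cV[R]_m) : compact K ->
  measurable (~` (@unit_cube R d `*` K) : set (Rvec R d * Rvec R m)).
Proof.
move=> cK; apply: measurableC.
have mK : measurable (K : set (Rvec R m)).
  rewrite -[X in measurable X]setCK; apply: measurableC; apply: sub_sigma_algebra.
  rewrite /= openC; apply: compact_closed cK; exact: norm_hausdorff.
apply: measurableX mK.
by apply: (@measurable_box R d (fun=> `[0, 1[%classic)) => i; exact: measurable_itv.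
Qed.

(** A finite measure carried by unit_cube x K integrates every measurable
    function that is bounded for bounded controls. *)
Lemma Mplus_integrable (R : realType) d m nu (g : Rvec R d * Rvec R m -> R) :
  Mplus nu -> measurable_fun setT g ->
  (forall N, exists C, forall x (u : 'cV[R]_m), `|u| <= N -> `|g (x, u)| <= C) ->
  nu.-integrable setT (EFin \o g).
Proof.
move=> [K [cK nuK]] mg gN.
have mS := @measurable_carrier R d m K cK.
have mgE : measurable_fun setT (EFin \o g) by exact/measurable_EFinP.
(* Discard the null complement of unit_cube x K, where g may be unbounded. *)
apply/(negligible_integrable mS measurableT mgE nuK).
have [N [_ hN]] := compact_bounded cK.
have [C hC] := gN (N + 1).
have mD : measurable ([set: Rvec R d * Rvec R m] `\` ~` (@unit_cube R d `*` K)) by exact: measurableD.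
apply: (le_integrable mD _ _ (finite_measure_integrable_cst nu C mD)).
  exact: measurable_funTS.
move=> [x u] [_ /contrapT[_ /= Ku]]; rewrite lee_fin.
by rewrite (le_trans _ (ler_norm C))// hC// hN// ltrDl.
Qed.

(** A weighted image of a Dirac mass; c = 0 gives the zero measure. *)
Lemma point_mass (R : realType) d m (x : 'cV[R]_d) (u : 'cV[R]_m) c : 0 <= c -> unit_cube x ->
  exists2 nu, @Mplus R d m nu &
    forall g : Rvec R d * Rvec R m -> R, measurable_fun setT g ->
      (\int[nu]_z (g z)%:E = (g (x, u) * c)%:E)%E.
Proof.
move=> c0 cx.
pose z : Rvec R d * Rvec R m := (x, u).
have mk : measurable_fun setT (cst c : Rvec R d * Rvec R m -> R) by exact: measurable_cst.
have ci (g : Rvec R d * Rvec R m -> R) : measurable_fun setT g ->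
    (\int[dirac z]_w (g w * c)%:E = (g z * c)%:E)%E.
  move=> mg; rewrite integral_dirac ?diracT ?mul1e//.
  by apply/measurable_EFinP; exact: measurable_funM.
have kfin : (\int[dirac z]_w (cst c w)%:E < +oo)%E.
  rewrite (_ : \int[_]_w _ = (1 * c)%:E)%E ?ltry// -(ci (cst 1))//.
  by apply: eq_integral => w _; rewrite mul1r.
have [nu [nuA nuf]] := weighted_image (@measurable_id _ _ setT) mk (fun=> c0) kfin.
exists nu => [|g mg]; last by rewrite nuf//= ci.
exists [set u]; split; first exact: compact_set1.
have mS := @measurable_carrier R d m _ (@compact_set1 _ u).
rewrite nuA (_ : (fun x => x) @^-1` _ = ~` (@unit_cube R d `*` [set u]))//.
rewrite integral_mkcond integral_dirac ?diracT ?mul1e//; last first.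
  by apply/(measurable_restrict _ mS) => //; exact/measurable_EFinP/measurable_funTS.
by rewrite patchE memNset// => /(_ (conj cx erefl)).
Qed.

Section Duality.
Variables (R : realType) (d m : nat) (rho q : R) (f : 'cV[R]_d -> R).
Variables (a : 'cV[R]_d -> 'cV[R]_d) (B : 'cV[R]_d -> 'M[R]_(d, m)).
Variable P : regular rho q f a B.
Variable mu0 : 'cV[R]_d -> R.
Hypothesis dens : full_support_bounded_density mu0.
Local Notation vec := 'cV[R]_d.
Local Notation ctl := 'cV[R]_m.
Local Notation cost u := (ctrl_cost q u).
Implicit Types (U phi : vec -> R) (x : vec) (u : ctl).

Lemma Mplus_integrable_cost nu : Mplus nu ->
  nu.-integrable setT (EFin \o (fun z : Rvec R d * Rvec R m => f z.1 + cost z.2)).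
Proof.
move=> nuM; apply: Mplus_integrable => //; first exact: (measurable_running_cost P).
move=> N; have [C hC] := @ctrl_cost_bounded R m q N (lt_trans ltr01 (reg_q1 P)).
exists (fmax P + C) => x u uN; rewrite /= ger0_norm; last first.
  by rewrite addr_ge0 ?(reg_f0 P) ?(cost_ge0 P).
by rewrite lerD ?hC ?(reg_fmax P).
Qed.

Lemma Mplus_integrable_calL nu phi : Mplus nu -> C1_torus phi ->
  nu.-integrable setT (EFin \o (fun z : Rvec R d * Rvec R m => calL rho a B phi z.1 z.2)).
Proof.
move=> nuM phiC; apply: Mplus_integrable => //; first exact: (measurable_calL P phiC).
have [C C0 hC] := calL_bound P phiC.
move=> N; exists (C * (1 + N)) => x u uN /=.
by rewrite (le_trans (hC _ _))// ler_wpM2l// lerD2l.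
Qed.

(** Both integrals are finite, so the pointwise constraint of (D) may be
    integrated. *)
Lemma int_calL_le_primal nu U : Mplus nu -> dual_feasible rho q f a B U ->
  (int_calL rho a B nu U <= primal_obj q f nu)%E.
Proof.
move=> nuM [UC Usub]; apply: le_integral => //.
- exact: Mplus_integrable_calL.
- exact: Mplus_integrable_cost.
- by move=> z _; rewrite lee_fin.
Qed.

Lemma weak_duality : (val_D rho q f a B mu0 <= val_P rho q f a B mu0)%E.
Proof.
apply: ge_ereal_sup => _ [U UF <-]; apply: le_ereal_inf_tmp => _ [nu [nuM nuE] <-].
by rewrite -nuE; [exact: int_calL_le_primal|case: UF].
Qed.

Lemma C1_torus_obj_fin U : C1_torus U -> dual_obj mu0 U \is a fin_num.
Proof.
move=> [pU dU _]; apply: dual_obj_fin => // z; exact: differentiable_continuous.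
Qed.

(** Two extreme cases are used: c = 0, where the Lagrangian is the dual
    objective, and c -> +oo at a point that violates the constraint of (D). *)
Lemma lagrangian_point_mass U x u c : C1_torus U -> 0 <= c -> exists2 nu, Mplus nu &
  lagrangian rho q f a B mu0 nu U =
    (dual_obj mu0 U - (c * (calL rho a B U x u - (f x + cost u)))%:E)%E.
Proof.
move=> UC c0; have [nu nuM nuf] := point_mass u c0 (torus_rep_cube x).
exists nu => //; rewrite /lagrangian /primal_obj /int_calL.
rewrite (nuf _ (measurable_running_cost P)) (nuf _ (measurable_calL P UC)).
rewrite /= (calL_rep P)// (Zperiodic_rep (reg_fper P)).
rewrite -(fineK (C1_torus_obj_fin UC)) -EFinD -!EFinB; congr (_%:E); ring.
Qed.

(** If V is feasible, the Lagrangian exceeds dual_obj V by the integral of a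
    nonnegative function, with equality for the zero measure.  Otherwise a large
    mass at a violating point drives the Lagrangian to -oo. *)
Lemma lagrange_duality : lagrange_dual rho q f a B mu0.
Proof.
move=> U UC; have fU := C1_torus_obj_fin UC; case: ifPn => [/asboolP UF|/asboolPn UF].
  apply/eqP; rewrite eq_le; apply/andP; split.
    have [nu nuM nuE] := lagrangian_point_mass 0 0 UC (lexx 0).
    by apply: ereal_inf_lbound; exists nu => //; rewrite nuE mul0r sube0.
  apply: le_ereal_inf_tmp => _ [nu nuM <-].
  have iP := integrable_fin_num measurableT (Mplus_integrable_cost nuM).
  have iL := integrable_fin_num measurableT (Mplus_integrable_calL nuM UC).
  rewrite /lagrangian addeAC leeDr// sube_ge0; first exact: int_calL_le_primal.
  by rewrite iL.
have [x [u gap]] : exists x u, f x + cost u < calL rho a B U x u.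
  apply: contrapT => h; apply: UF; split=> // x u; rewrite leNgt.
  by apply/negP => xu; apply: h; exists x, u.
set g := calL rho a B U x u - (f x + cost u).
have g0 : 0 < g by rewrite subr_gt0.
apply: eq_ninfty => r.
(* This mass makes the Lagrangian equal to dual_obj U - |dual_obj U| - |r|,
   which is at most r. *)
pose c := (`|fine (dual_obj mu0 U)| + `|r|) / g.
have c0 : 0 <= c by apply: divr_ge0 (ltW g0); exact: addr_ge0.
have [nu nuM nuE] := lagrangian_point_mass x u UC c0.
apply: (@le_trans _ _ (lagrangian rho q f a B mu0 nu U)).
  by apply: ereal_inf_lbound; exists nu.
rewrite nuE -/g /c divfK ?gt_eqF// -(fineK fU) -EFinB lee_fin /=.
have := ler_norm (fine (dual_obj mu0 U)); have := ler_norm (- r); rewrite normrN; lra.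
Qed.

(** V* is squeezed between a feasible U and plan_value <= U + e. *)
Lemma Vstar_eq_plan_value x : Vstar rho q f a B x = (plan_value P x)%:E.
Proof.
apply/eqP; rewrite eq_le Vstar_le_plan_value/=; apply/lee_addgt0Pr => e e0.
have [U [UF VU]] := near_optimal_subsolution P e0.
rewrite (le_trans _ (leeD2r _ (subsolution_le_Vstar P x UF)))//.
by rewrite -EFinD lee_fin.
Qed.

Lemma int_VstarE : int_Vstar rho q f a B mu0 = dual_obj mu0 (plan_value P).
Proof. by apply: eq_integral => x _; rewrite Vstar_eq_plan_value EFinM. Qed.

Lemma int_Vstar_le_val_D : (int_Vstar rho q f a B mu0 <= val_D rho q f a B mu0)%E.
Proof.
rewrite int_VstarE; apply/lee_addgt0Pr => e e0.
have [U [UF VU]] := near_optimal_subsolution P e0.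
have [[pU dU _] _] := UF.
have cU : continuous U by move=> z; exact: differentiable_continuous.
apply: (@le_trans _ _ (dual_obj mu0 U + e%:E)%E); last first.
  by apply: leeD2r; apply: ereal_sup_ubound; exists U.
rewrite -(dual_obj_addc dens e cU pU); apply: (dual_obj_le dens) => //.
- exact: plan_value_cont.
- exact: plan_value_per.
- by apply: continuousD_fun => //; exact: cst_continuous.
- by move=> x i; rewrite pU.
Qed.

Lemma val_P_le_int_Vstar : (val_P rho q f a B mu0 <= int_Vstar rho q f a B mu0)%E.
Proof.
rewrite int_VstarE; apply/lee_addgt0Pr => e e0.
have [nu nuF nuV] := near_optimal_measure P dens e0.
by apply: le_trans nuV; apply: ereal_inf_lbound; exists nu.
Qed.

End Duality.

(** The drift is a x + B x *m u, with a and B Lipschitz, so it is Lipschitz in x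
    with a constant affine in |u|; periodicity turns the Lipschitz bounds into
    bounds.  The flows exist by Picard iteration and are chosen once and for
    all. *)
Lemma regular_data (R : realType) (d m : nat) (rho q : R)
    (f : 'cV[R]_d -> R) (a : 'cV[R]_d -> 'cV[R]_d) (B : 'cV[R]_d -> 'M[R]_(d, m)) :
  0 < rho -> 1 < q -> q <= 2 -> Zperiodic f -> Zperiodic a -> Zperiodic B ->
  (forall x, 0 <= f x) -> lipschitz f -> lipschitz a -> lipschitz B ->
  inhabited (regular rho q f a B).
Proof.
move=> rho0 q1 q2 pf pa pB f0 /lipschitzP[Lf Lf0 lf] /lipschitzP[La La0 la] /lipschitzP[LB LB0 lB].
have m0 : 0 <= m%:R :> R by [].
pose L := Lf + La + m%:R * LB.
have L0 : 0 < L by rewrite ltr_wpDr ?addr_gt0// mulr_ge0// ltW.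
have lb u x y : `|drift a B x u - drift a B y u| <= L * (1 + `|u|) * `|x - y|.
  rewrite (_ : _ - _ = (a x - a y) + (B x - B y) *m u); last first.
    by rewrite mulmxBl /drift opprD addrACA.
  rewrite (le_trans (ler_normD _ _))//.
  have h1 := la x y; have h2 := mulmx_norm (B x - B y) u.
  have h3 : m%:R * `|B x - B y| * `|u| <= m%:R * (LB * `|x - y|) * `|u|.
    by rewrite ler_wpM2r// ler_wpM2l.
  have n1 := normr_ge0 u; have n2 := normr_ge0 (x - y).
  have k1 : 0 <= Lf * `|x - y| by rewrite mulr_ge0// ltW.
  have k2 : 0 <= (Lf + La) * `|u| * `|x - y| by rewrite !mulr_ge0// addr_ge0// ltW.
  have k3 : 0 <= m%:R * LB * `|x - y| by rewrite !mulr_ge0// ltW.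
  by rewrite /L; nra.
have [flow flowP] : exists flow : 'cV[R]_m -> 'cV[R]_d -> R -> 'cV[R]_d,
    forall u x, solution (fun y => drift a B y u) x (flow u x).
  have /choice[g gP] : forall p : 'cV[R]_m * 'cV[R]_d, exists y,
      solution (fun y => drift a B y p.1) p.2 y.
    move=> [u x]; apply: (solution_exists (lb u)).
    by rewrite mulr_gt0// ltr_pwDl.
  by exists (fun u x => g (u, x)) => u x; exact: (gP (u, x)).
have bf x : f x <= `|f 0| + Lf := le_trans (ler_norm _) (lip_periodic_bounded pf lf (ltW Lf0) x).
pose S := (`|a 0| + La) + m%:R * (`|B 0| + LB).
have bb x u : `|drift a B x u| <= S * (1 + `|u|).
  rewrite (le_trans (ler_normD _ _))//.
  have h1 := lip_periodic_bounded pa la (ltW La0) x.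
  have h2 := mulmx_norm (B x) u; have h3 := lip_periodic_bounded pB lB (ltW LB0) x.
  have h4 : m%:R * `|B x| * `|u| <= m%:R * (`|B 0| + LB) * `|u|.
    by rewrite ler_wpM2r// ler_wpM2l.
  have n1 := normr_ge0 u.
  have k1 : 0 <= (`|a 0| + La) * `|u| by rewrite mulr_ge0// addr_ge0// ltW.
  have k2 : 0 <= m%:R * (`|B 0| + LB) by rewrite mulr_ge0// addr_ge0// ltW.
  by rewrite /S; lra.
constructor; apply: (@Regular _ _ _ _ _ _ _ _ rho0 q1 q2 pf pa pB f0 L L0 _ lb S bb _ bf flow flowP).
move=> x y; rewrite (le_trans (lf x y))// ler_wpM2r// /L.
by rewrite -addrA lerDl addr_ge0 ?mulr_ge0// ltW.
Qed.

Theorem theorem1 (R : realType) (d m : nat) (rho q : R)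
    (f : 'cV[R]_d -> R) (a : 'cV[R]_d -> 'cV[R]_d)
    (B : 'cV[R]_d -> 'M[R]_(d, m)) (mu0 : 'cV[R]_d -> R)
    (d_ge1 : (1 <= d)%N) (m_ge1 : (1 <= m)%N)
    (rho_gt0 : 0 < rho) (q_gt1 : 1 < q) (q_le2 : q <= 2)
    (f_per : Zperiodic f) (a_per : Zperiodic a) (B_per : Zperiodic B)
    (f_ge0 : forall x, 0 <= f x)
    (mu0_density : full_support_bounded_density mu0)
    (f_lip : lipschitz f) (a_lip : lipschitz a) (B_lip : lipschitz B)
    (a_in_range_B : exists alpha : 'cV[R]_d -> 'cV[R]_m,
       Linfty_torus alpha /\ forall x, a x = B x *m alpha x) :
  [/\ [/\ primal_feasible rho a B mu0 !=set0,
          dual_feasible rho q f a B !=set0,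
          lagrange_dual rho q f a B mu0,
          (val_D rho q f a B mu0 <= val_P rho q f a B mu0)%E
        & (int_Vstar rho q f a B mu0 <= val_D rho q f a B mu0)%E],
      val_P rho q f a B mu0 = val_D rho q f a B mu0
    & val_P rho q f a B mu0 = int_Vstar rho q f a B mu0 /\
      val_D rho q f a B mu0 = int_Vstar rho q f a B mu0].
Proof.
have [P] := regular_data rho_gt0 q_gt1 q_le2 f_per a_per B_per f_ge0 f_lip a_lip B_lip.
have DP := weak_duality P mu0.
have VD := int_Vstar_le_val_D P mu0_density.
have PV := val_P_le_int_Vstar P mu0_density.
have eqDV : val_D rho q f a B mu0 = int_Vstar rho q f a B mu0.
  by apply/eqP; rewrite eq_le VD (le_trans DP PV).
have eqPV : val_P rho q f a B mu0 = int_Vstar rho q f a B mu0.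
  by apply/eqP; rewrite eq_le PV (le_trans VD DP).
split; [split=> //|by rewrite eqPV|by []].
- by have [nu nuF _] := near_optimal_measure P mu0_density ltr01; exists nu.
- by have [U [UF _]] := near_optimal_subsolution P ltr01; exists U.
- exact: (lagrange_duality P mu0_density).
Qed.
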